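(* Let $\omega$ be a non-quasianalytic concave weight function. Then for every $d\ge1$ both rings ${}_d\mathcal{E}^{\{\omega\}}$ and ${}_d\mathcal{E}^{(\omega)}$ have property $(\mathscr{D})$.
   Context: A weight function is a continuous increasing $\omega:[0,\infty)\to[0,\infty)$ with $\omega(2t)=O(\omega(t))$, $\omega(t)=o(t)$, $\log t=o(\omega(t))$ as $t\to\infty$, and such that $\varphi_\omega(t):=\omega(e^t)$ is convex on $[0,\infty)$. It is non-quasianalytic if $\int_1^\infty\omega(t)t^{-2}\,dt<\infty$. Let $\varphi_\omega^*(s):=\sup_{t\ge0}(st-\varphi_\omega(t))$. For open $U\subseteq\mathbb{R}^d$ and $\rho>0$, $\mathcal{B}^\omega_\rho(U)$ is the set of $f\in C^\infty(U)$ with $\sup_{x\in U,\alpha\in\mathbb{N}^d}|\partial^\alpha f(x)|e^{-\varphi_\omega^*(\rho|\alpha|)/\rho}<\infty$. $\mathcal{E}^{\{\omega\}}(U)$ is the set of $f\in C^\infty(U)$ such that for every relatively compact open $V\subseteq U$ there is $n\in\mathbb{N}_{\ge1}$ with $f|_V\in\mathcal{B}^\omega_n(V)$; $\mathcal{E}^{(\omega)}(U)$ is the set of $f$ with $f|_V\in\mathcal{B}^\omega_{1/n}(V)$ for all such $V$ and all $n\ge1$. ${}_d\mathcal{E}^{\{\omega\}}$ (resp. ${}_d\mathcal{E}^{(\omega)}$) is the ring of germs at $0\in\mathbb{R}^d$ of complex valued functions of class $\mathcal{E}^{\{\omega\}}$ (resp. $\mathcal{E}^{(\omega)}$). A subring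 $\mathcal{S}$ of the ring of germs at $0\in\mathbb{R}^d$ of complex valued $C^\infty$ functions has property $(\mathscr{D})$ if for every complex valued function germ $f$ at $0$: if $f^j,f^{j+1}\in\mathcal{S}$ for some integer $j\ge1$, then $f\in\mathcal{S}$. *)

(* Defs.v *)
From mathcomp Require Import all_boot all_order all_algebra.
From mathcomp Require Import all_classical all_reals all_analysis.
From mathcomp.real_closed Require Import complex.
Set Implicit Arguments. Unset Strict Implicit. Unset Printing Implicit Defensive.
Import Order.TTheory GRing.Theory Num.Theory.
Import numFieldNormedType.Exports.
Local Open Scope classical_set_scope.
Local Open Scope ring_scope.

Section Defs.
Variable R : realType.

Definition phi_w (w : R -> R) (t : R) : R := w (expR t).

Definition phi_star (w : R -> R) (s : R) : R :=
  sup [set s * t - phi_w w t | t in [set t : R | 0 <= t]].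

Definition convex_on_nonneg (g : R -> R) : Prop :=
  forall s t l : R, 0 <= s -> 0 <= t -> 0 <= l -> l <= 1 ->
    g (l * s + (1 - l) * t) <= l * g s + (1 - l) * g t.

Definition concave_on_nonneg (g : R -> R) : Prop :=
  forall s t l : R, 0 <= s -> 0 <= t -> 0 <= l -> l <= 1 ->
    l * g s + (1 - l) * g t <= g (l * s + (1 - l) * t).

Definition weight_function (w : R -> R) : Prop :=
  (forall t, 0 <= t -> 0 <= w t) /\
  {within [set t : R | 0 <= t], continuous w} /\
  (forall s t, 0 <= s -> s < t -> w s < w t) /\
  (exists C T : R, forall t, T <= t -> w (2 * t) <= C * w t) /\
  (forall e : R, 0 < e -> exists T : R, forall t, T <= t -> w t <= e * t) /\
  (forall e : R, 0 < e -> exists T : R, forall t, T <= t -> 0 < t ->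
      ln t <= e * w t) /\
  convex_on_nonneg (phi_w w).

Definition non_quasianalytic (w : R -> R) : Prop :=
  (\int[@lebesgue_measure R]_(t in `[1%R, +oo[) ((w t / (t ^+ 2))%:E) < +oo)%E.

Definition e_dir (d : nat) (i : 'I_d) : 'rV[R]_d := delta_mx 0 i.

Definition pd (d : nat) (i : 'I_d) (g : 'rV[R]_d -> R) : 'rV[R]_d -> R :=
  fun x => derive g x (e_dir i).

Definition pds (d : nat) (s : seq 'I_d) (g : 'rV[R]_d -> R) : 'rV[R]_d -> R :=
  foldr (fun i h => pd i h) g s.

Definition palpha (d : nat) (alpha : 'I_d -> nat) (g : 'rV[R]_d -> R)
  : 'rV[R]_d -> R :=
  pds (flatten [seq nseq (alpha i) i | i <- enum 'I_d]) g.

Definition length_mi (d : nat) (alpha : 'I_d -> nat) : nat :=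
  (\sum_(i < d) alpha i)%N.

Definition smooth_real_on (d : nat) (U : set 'rV[R]_d) (g : 'rV[R]_d -> R)
  : Prop :=
  forall (s : seq 'I_d) (x : 'rV[R]_d), U x ->
    {for x, continuous (pds s g)} /\ (forall i : 'I_d, derivable (pds s g) x (e_dir i)).

Definition ReF (d : nat) (f : 'rV[R]_d -> R[i]) : 'rV[R]_d -> R :=
  fun x => complex.Re (f x).
Definition ImF (d : nat) (f : 'rV[R]_d -> R[i]) : 'rV[R]_d -> R :=
  fun x => complex.Im (f x).

Definition smooth_on (d : nat) (U : set 'rV[R]_d) (f : 'rV[R]_d -> R[i]) : Prop :=
  smooth_real_on U (ReF f) /\ smooth_real_on U (ImF f).

Definition abs_palpha (d : nat) (alpha : 'I_d -> nat) (f : 'rV[R]_d -> R[i])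
  (x : 'rV[R]_d) : R :=
  Num.sqrt (palpha alpha (ReF f) x ^+ 2 + palpha alpha (ImF f) x ^+ 2).

Definition B_w (w : R -> R) (rho : R) (d : nat) (U : set 'rV[R]_d)
  (f : 'rV[R]_d -> R[i]) : Prop :=
  smooth_on U f /\
  exists C : R, forall (x : 'rV[R]_d) (alpha : 'I_d -> nat), U x ->
    abs_palpha alpha f x * expR (- (phi_star w (rho * (length_mi alpha)%:R) / rho))
      <= C.

Definition rel_compact_open_in (d : nat) (V U : set 'rV[R]_d) : Prop :=
  open V /\ compact (closure V) /\ closure V `<=` U.

Definition E_roumieu (w : R -> R) (d : nat) (U : set 'rV[R]_d)
  (f : 'rV[R]_d -> R[i]) : Prop :=
  smooth_on U f /\
  forall V, rel_compact_open_in V U -> exists n : nat, (1 <= n)%N /\ B_w w n%:R V f.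

Definition E_beurling (w : R -> R) (d : nat) (U : set 'rV[R]_d)
  (f : 'rV[R]_d -> R[i]) : Prop :=
  smooth_on U f /\
  forall V, rel_compact_open_in V U -> forall n : nat, (1 <= n)%N ->
    B_w w (n%:R)^-1 V f.

Definition germ_in (d : nat)
  (E : set 'rV[R]_d -> ('rV[R]_d -> R[i]) -> Prop) (f : 'rV[R]_d -> R[i]) : Prop :=
  exists U : set 'rV[R]_d, [/\ open U, U 0 & E U f].

Definition property_D (d : nat)
  (E : set 'rV[R]_d -> ('rV[R]_d -> R[i]) -> Prop) : Prop :=
  forall (f : 'rV[R]_d -> R[i]) (j : nat), (1 <= j)%N ->
    germ_in E (fun x => f x ^+ j) -> germ_in E (fun x => f x ^+ j.+1) ->
    germ_in E f.

End Defs.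

(* Main.v *)
(** Along a line through a point [x] in direction [v], the Taylor polynomials [G]
    and [H] of [f^j] and [f^(j+1)] satisfy [G^(j+1) = H^j] modulo [X^N], and the
    formal Taylor series of [f] is [F = H / G]. The heart of the matter is a bound
    on the first coefficients of [F] that does not depend on [x] and [v]: if the
    coefficients of [G] and [H] are at most 1 in absolute value and [G(0) <> 0],
    then [|F_i| <= K^N] for [i < kap], where [N = j (j+1) kap]. Put [M = j kap] and
    replace [G] by [D = G + (N+1) X^N - w X^M], which does not change [F_i]. All
    roots [a] of [D] lie in the unit disc; there [G + (N+1) X^N] has absolute value
    at most [|a|^M], so [|H(a)| <= c |a|^((j+1) kap)] because [G^(j+1) = H^j] modulo
    [X^N]. Euler's formula reads [F_i = - sum_a H(a) / (a^(i+1) D'(a))], and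
    [|a D'(a)| >= B^(-N) |a|^M] as soon as [w] keeps away from the finitely many
    critical values of the rational function [(G + (N+1) X^N) / X^M].

    Because [f] is determined by [f^j] and [f^(j+1)] in a Hoelder continuous way,
    it is approximated by [F] along every line, uniformly. Uniform expansions
    along all lines are inherited by partial derivatives, so [f] is smooth, and
    finite differences recover the partial derivatives of [f] from the
    coefficients [F_i]. Finally, with [W_i = exp (phi* (rho i) / rho)], concavity of
    [w] makes [W_i^(1/i) / i] nondecreasing, so that a dilation of the variable
    normalises [G] and [H]; the loss of the factor [K^N] and of the passage from
    order [N] to order [i] is absorbed by multiplying [rho] by a constant. *)

Require Import Defs.
From mathcomp Require Import all_boot all_order all_algebra.
From mathcomp Require Import all_classical all_reals all_analysis.
From mathcomp.real_closed Require Import complex.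
From mathcomp Require Import ring lra zify.
Set Implicit Arguments. Unset Strict Implicit. Unset Printing Implicit Defensive.
Import Order.TTheory GRing.Theory Num.Theory.
Import numFieldNormedType.Exports.
Local Open Scope classical_set_scope.
Local Open Scope ring_scope.

(** * Polynomials: interpolation, coefficient majorants, root separation *)

Section Lagrange.
Variable F : fieldType.
Implicit Types (rs : seq F) (P : {poly F}).

(** Dividing [H] by [G] directly produces powers of 1 / G(0), and G(0) = f(x)^j is arbitrarily small
    near the zeros of [f]. The cancellation has to come from the relation between [G] and [H], and
    Euler's formula shows it root by root: a small root [a] of [D] gives a small denominator, but it
    also forces H(a) to be small. The parameter [w] keeps the roots of [D] apart. Only N + 1 values
    must be avoided, so the unit disc contains a point at distance at least 1 / (2 (N + 2)) from all
    of them, and every loss is at most exponential in [N]. Exponential losses are harmless, since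
    w(A t) <= L w(t) + B.

    For derivatives of order m the proof takes N = j (j+1) (j+1) (m+1). The factor j (j+1) makes the
    orders of numerator and denominator match at each root; the other j+1 pays for the Hoelder
    exponent 1 / (j+1) with which [f] is recovered. The normalising dilation depends on [N], hence
    on m, so each order of derivative is estimated with its own pair of Taylor polynomials. The
    factor by which [rho] grows depends on [j], [d] and the weight only, so one estimate serves both
    rings. *)

Definition lagr rs (a : F) : {poly F} := \prod_(b <- rs | b != a) ('X - b%:P).

Lemma prod_XsubC_lagr rs a : uniq rs -> a \in rs ->
  \prod_(b <- rs) ('X - b%:P) = ('X - a%:P) * lagr rs a.
Proof. by move=> urs ars; rewrite (bigD1_seq a). Qed.

Lemma lagr_eval0 rs a b : b \in rs -> b != a -> (lagr rs a).[b] = 0.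
Proof.
move=> brs ba; rewrite /lagr horner_prod; apply/eqP; rewrite prodf_seq_eq0.
by apply/hasP; exists b => //; rewrite ba !hornerE subrr eqxx.
Qed.

Lemma lagr_eval_neq0 rs a : (lagr rs a).[a] != 0.
Proof.
rewrite /lagr horner_prod prodf_seq_neq0; apply/allP => b _.
by apply/implyP => ba; rewrite !hornerE subr_eq0 eq_sym.
Qed.

Lemma deriv_prod_XsubC_eval rs a : uniq rs -> a \in rs ->
  (\prod_(b <- rs) ('X - b%:P))^`().[a] = (lagr rs a).[a].
Proof.
move=> urs ars; rewrite (prod_XsubC_lagr urs ars) derivM derivXsubC mul1r.
by rewrite hornerD hornerM !hornerE subrr mul0r addr0.
Qed.

Lemma size_lagr rs a : uniq rs -> a \in rs -> size (lagr rs a) = size rs.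
Proof.
move=> urs ars; have := congr1 (fun p : {poly F} => size p) (prod_XsubC_lagr urs ars).
rewrite size_prod_XsubC size_mul ?polyXsubC_eq0 //.
  by rewrite size_XsubC /= => -[].
by apply: contra_neq (lagr_eval_neq0 rs a) => ->; rewrite horner0.
Qed.

Lemma lagr_coef_last rs a : uniq rs -> a \in rs -> (lagr rs a)`_(size rs).-1 = 1.
Proof.
move=> urs ars; rewrite -(size_lagr urs ars) -lead_coefE; apply/eqP.
by rewrite -[_ == _]/(_ \is monic) monic_prod // => b _; rewrite monicXsubC.
Qed.

Lemma lagrange_interpolation rs P : uniq rs -> (size P <= size rs)%N ->
  P = \sum_(a <- rs) (P.[a] / (lagr rs a).[a]) *: lagr rs a.
Proof.
move=> urs sP; apply/eqP; rewrite -subr_eq0.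
set S := \sum_(a <- rs) _.
have sS : (size S <= size rs)%N.
  rewrite /S big_seq; elim/big_ind : _ => [|p q sp sq|a ars]; first by rewrite size_poly0.
    by rewrite (leq_trans (size_polyD _ _)) // geq_max sp.
  by rewrite (leq_trans (size_scale_leq _ _)) // size_lagr.
apply/negP => /negP nz.
have rt : all (root (P - S)) rs.
  apply/allP => b brs; rewrite rootE hornerD hornerN /S horner_sum subr_eq0.
  rewrite (bigD1_seq b) //= hornerZ mulfVK ?lagr_eval_neq0 // big_seq_cond big1 ?addr0 //.
  move=> a /andP[ars ab]; by rewrite hornerZ [X in _ * X](lagr_eval0 brs) ?mulr0 // eq_sym.
have := max_poly_roots nz rt urs.
rewrite ltnNge (leq_trans (size_polyD _ _)) // size_polyN geq_max sP; exact: sS.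
Qed.

(** Compare the coefficients of degree [(size rs).-1] in the interpolation formula: the Lagrange
    basis polynomials are monic of that degree before normalisation. *)
Lemma euler_sum rs P : uniq rs -> (size P <= size rs)%N ->
  \sum_(a <- rs) P.[a] / (\prod_(b <- rs) ('X - b%:P))^`().[a] = P`_(size rs).-1.
Proof.
move=> urs sP; rewrite [in RHS](lagrange_interpolation urs sP) coef_sum.
rewrite [LHS]big_seq [RHS]big_seq; apply: eq_bigr => a ars.
by rewrite coefZ lagr_coef_last // mulr1 deriv_prod_XsubC_eval.
Qed.

End Lagrange.

Lemma eq_leW (R : numDomainType) (x y : R) : x = y -> x <= y.
Proof. by move=> ->. Qed.

Section Majorant.
Variable C : numDomainType.
Implicit Types (P Q : {poly C}) (x : C).

(** The value at [x] of [P] with its coefficients replaced by their absolute values. It is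
    submultiplicative and bounds [P] on the disc of radius [x]; at 1 it is the l1 norm. *)
Definition nrmp x P : C := \sum_(i < size P) `|P`_i| * x ^+ i.

Lemma nrmp_wide n x P : (size P <= n)%N -> nrmp x P = \sum_(i < n) `|P`_i| * x ^+ i.
Proof.
move=> sPn; rewrite /nrmp (big_ord_widen n (fun i => `|P`_i| * x ^+ i) sPn) big_mkcond /=.
by apply: eq_bigr => i _; case: ltnP => // si; rewrite nth_default // normr0 mul0r.
Qed.

Lemma nrmp_ge0 x P : 0 <= x -> 0 <= nrmp x P.
Proof. by move=> x0; apply: sumr_ge0 => i _; rewrite mulr_ge0 // exprn_ge0. Qed.

Lemma nrmp_coef x P i : 0 <= x -> `|P`_i| * x ^+ i <= nrmp x P.
Proof.
move=> x0; have [iP|iP] := ltnP i (size P); last first.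
  by rewrite nth_default // normr0 mul0r nrmp_ge0.
rewrite /nrmp (bigD1 (Ordinal iP)) //= lerDl sumr_ge0 // => k _.
by rewrite mulr_ge0 // exprn_ge0.
Qed.

Lemma nrmp_horner P a : `|P.[a]| <= nrmp `|a| P.
Proof.
rewrite horner_coef (le_trans (ler_norm_sum _ _ _)) // ler_sum // => i _.
by rewrite normrM normrX.
Qed.

Lemma horner_le_nrmp1 P t : `|t| <= 1 -> `|P.[t]| <= nrmp 1 P.
Proof.
move=> t1; apply: (le_trans (nrmp_horner _ _)); apply: ler_sum => i _.
by rewrite ler_wpM2l // expr1n exprn_ile1.
Qed.

Lemma nrmpD x P Q : 0 <= x -> nrmp x (P + Q) <= nrmp x P + nrmp x Q.
Proof.
move=> x0; pose n := maxn (size P) (size Q).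
rewrite (@nrmp_wide n _ (P + Q)) ?size_polyD //.
rewrite (@nrmp_wide n _ P) ?leq_maxl // (@nrmp_wide n _ Q) ?leq_maxr //.
rewrite -big_split /= ler_sum // => i _.
by rewrite coefD -mulrDl ler_wpM2r ?exprn_ge0 // ler_normD.
Qed.

Lemma nrmpZ x c P : nrmp x (c *: P) = `|c| * nrmp x P.
Proof.
rewrite (@nrmp_wide (size P)) ?size_scale_leq // /nrmp big_distrr /=.
by apply: eq_bigr => i _; rewrite coefZ normrM mulrA.
Qed.

Lemma nrmpN x P : nrmp x (- P) = nrmp x P.
Proof. by rewrite -scaleN1r nrmpZ normrN1 mul1r. Qed.

Lemma nrmp_cons x P c : nrmp x (P * 'X + c%:P) = nrmp x P * x + `|c|.
Proof.
rewrite (@nrmp_wide (size P).+1); last first.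
  rewrite (leq_trans (size_polyD _ _)) // geq_max (leq_trans (size_polyC_leq1 _)) // andbT.
  by rewrite (leq_trans (size_polyMleq _ _)) // size_polyX addn2.
rewrite big_ord_recl /= coefD coefMX coefC /= add0r expr0 mulr1 addrC; congr (_ + _).
rewrite /nrmp big_distrl /=; apply: eq_bigr => i _.
by rewrite coefD coefMX coefC /= addr0 -mulrA -exprSr.
Qed.

Lemma nrmp0 x : nrmp x 0 = 0.
Proof. by rewrite /nrmp size_poly0 big_ord0. Qed.

Lemma nrmpC x c : nrmp x c%:P = `|c|.
Proof. by have := nrmp_cons x 0 c; rewrite nrmp0 !mul0r !add0r. Qed.

Lemma nrmpM x P Q : 0 <= x -> nrmp x (P * Q) <= nrmp x P * nrmp x Q.
Proof.
move=> x0; elim/poly_ind: P => [|P c IH]; first by rewrite mul0r nrmp0 mul0r.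
rewrite nrmp_cons !mulrDl (le_trans (nrmpD _ _ x0)) // mul_polyC nrmpZ lerD2r.
rewrite -mulrA ['X * Q]mulrC mulrA.
by have := nrmp_cons x (P * Q) 0; rewrite addr0 normr0 addr0 => ->; rewrite mulrAC ler_wpM2r.
Qed.

Lemma nrmpX x P k : 0 <= x -> nrmp x (P ^+ k) <= nrmp x P ^+ k.
Proof.
move=> x0; elim: k => [|k IH]; first by rewrite !expr0 nrmpC normr1.
rewrite !exprS (le_trans (nrmpM _ _ x0)) // ler_wpM2l ?nrmp_ge0 //.
Qed.

Lemma nrmp_prod_XsubC x (rs : seq C) : 0 <= x ->
  nrmp x (\prod_(c <- rs) ('X - c%:P)) <= \prod_(c <- rs) (x + `|c|).
Proof.
move=> x0; elim: rs => [|c rs IH]; first by rewrite !big_nil nrmpC normr1.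
rewrite !big_cons (le_trans (nrmpM _ _ x0)) //.
have -> : nrmp x ('X - c%:P) = x + `|c|.
  by have := nrmp_cons x 1 (- c); rewrite mul1r polyCN normrN nrmpC normr1 mul1r.
by rewrite ler_wpM2l // addr_ge0.
Qed.

End Majorant.

Section RootSeparation.
Variable C : numClosedFieldType.
Implicit Types (G Q R : {poly C}).

(* The numerator of the derivative of [G / X^M]. *)
Definition wronsk (M : nat) G : {poly C} := 'X * G^`() - M%:R *: G.

Lemma coef_wronsk M G m : (wronsk M G)`_m = (m%:R - M%:R) * G`_m.
Proof.
rewrite /wronsk coefB coefZ coefXM mulrBl; congr (_ - _).
case: m => [|m] /=; first by rewrite mul0r.
by rewrite coef_deriv mulr_natl.
Qed.

(* Expanded at the zero [c] of [R], the equation [X R' - M R = Q] becomes a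
   recursion for the coefficients of [R]. *)
Lemma wronsk_shift_bound (M : nat) R (c rho : C) m :
  R.[c] = 0 -> 0 <= rho -> rho <= `|c| -> c != 0 ->
  `|(R \Po ('X + c%:P))`_m| * rho ^+ m <=
  'C(M + m, m)%:R * nrmp rho (wronsk M R \Po ('X + c%:P)).
Proof.
move=> Rc rho0 rhoc c0; set q := wronsk _ _ \Po _; set r := R \Po _.
have S0 : 0 <= nrmp rho q by exact: nrmp_ge0.
have eq : q = ('X + c%:P) * r^`() - M%:R *: r.
  rewrite /q /wronsk comp_polyD comp_polyM comp_polyX -scaleNr comp_polyZ scaleNr.
  by rewrite /r deriv_comp derivD derivX derivC addr0 mulr1.
elim: m => [|m IH].
  rewrite expr0 mulr1 /r -horner_coef0 horner_comp !hornerE /= Rc normr0.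
  by rewrite mulr_ge0 // ler0n.
have eqm : c * (r`_m.+1 *+ m.+1) = q`_m - (m%:R - M%:R) * r`_m.
  rewrite eq coefB mulrDl coefD coefZ coefXM coefCM !coef_deriv.
  case: m {IH} => [|m] /=; first by rewrite mulr1n; ring.
  by rewrite -[r`_m.+2 *+ _]mulr_natl -[r`_m.+1 *+ _]mulr_natl; ring.
have m1 : (0 : C) < m.+1%:R by rewrite ltr0n.
rewrite -(ler_pM2l m1) mulrA -natrM.
(* The binomials are made for this recursion: |m - M| <= M + m uses M + m copies of the previous
   one, and the source term uses one more. *)
have -> : (m.+1 * 'C(M + m.+1, m.+1) = (M + m.+1) * 'C(M + m, m))%N.
  by rewrite addnS -mul_bin_diag.
have step : m.+1%:R * (`|r`_m.+1| * rho ^+ m.+1) <=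
    `|m%:R - M%:R| * (`|r`_m| * rho ^+ m) + `|q`_m| * rho ^+ m.
  have -> : m.+1%:R * (`|r`_m.+1| * rho ^+ m.+1) = rho * (`|r`_m.+1 *+ m.+1| * rho ^+ m).
    by rewrite normrMn -mulr_natl exprS; ring.
  apply: (@le_trans _ _ (`|c| * (`|r`_m.+1 *+ m.+1| * rho ^+ m))).
    by rewrite ler_wpM2r // mulr_ge0 // exprn_ge0.
  rewrite mulrA -normrM eqm mulrA -mulrDl ler_wpM2r ?exprn_ge0 //.
  rewrite -[X in _ <= X + _]normrM [leRHS]addrC; exact: ler_normB.
apply: (le_trans step).
have h1 : `|m%:R - M%:R : C| <= (M + m)%:R.
  by rewrite (le_trans (ler_normB _ _)) // !normr_nat -natrD addnC.
have h2 : `|q`_m| * rho ^+ m <= 'C(M + m, m)%:R * nrmp rho q.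
  apply: (le_trans (nrmp_coef q m rho0)).
  by rewrite ler_peMl // ler1n bin_gt0 leq_addl.
apply: (@le_trans _ _ ((M + m)%:R * ('C(M + m, m)%:R * nrmp rho q) + 'C(M + m, m)%:R * nrmp rho q)).
  by rewrite lerD // ler_pM // mulr_ge0 // exprn_ge0.
by rewrite addnS natrM -addn1 natrD; apply: eq_leW; ring.
Qed.

Lemma dist_nat_ge1 (m n : nat) : m != n -> 1 <= `|m%:R - n%:R : C|.
Proof.
case: ltngtP => // [mn|nm] _.
  by rewrite distrC -natrB ?(ltnW mn) // normr_nat ler1n subn_gt0.
by rewrite -natrB ?(ltnW nm) // normr_nat ler1n subn_gt0.
Qed.

Lemma bin_leq_exp2 p q : ('C(p, q) <= 2 ^ p)%N.
Proof.
elim: p q => [|p IH] [|q]; rewrite ?bin0 ?expn_gt0 //.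
by rewrite binS expnS mul2n -addnn leq_add.
Qed.

Lemma sum_bin_diag_leq M n : (\sum_(i < n) 'C(M + i, i) <= 2 ^ (M + n))%N.
Proof.
elim: n => [|n IH]; first by rewrite big_ord0.
by rewrite big_ord_recr /= addnS expnS mul2n -addnn leq_add ?bin_leq_exp2 // (leq_trans (bin_leq_exp2 _ _)).
Qed.

Lemma nearest_point (rs : seq C) (a : C) : rs != [::] ->
  exists2 c, c \in rs & forall c', c' \in rs -> `|a - c| <= `|a - c'|.
Proof.
elim: rs => // b [_ _|b' rs IH _].
  by exists b; rewrite ?inE // => c'; rewrite inE => /eqP ->.
have [//|c cin cmin] := IH.
have /orP[le|le] := ger_leVge (normr_ge0 (a - b)) (normr_ge0 (a - c)).
  exists b; first by rewrite inE eqxx.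
  move=> c'; rewrite inE => /orP[/eqP ->//|/cmin]; exact: le_trans.
exists c; first by rewrite inE cin orbT.
by move=> c'; rewrite inE => /orP[/eqP ->//|/cmin].
Qed.

(** Away from the critical points: the factor m - M has absolute value at least 1 except at m = M,
    so the coefficients of [wronsk M G] dominate those of [G]. Each linear factor satisfies |a| +
    |c| <= 2 |a| + |a - c| <= 5 |a - c|, so the majorant of the product is comparable to its
    value. *)
Lemma wronsk_majorant N M G (k : C) rs a : (size G <= N.+1)%N -> size rs = N ->
  wronsk M G = k *: \prod_(c <- rs) ('X - c%:P) ->
  (forall c, c \in rs -> `|a| <= 2 * `|a - c|) ->
  `|G.[a] - G`_M * a ^+ M| <= 5 ^+ N * `|(wronsk M G).[a]|.
Proof.
move=> sG srs eQ far.
have a0 := normr_ge0 a.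
apply: (@le_trans _ _ (nrmp `|a| (wronsk M G))).
  have sQ : (size (wronsk M G) <= N.+1)%N.
    apply/leq_sizeP => i Ni; rewrite coef_wronsk [G`_i]nth_default ?mulr0 //.
    by rewrite (leq_trans sG).
  rewrite (nrmp_wide _ sQ) (horner_coef_wide _ sG).
  have -> : G`_M * a ^+ M = \sum_(i < N.+1) (if i == M :> nat then G`_i * a ^+ i else 0).
    have [MN|NM] := ltnP M N.+1.
      rewrite (bigD1 (Ordinal MN)) //= eqxx big1 ?addr0 // => i iM.
      by case: eqP => // iM'; case/eqP: iM; apply: val_inj.
    rewrite nth_default ?mul0r; last by rewrite (leq_trans sG).
    by rewrite big1 // => i _; case: eqP => // iM; have := ltn_ord i; rewrite iM ltnNge NM.
  rewrite -sumrB (le_trans (ler_norm_sum _ _ _)) // ler_sum // => i _.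
  case: eqP => [->|/eqP iM]; first by rewrite subrr normr0 mulr_ge0 // exprn_ge0.
  rewrite subr0 normrM normrX ler_wpM2r ?exprn_ge0 // coef_wronsk normrM.
  by rewrite ler_peMl // dist_nat_ge1.
rewrite eQ nrmpZ hornerZ normrM mulrCA ler_wpM2l //.
apply: (le_trans (nrmp_prod_XsubC _ a0)).
rewrite horner_prod normr_prod -srs.
have -> : 5 ^+ size rs = \prod_(c <- rs) (5 : C) by rewrite big_const_seq count_predT iter_mulr_1.
rewrite -big_split /= !big_seq ler_prod // => c cin.
rewrite addr_ge0 //= !hornerE.
have h := far c cin.
have h' : `|c| <= `|a| + `|a - c|.
  by rewrite (le_trans _ (ler_normB _ _)) // opprB addrC subrK.
apply: (le_trans (lerD h h')); rewrite addrA.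
apply: (le_trans (lerD (lerD (lexx _) h) (lexx _))); apply: eq_leW; ring.
Qed.

(** Near a critical point: [wronsk M] kills X^M, so a multiple of X^M may be subtracted from [G] to
    create a zero at [c]. The recursion at [c] then applies on the disc of radius |a - c|, where |a
    - c| + |c' - c| <= 3 |a - c'| because [c] is the nearest root. *)
Lemma wronsk_near N M G (k : C) rs a c : (M <= N)%N -> (size G <= N.+1)%N -> size rs = N ->
  wronsk M G = k *: \prod_(c <- rs) ('X - c%:P) -> c \in rs -> c != 0 ->
  (forall c', c' \in rs -> `|a - c| <= `|a - c'|) -> 2 * `|a - c| <= `|a| ->
  `|G.[a] - G.[c] / c ^+ M * a ^+ M| <= 2 ^+ (M + N.+1) * 3 ^+ N * `|(wronsk M G).[a]|.
Proof.
move=> MN sG srs eQ crs c0 near close.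
set rho := `|a - c|; have rho0 : 0 <= rho by exact: normr_ge0.
pose R := G - (G.[c] / c ^+ M) *: 'X^M.
have Rc : R.[c] = 0.
  by rewrite /R !hornerE mulfVK ?subrr // expf_neq0.
have Ra : R.[a] = G.[a] - G.[c] / c ^+ M * a ^+ M by rewrite /R !hornerE.
have eQR : wronsk M R = wronsk M G.
  apply/polyP => i; rewrite !coef_wronsk coefB coefZ coefXn.
  by case: eqP => [->|_]; rewrite ?subrr ?mul0r // mulr0 subr0.
have rhoc : rho <= `|c|.
  have : `|a| <= `|c| + rho by rewrite (le_trans _ (ler_normD _ _)) // addrC subrK.
  move/(le_trans close); rewrite -/rho mulr_natl mulr2n lerD2r //.
set q := wronsk M R \Po ('X + c%:P).
have S0 := nrmp_ge0 q rho0.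
rewrite -Ra; have -> : R.[a] = (R \Po ('X + c%:P)).[a - c] by rewrite horner_comp !hornerE subrK.
have sR : (size (R \Po ('X + c%:P)) <= N.+1)%N.
  rewrite size_comp_poly2; last by rewrite -[c]opprK polyCN size_XsubC.
  rewrite (leq_trans (size_polyD _ _)) // size_polyN geq_max sG.
  by rewrite (leq_trans (size_scale_leq _ _)) // size_polyXn ltnS.
apply: (le_trans (nrmp_horner _ _)); rewrite -/rho (nrmp_wide _ sR).
apply: (@le_trans _ _ (2 ^+ (M + N.+1) * nrmp rho q)).
  apply: (@le_trans _ _ (\sum_(i < N.+1) 'C(M + i, i)%:R * nrmp rho q)).
    by apply: ler_sum => i _; exact: wronsk_shift_bound.
  rewrite -mulr_suml ler_wpM2r // -natr_sum -natrX ler_nat.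
  exact: sum_bin_diag_leq.
rewrite -mulrA ler_wpM2l ?exprn_ge0 // /q eQR eQ comp_polyZ nrmpZ.
rewrite rmorph_prod hornerZ normrM mulrCA ler_wpM2l //.
have -> : \prod_(c' <- rs) (('X - c'%:P) \Po ('X + c%:P)) =
    \prod_(d <- [seq c' - c | c' <- rs]) ('X - d%:P).
  rewrite big_map; apply: eq_bigr => c' _.
  by rewrite comp_polyB comp_polyX comp_polyC polyCB opprB addrA.
apply: (le_trans (nrmp_prod_XsubC _ rho0)).
rewrite big_map horner_prod normr_prod -srs.
have -> : 3 ^+ size rs = \prod_(c <- rs) (3 : C) by rewrite big_const_seq count_predT iter_mulr_1.
rewrite -big_split /= !big_seq ler_prod // => c' cin.
rewrite addr_ge0 //= !hornerE.
have h := near c' cin.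
have h' : `|c' - c| <= `|a - c| + `|a - c'|.
  by rewrite (_ : c' - c = a - c - (a - c')) ?ler_normB //; ring.
apply: (le_trans (lerD h h')); rewrite addrA.
apply: (le_trans (lerD (lerD (lexx _) h) (lexx _))); apply: eq_leW; ring.
Qed.

(* At a point where [G / X^M] takes the value [w], its derivative is not small
   if [w] is far from the critical values of [G / X^M]. When no critical point
   is close to [a], the constant term [G`_M] of this Laurent polynomial plays
   the role of a critical value. *)
Lemma wronsk_root_lower N M G (k w d : C) rs a : (M < N)%N ->
  (size G <= N.+1)%N -> size rs = N -> wronsk M G = k *: \prod_(c <- rs) ('X - c%:P) ->
  0 \notin rs -> d <= `|w - G`_M| -> (forall c, c \in rs -> d <= `|w - G.[c] / c ^+ M|) ->
  G.[a] = w * a ^+ M -> d * `|a| ^+ M <= 12 ^+ N * `|(wronsk M G).[a]|.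
Proof.
move=> MN sG srs eQ rs0 dM dc Ga.
have rsn : rs != [::] by rewrite -size_eq0 srs -lt0n (leq_trans _ MN).
have [c crs near] := nearest_point a rsn.
have aM0 : 0 <= `|a| ^+ M by rewrite exprn_ge0.
have [far|close] := real_leP (normr_real a) (realM (realn C 2) (normr_real (a - c))).
  apply: (@le_trans _ _ `|G.[a] - G`_M * a ^+ M|).
    by rewrite Ga -mulrBl normrM normrX ler_wpM2r.
  apply: (le_trans (wronsk_majorant sG srs eQ _)).
    by move=> c' c'rs; rewrite (le_trans far) // ler_wpM2l // near.
  by rewrite ler_wpM2r // lerXn2r ?nnegrE // ler_nat.
apply: (@le_trans _ _ `|G.[a] - G.[c] / c ^+ M * a ^+ M|).
  by rewrite Ga -mulrBl normrM normrX ler_wpM2r // dc.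
apply: (le_trans (wronsk_near (ltnW MN) sG srs eQ crs _ near (ltW close))).
  by apply: contraNneq rs0 => <-.
rewrite ler_wpM2r //.
(* [M < N] bounds 2^(M+N+1) by 4^N, whence 12 = 4 * 3; the other case only needed 5. *)
have -> : 12 = 2 ^+ 2 * 3 :> C by ring.
rewrite exprMn -exprM ler_wpM2r ?exprn_ge0 // ler_eXn2l ?ltr1n //.
lia.
Qed.

End RootSeparation.

(** * The coefficients of the quotient [H / G] *)

Section DvdXn.
Variable F : fieldType.
Implicit Types P Q : {poly F}.

Lemma dvdXnP k P : reflect (forall m, (m < k)%N -> P`_m = 0) ('X^k %| P).
Proof.
apply: (iffP idP) => [/dvdpP[Q ->] m mk|h]; first by rewrite coefMXn mk.
rewrite -(poly_take_drop k P); suff -> : take_poly k P = 0 by rewrite add0r dvdp_mulIr.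
by apply/polyP => m; rewrite coef_take_poly coef0; case: ifP => // /h.
Qed.

Lemma dvdXn_take k P : 'X^k %| P - take_poly k P.
Proof. by apply/dvdXnP => m mk; rewrite coefB coef_take_poly mk subrr. Qed.

Lemma dvdp_subX P Q d n : d %| P - Q -> d %| P ^+ n - Q ^+ n.
Proof. by move=> h; rewrite subrXX dvdp_mulr. Qed.

Lemma dvdp_sub_trans P Q R d : d %| P - Q -> d %| Q - R -> d %| P - R.
Proof. by move=> h1 h2; rewrite -(subrKA Q) dvdp_add. Qed.

Lemma dvdp_sub_sym P Q d : d %| P - Q -> d %| Q - P.
Proof. by move=> h; rewrite -opprB dvdpNr. Qed.

Lemma dvdXn_leq m n P : (m <= n)%N -> 'X^n %| P -> 'X^m %| P.
Proof. by move=> mn; apply: dvdp_trans; rewrite dvdp_exp2l. Qed.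

(* Euler's identity for the polynomial [(H - T D) / X^(i+1)], where [T] is the
   truncation of [f] at order [i]. *)
Lemma coef_quotient_euler (rs : seq F) (lc : F) (D H f : {poly F}) i :
  D = lc *: \prod_(a <- rs) ('X - a%:P) -> lc != 0 -> uniq rs -> 0 \notin rs ->
  (0 < size rs)%N -> (size H <= size rs)%N -> 'X^(i.+1) %| H - f * D ->
  f`_i = - \sum_(a <- rs) H.[a] / (a ^+ i.+1 * D^`().[a]).
Proof.
set W := \prod_(a <- rs) _; set N := size rs => eD lc0 urs rs0 N0 sH dv.
have sD : size D = N.+1 by rewrite eD size_scale // size_prod_XsubC.
have DN : D`_N = lc.
  have /monicP := monic_prod_XsubC rs predT id; rewrite lead_coefE size_prod_XsubC.
  by rewrite eD coefZ => ->; rewrite mulr1.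
set T := take_poly i.+1 f.
have sT : (size T <= i.+1)%N by exact: size_take_poly.
have /dvdpP[P eP] : 'X^(i.+1) %| H - T * D.
  apply: dvdp_sub_trans dv _; rewrite -mulrBl dvdp_mulr //; exact: dvdXn_take.
have sP : (size P <= N)%N.
  have [->|P0] := eqVneq P 0; first by rewrite size_poly0.
  rewrite -(leq_add2l i.+1) -size_mulXn // -eP (leq_trans (size_polyD _ _)) //.
  rewrite size_polyN geq_max (leq_trans sH) ?leq_addl //=.
  rewrite (leq_trans (size_polyMleq _ _)) // sD addnS /= leq_add2r //.
(* Read off the coefficient of degree N + i in H - T D: [H] is too short to contribute, and of the
   product only the top coefficients of [T] and [D] meet there. *)
have PN : P`_N.-1 = - (lc * f`_i).
  have -> : P`_N.-1 = (P * 'X^(i.+1))`_(N + i).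
    rewrite coefMXn; case: ifPn => [|_]; first by lia.
    by congr (_`__); lia.
  rewrite -eP coefB nth_default ?sub0r; last by rewrite (leq_trans sH) ?leq_addr.
  rewrite coefM (bigD1 (Ordinal (leq_addl N i : i < (N + i).+1)%N)) //=.
  rewrite addnK DN coef_take_poly ltnSn mulrC big1 ?addr0 // => k ki.
  have [ik|ik] := leqP i k; last first.
    by rewrite [D`__]nth_default ?mulr0 // sD; lia.
  rewrite coef_take_poly ltnNge ltn_neqAle ik andbT.
  suff -> : i != k by rewrite mul0r.
  by apply: contraNneq ki => e; apply/eqP/val_inj.
have := euler_sum urs sP; rewrite -/N PN => /(congr1 (fun x => - (lc^-1 * x))).
rewrite mulrN opprK mulKf // => <-; congr (- _).
rewrite mulr_sumr [LHS]big_seq [RHS]big_seq; apply: eq_bigr => a ars.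
have a0 : a != 0 by apply: contraNneq rs0 => <-.
have Da : D.[a] = 0.
  by apply/eqP; rewrite eD hornerZ -[_.[a]]/(_) ; have := root_prod_XsubC rs a; rewrite ars => /rootP ->; rewrite mulr0.
have -> : H.[a] = P.[a] * a ^+ i.+1.
  by have := congr1 (horner^~ a) eP; rewrite hornerD hornerN hornerM Da mulr0 subr0 hornerM hornerXn.
rewrite eD derivZ hornerZ mulrC -/W.
have Wa : W^`().[a] != 0.
  by rewrite deriv_prod_XsubC_eval // lagr_eval_neq0.
have ai : a ^+ i.+1 != 0 by rewrite expf_neq0.
by field; rewrite ai Wa lc0.
Qed.

End DvdXn.

Section DvdXnNorm.
Variable K : numFieldType.
Implicit Types P : {poly K}.

Lemma dvdXn_horner_le N P a : 'X^N %| P -> `|a| <= 1 ->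
  `|P.[a]| <= `|a| ^+ N * nrmp 1 P.
Proof.
move=> /dvdXnP dv a1; apply: (le_trans (nrmp_horner _ _)).
rewrite /nrmp mulr_sumr ler_sum // => i _.
rewrite expr1n mulr1 mulrC; have [iN|Ni] := ltnP i N.
  by rewrite dv // normr0 !mulr0.
by rewrite ler_wpM2r // ler_wiXn2l.
Qed.

End DvdXnNorm.

Section QuotientBound.
Variable C : numClosedFieldType.
Implicit Types (G H f P : {poly C}).

(** Pigeonhole: the n + 1 points l / (n + 1) are spaced by 1 / (n + 1), so an open disc of half that
    radius around a bad point contains at most one of them. *)
Lemma avoid_points (bad : seq C) : exists2 w : C, `|w| <= 1 &
  forall b, b \in bad -> (2 * (size bad).+1%:R)^-1 <= `|w - b|.
Proof.
set n := size bad; set d := _^-1.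
have n1 : (0 : C) < n.+1%:R by rewrite ltr0n.
have d0 : 0 < d by rewrite invr_gt0 mulr_gt0 ?ltr0n.
pose pt (l : 'I_n.+1) : C := l%:R / n.+1%:R.
have pt1 l : `|pt l| <= 1.
  by rewrite /pt normrM normfV !normr_nat ler_pdivrMr // mul1r ler_nat ltnW.
have [l /allP hl|hno] := pickP (fun l => all (fun b => d <= `|pt l - b|) bad).
  by exists (pt l).
exfalso; have hfind l : (find (fun b => ~~ (d <= `|pt l - b|)%R) bad < n)%N.
  by rewrite -has_find has_predC hno.
pose g l := Ordinal (hfind l).
suff /leq_card : injective g by rewrite !card_ord ltnn.
move=> l m /(congr1 val) /= e.
have close k : `|pt k - nth 0 bad (g k)| < d.
  have := hfind k; rewrite -has_find => /(nth_find 0) /=.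
  by rewrite -real_ltNge ?normr_real // gtr0_real.
have : `|pt l - pt m| < d + d.
  have := ltrD (close l) (close m); rewrite [X in _ + X < _]distrC; apply: le_lt_trans.
  by rewrite /= e (le_trans _ (ler_normD _ _)) // addrA subrK.
have -> : d + d = n.+1%:R^-1 
  by rewrite /d -mulr2n -[LHS]mulr_natl invfM mulrA mulfV ?mul1r // pnatr_eq0.
rewrite /pt -mulrBl normrM [`|n.+1%:R^-1|]ger0_norm ?invr_ge0 ?ler0n //.
rewrite gtr_pMl ?invr_gt0 // => lt1; apply/val_inj/eqP; apply: contraTT isT => lm.
by have := le_lt_trans (dist_nat_ge1 C lm) lt1; rewrite ltxx.
Qed.

Lemma uniq_roots_deriv (rs : seq C) :
  (forall a, a \in rs -> (\prod_(b <- rs) ('X - b%:P))^`().[a] != 0) -> uniq rs.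
Proof.
elim: rs => //= a s IH h; apply/andP; split.
  have := h a (mem_head _ _); rewrite big_cons derivM derivXsubC mul1r hornerD hornerM.
  rewrite !hornerE subrr mul0r addr0; apply: contraNN => ains.
  by have := root_prod_XsubC s a; rewrite ains.
apply: IH => b bs; have := h b; rewrite inE bs orbT => /(_ isT).
rewrite big_cons derivM derivXsubC mul1r hornerD hornerM.
have := root_prod_XsubC s b; rewrite bs => /rootP ->; rewrite add0r.
by apply: contraNneq => ->; rewrite mulr0.
Qed.

Lemma nrmp_Xn (x : C) n : nrmp x ('X^n : {poly C}) = x ^+ n.
Proof.
elim: n => [|n IH]; first by rewrite !expr0 nrmpC normr1.
have := nrmp_cons x 'X^n 0; rewrite addr0 normr0 addr0 IH -!exprSr.
by move=> ->.
Qed.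

Lemma nrmp1_le P N : (size P <= N)%N -> (forall i, `|P`_i| <= 1) -> nrmp 1 P <= N%:R.
Proof.
move=> sP P1; rewrite (nrmp_wide _ sP).
apply: (@le_trans _ _ (\sum_(i < N) 1)); last by rewrite sumr_const card_ord.
by apply: ler_sum => i _; rewrite expr1n mulr1.
Qed.

(** The factors on the left are the number of roots, the numerator constant, the root separation
    constant and the inverse distance to the avoided values. All but 12^N are polynomial in [N] and
    fit into 2^(8N). *)
Lemma joris_const_exists : {K | (0 < K)%N & forall N, (0 < N)%N ->
  (N * ((2 * N.+1) ^ 2 * 12 ^ N * (2 * N.+2)) <= K ^ N)%N}.
Proof.
exists (12 * 2 ^ 8)%N => // N N0.
rewrite [((_ * 2 ^ 8) ^ N)%N]expnMn -expnM [(8 * N)%N]mulnC expnM.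
have : (N < 2 ^ N)%N by exact: ltn_expl.
set x := (2 ^ N)%N => Nx; set y := (12 ^ N)%N.
have x2 : (2 <= x)%N by rewrite /x -{1}(expn1 2) leq_exp2l.
have -> : (N * ((2 * N.+1) ^ 2 * y * (2 * N.+2)) = y * (N * (2 * N.+1) ^ 2 * (2 * N.+2)))%N by ring.
rewrite leq_mul2l; apply/orP; right.
apply: (@leq_trans (x * (2 * x) ^ 2 * (4 * x))).
  apply: leq_mul; last by lia.
  apply: leq_mul; first exact: ltnW.
  by rewrite leq_exp2r // leq_mul2l.
have -> : (x * (2 * x) ^ 2 * (4 * x) = 2 ^ 4 * x ^ 4)%N by ring.
by rewrite (_ : 8 = 4 + 4)%N // expnD leq_mul // leq_exp2r.
Qed.

Definition joris_const : nat := s2val joris_const_exists.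

Lemma joris_const_gt0 : (0 < joris_const)%N.
Proof. exact: s2valP joris_const_exists. Qed.

Lemma joris_const_leq N : (0 < N)%N ->
  (N * ((2 * N.+1) ^ 2 * 12 ^ N * (2 * N.+2)) <= joris_const ^ N)%N.
Proof. exact: s2valP' joris_const_exists N. Qed.

(** If |a| > 1, the N coefficients of [G] and the term w a^M contribute at most (N+1) |a|^(N-1), too
    little to balance (N+1) |a|^N. This fixes the coefficient N + 1. *)
Lemma root_size_le1 N M G (w : C) a : (0 < N)%N -> (M < N)%N -> (size G <= N)%N ->
  (forall i, `|G`_i| <= 1) -> `|w| <= 1 ->
  (G + N.+1%:R *: 'X^N).[a] = w * a ^+ M -> `|a| <= 1.
Proof.
move=> N0 MN sG G1 w1 e; case: (real_leP (normr_real a) (normr_real (1 : C))); rewrite normr1 // => a1.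
have apos : 0 < `|a| by exact: lt_trans a1.
suff : N.+1%:R * `|a| ^+ N <= N.+1%:R * `|a| ^+ N.-1.
  rewrite ler_pM2l ?ltr0n // -{1}(prednK N0) exprS.
  by rewrite ger_pMl ?exprn_gt0 // => /(lt_le_trans a1); rewrite ltxx.
have -> : N.+1%:R * `|a| ^+ N = `|w * a ^+ M - G.[a]|.
  by rewrite -e hornerD hornerZ hornerXn addrAC subrr add0r normrM normrX normr_nat.
apply: (le_trans (ler_normB _ _)).
rewrite -natr1 mulrDl mul1r addrC lerD //.
  apply: (le_trans (nrmp_horner _ _)); rewrite (nrmp_wide _ sG).
  apply: (@le_trans _ _ (\sum_(i < N) `|a| ^+ N.-1)); last first.
    by rewrite sumr_const card_ord mulr_natl.
  apply: ler_sum => i _; rewrite -[leRHS]mul1r ler_pM ?exprn_ge0 //.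
  by rewrite ler_weXn2l ?(ltW a1) // -ltnS prednK.
rewrite normrM normrX -[leRHS]mul1r ler_pM ?exprn_ge0 //.
by rewrite ler_weXn2l ?(ltW a1) // -ltnS prednK.
Qed.

(* At a root [a] of [G + (N+1) X^N - w X^M] one has [H(a)^j = (w a^M)^(j+1) + O(a^N)]
   and both terms have order [N = M (j+1)]. *)
Lemma joris_numerator_bound j kap N G H (w : C) a :
  (0 < j)%N -> (0 < kap)%N -> N = (j * (j.+1 * kap))%N ->
  (size G <= N)%N -> (size H <= N)%N ->
  (forall i, `|G`_i| <= 1) -> (forall i, `|H`_i| <= 1) -> `|w| <= 1 -> `|a| <= 1 ->
  'X^N %| G ^+ j.+1 - H ^+ j ->
  (G + N.+1%:R *: 'X^N).[a] = w * a ^+ (j * kap) ->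
  `|H.[a]| <= (2 * N.+1%:R) ^+ 2 * `|a| ^+ (j.+1 * kap).
Proof.
move=> j0 kap0 eN sG sH G1 H1 w1 a1 dv e; set Gp := G + _ in e.
pose T := Gp ^+ j.+1 - H ^+ j.
have dvT : 'X^N %| T.
  apply: dvdp_sub_trans dv; apply: dvdp_subX.
  by rewrite /Gp addrAC subrr add0r -mul_polyC dvdp_mull.
have nGp : nrmp 1 Gp <= (2 * N).+1%:R.
  apply: (le_trans (nrmpD _ _ ler01)); rewrite nrmpZ normr_nat.
  have -> : nrmp 1 'X^N = 1 :> C.
    by rewrite nrmp_Xn expr1n.
  rewrite mulr1; apply: (le_trans (lerD (nrmp1_le sG G1) (lexx _))).
  by rewrite -natrD ler_nat; lia.
have nH := nrmp1_le sH H1.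
have nT : nrmp 1 T <= (2 * N).+1%:R ^+ j.+1 + N%:R ^+ j.
  apply: (le_trans (nrmpD _ _ ler01)); rewrite nrmpN lerD //.
    apply: (le_trans (nrmpX _ _ ler01)); rewrite lerXn2r ?nnegrE ?nrmp_ge0 //.
  by apply: (le_trans (nrmpX _ _ ler01)); rewrite lerXn2r ?nnegrE ?nrmp_ge0.
have hT := le_trans (dvdXn_horner_le dvT a1) (ler_wpM2l (exprn_ge0 N (normr_ge0 a)) nT).
rewrite -(ler_pXn2r j0) ?nnegrE ?mulr_ge0 ?exprn_ge0 //.
rewrite exprMn -!exprM [(_ * j)%N in X in _ <= _ * X]mulnC -eN.
have -> : `|H.[a]| ^+ j = `|Gp.[a] ^+ j.+1 - T.[a]|.
  by rewrite [T.[a]]hornerD hornerN !horner_exp opprB addrC subrK normrX.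
apply: (le_trans (ler_normB _ _)).
apply: (le_trans (lerD (lexx _) hT)).
have -> : `|Gp.[a] ^+ j.+1| = `|w| ^+ j.+1 * `|a| ^+ N.
  rewrite e exprMn normrM !normrX -exprM eN; congr (_ * _ ^+ _); lia.
rewrite [X in _ + X]mulrC -mulrDl ler_wpM2r ?exprn_ge0 //.
apply: (@le_trans _ _ (1 + ((2 * N).+1%:R ^+ j.+1 + N%:R ^+ j))).
  by rewrite lerD2r exprn_ile1.
rewrite -[X in X + _]/(1%:R) -natrM -!natrX -!natrD ler_nat.
(* Since j + 1 <= 2 j, the j-th root of this bound is at most the square of 2 (N+1), whatever [j]
   is. *)
apply: (@leq_trans ((2 * N.+1) ^ j.+1)%N); last by rewrite leq_pexp2l //; lia.
have -> : (2 * N.+1 = (2 * N).+1.+1)%N by lia.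
set x := (2 * N).+1; rewrite [X in (_ <= X)%N]expnS mulSn addnCA expnS.
have le1 : (x ^ j <= x.+1 ^ j)%N by rewrite leq_exp2r.
have le2 : (1 + N ^ j <= x.+1 ^ j)%N by rewrite add1n ltn_exp2r // /x; lia.
nia.
Qed.

Lemma wronsk_at_root M G (w a : C) : (0 < M)%N -> G.[a] = w * a ^+ M ->
  a * (G - w *: 'X^M)^`().[a] = (wronsk M G).[a].
Proof.
move=> M0 e; rewrite /wronsk derivB derivZ derivXn hornerD hornerN hornerZ hornerMn hornerXn.
rewrite hornerD hornerN hornerM hornerX hornerZ e mulrBr -mulr_natl -[in RHS](prednK M0) exprS.
by rewrite prednK //; ring.
Qed.

(* Replacing [G] by [D = G + (N+1) X^N - w X^M] does not change [f`_i]; the term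
   in [X^N] forces all roots of [D] into the unit disc. *)
Lemma joris_quotient_bound j kap N G H f : (0 < j)%N -> (0 < kap)%N -> N = (j * (j.+1 * kap))%N ->
  (size G <= N)%N -> (size H <= N)%N ->
  (forall i, `|G`_i| <= 1) -> (forall i, `|H`_i| <= 1) -> G`_0 != 0 ->
  'X^N %| G ^+ j.+1 - H ^+ j -> 'X^kap %| f * G - H ->
  forall i, (i < kap)%N -> `|f`_i| <= joris_const%:R ^+ N.
Proof.
move=> j0 kap0 eN sG sH G1 H1 G00 dv dvf i ik.
set M := (j * kap)%N.
have M0 : (0 < M)%N by rewrite muln_gt0 j0.
have MN : (M < N)%N by rewrite eN /M; nia.
have kM : (kap <= M)%N by rewrite /M leq_pmull.
have N0 : (0 < N)%N by exact: leq_ltn_trans MN.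
pose Gp := G + N.+1%:R *: 'X^N.
have Lam0 : (0 : C) < N.+1%:R by rewrite ltr0n.
have GpN : Gp`_N = N.+1%:R.
  by rewrite coefD nth_default // add0r coefZ coefXn eqxx mulr1.
have Gp0 : Gp`_0 = G`_0.
  by rewrite coefD coefZ coefXn (ltn_eqF N0) mulr0 addr0.
have sGp : (size Gp <= N.+1)%N.
  rewrite (leq_trans (size_polyD _ _)) // geq_max leqW //=.
  by rewrite (leq_trans (size_scale_leq _ _)) // size_polyXn.
(* The roots of [Q] are the critical points of Gp / X^M. The top coefficient (N - M)(N + 1) gives
   degree exactly [N], and G(0) != 0 keeps the roots away from 0, where Gp / X^M has its pole. *)
pose Q := wronsk M Gp.
have sQ : size Q = N.+1.
  apply/eqP; rewrite eqn_leq; apply/andP; split.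
    apply/leq_sizeP => k Nk; rewrite coef_wronsk [Gp`_k]nth_default ?mulr0 //.
    exact: leq_trans sGp Nk.
  rewrite ltnNge; apply/negP => /leq_sizeP/(_ N (leqnn _))/eqP.
  by rewrite coef_wronsk GpN mulf_eq0 subr_eq0 eqr_nat (gtn_eqF MN) (gt_eqF Lam0).
have [rQ eQ] := closed_field_poly_normal Q.
have Qn0 : Q != 0 by rewrite -size_poly_eq0 sQ.
have srQ : size rQ = N.
  by move: sQ; rewrite eQ size_scale ?lead_coef_eq0 // size_prod_XsubC => -[].
have rQ0 : 0 \notin rQ.
  rewrite -root_prod_XsubC -(rootZ _ _ (_ : lead_coef Q != 0)) ?lead_coef_eq0 // -eQ.
  rewrite rootE horner_coef0 coef_wronsk Gp0 sub0r mulf_eq0 oppr_eq0 pnatr_eq0.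
  by rewrite (negPf G00) orbF -lt0n.
have [w w1 wfar] := avoid_points (Gp`_M :: [seq Gp.[c] / c ^+ M | c <- rQ]).
move: wfar; rewrite /= size_map srQ; set d := _^-1 => wfar.
have d0 : 0 < d by rewrite invr_gt0 mulr_gt0 ?ltr0n.
pose D := Gp - w *: 'X^M.
have DN : D`_N = N.+1%:R.
  by rewrite coefB GpN coefZ coefXn (gtn_eqF MN) mulr0 subr0.
have sD : size D = N.+1.
  apply/eqP; rewrite eqn_leq; apply/andP; split.
    rewrite (leq_trans (size_polyD _ _)) // size_polyN geq_max sGp /=.
    by rewrite (leq_trans (size_scale_leq _ _)) // size_polyXn ltnS ltnW.
  rewrite ltnNge; apply/negP => /leq_sizeP/(_ N (leqnn _))/eqP.
  by rewrite DN (gt_eqF Lam0).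
have lD : lead_coef D = N.+1%:R by rewrite lead_coefE sD.
have [rs eD] := closed_field_poly_normal D.
rewrite lD in eD.
have srs : size rs = N.
  by move: sD; rewrite eD size_scale ?gt_eqF // size_prod_XsubC => -[].
have D0 : D`_0 != 0.
  by rewrite coefB Gp0 coefZ coefXn (ltn_eqF M0) mulr0 subr0.
have rootD a : a \in rs -> Gp.[a] = w * a ^+ M.
  rewrite -root_prod_XsubC -(rootZ _ _ (_ : N.+1%:R != 0 :> C)) ?gt_eqF // -eD.
  by rewrite rootE hornerD hornerN hornerZ hornerXn subr_eq0 => /eqP.
have rs0 : 0 \notin rs.
  by rewrite -root_prod_XsubC -(rootZ _ _ (_ : N.+1%:R != 0 :> C)) ?gt_eqF // -eD rootE horner_coef0.
have a1 a : a \in rs -> `|a| <= 1.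
  by move=> /rootD; apply: root_size_le1.
have aD' a : a \in rs -> a * D^`().[a] = Q.[a].
  by move=> /rootD; exact: wronsk_at_root.
have lower a : a \in rs -> d * `|a| ^+ M <= 12 ^+ N * `|Q.[a]|.
  move=> ars; apply: (wronsk_root_lower MN sGp srQ eQ rQ0 _ _ (rootD a ars)).
    by apply: wfar; rewrite mem_head.
  by move=> c crQ; apply: wfar; rewrite inE; apply/orP; right; apply/mapP; exists c.
have an0 a : a \in rs -> a != 0 by move=> ars; apply: contraNneq rs0 => <-.
(* The lower bound is strictly positive at nonzero roots, so a value [w] that is not critical makes
   all roots of [D] simple. *)
have D'n0 a : a \in rs -> D^`().[a] != 0.
  move=> ars; have := lower a ars; rewrite -aD' //.
  apply: contraTneq => ->; rewrite mulr0 normr0 mulr0 -real_ltNge ?realE ?lexx //.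
    by rewrite mulr_gt0 // exprn_gt0 // normr_gt0 an0.
  by rewrite mulr_ge0 ?exprn_ge0 // ltW.
have urs : uniq rs.
  apply: uniq_roots_deriv => a ars; have := D'n0 a ars.
  by rewrite eD derivZ hornerZ mulf_eq0 negb_or => /andP[].
have dvD : 'X^(i.+1) %| H - f * D.
  apply: (dvdXn_leq ik); apply: (dvdp_sub_trans (dvdp_sub_sym dvf)).
  rewrite -mulrBr dvdp_mull //.
  have -> : G - D = w%:P * 'X^M - N.+1%:R%:P * 'X^N.
    by rewrite /D /Gp -!mul_polyC opprB opprD addrCA addNKr.
  by rewrite dvdp_sub // dvdp_mull // dvdp_exp2l // (leq_trans kM) // ltnW.
rewrite (coef_quotient_euler eD _ urs rs0 _ _ dvD) ?srs ?gt_eqF // normrN.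
pose K : C := (2 * N.+1%:R) ^+ 2 * (12 ^+ N * d^-1).
have term a : a \in rs -> `|H.[a] / (a ^+ i.+1 * D^`().[a])| <= K.
  move=> ars; have aa := an0 a ars.
  rewrite exprSr -mulrA aD' // normrM normfV ler_pdivrMr; last first.
    by rewrite normr_gt0 mulf_neq0 ?expf_neq0 // -aD' // mulf_neq0 // D'n0.
  apply: (le_trans (joris_numerator_bound j0 kap0 eN sG sH G1 H1 w1 (a1 a ars) dv (rootD a ars))).
  rewrite /K -[leRHS]mulrA ler_wpM2l ?exprn_ge0 ?mulr_ge0 //.
  (* The cancellation: the denominator is a^i Q(a), bounded below by a constant times |a|^(i+M), and
     i < kap gives i + M <= (j+1) kap, the order of the numerator. *)
  apply: (@le_trans _ _ (`|a| ^+ i * `|a| ^+ M)).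
    rewrite -exprD; apply: (ler_wiXn2l (normr_ge0 a) (a1 a ars)).
    by rewrite mulSn -/M leq_add2r ltnW.
  rewrite normrM normrX mulrCA ler_wpM2l ?exprn_ge0 //.
  by rewrite mulrAC ler_pdivlMr // mulrC lower.
apply: (le_trans (ler_norm_sum _ _ _)).
apply: (@le_trans _ _ (\sum_(a <- rs) K)).
  by rewrite !big_seq ler_sum.
rewrite big_const_seq count_predT iter_addr_0 srs -[leLHS]mulr_natl /K /d invrK.
have := joris_const_leq N0; by rewrite -(ler_nat C) !(natrX, natrM) -[(_ ^+ 2 * _) * _]mulrA.
Qed.

End QuotientBound.

(** * The formal root of [G] and [H] *)

Section FormalRoot.
Variable F : fieldType.
Implicit Types P Q U V : {poly F}.

Lemma Xn_factor P : P != 0 -> exists m U, U`_0 != 0 /\ P = U * 'X^m.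
Proof.
move=> P0; have [m [U rU eP]] := multiplicity_XsubC P 0.
by exists m, U; rewrite P0 subr0 /= in rU eP; split; rewrite // -horner_coef0.
Qed.

Lemma coprime_Xn m U : U`_0 != 0 -> coprimep 'X^m U.
Proof. by move=> U0; rewrite coprimep_sym coprimep_expr // coprimepX rootE horner_coef0. Qed.

Lemma coef0_exp U m : (U ^+ m)`_0 = U`_0 ^+ m.
Proof. by rewrite -!horner_coef0 horner_exp. Qed.

Lemma dvdXn_sub_neq U V a b N : U`_0 != 0 -> 'X^N %| U * 'X^a - V * 'X^b ->
  (a < b)%N -> (N <= a)%N.
Proof.
move=> U0 /dvdXnP dv ab; rewrite leqNgt; apply: contraNN U0 => aN.
by have := dv a aN; rewrite coefB !coefMXn ltnn subnn ab subr0 => ->.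
Qed.

(** The lowest terms of G^(j+1) and H^j lie below X^N and must cancel, so m (j+1) = n j. As j and
    j+1 are coprime, m and n come from a common [q], the order of the root itself. *)
Lemma order_joris j N G H U V m n : (0 < j)%N -> G = U * 'X^m -> H = V * 'X^n ->
  U`_0 != 0 -> V`_0 != 0 -> 'X^N %| G ^+ j.+1 - H ^+ j -> (m * j.+1 < N)%N ->
  exists q, [/\ m = (j * q)%N, n = (j.+1 * q)%N &
    'X^(N - j * j.+1 * q) %| U ^+ j.+1 - V ^+ j].
Proof.
move=> j0 -> -> U0 V0; rewrite !exprMn -!exprM => dv mN.
have Uj : (U ^+ j.+1)`_0 != 0 by rewrite coef0_exp expf_neq0.
have Vj : (V ^+ j)`_0 != 0 by rewrite coef0_exp expf_neq0.
have e : (m * j.+1 = n * j)%N.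
  case: (ltngtP (m * j.+1) (n * j)) => // lt.
    by have := dvdXn_sub_neq Uj dv lt; rewrite leqNgt mN.
  have := dvdXn_sub_neq Vj (dvdp_sub_sym dv) lt.
  by rewrite leqNgt (ltn_trans lt mN).
have /dvdnP[q eq] : (j %| m)%N.
  by rewrite -(@Gauss_dvdl _ _ j.+1) ?coprimenS // e dvdn_mull.
have em : m = (j * q)%N by rewrite eq mulnC.
have en : n = (j.+1 * q)%N.
  by apply/eqP; rewrite -(eqn_pmul2r j0) -e em; apply/eqP; ring.
exists q; split => //; move: dv mN; rewrite -e -mulrBl em => dv mN.
have eN : N = (N - j * j.+1 * q + j * q * j.+1)%N by nia.
by move: dv; rewrite [in X in X -> _]eN exprD dvdp_mul2r // expf_neq0 // polyX_eq0.
Qed.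

Lemma series_quotient U V k : U`_0 != 0 ->
  exists f : {poly F}, (size f <= k)%N /\ 'X^k %| f * U - V.
Proof.
move=> /(coprime_Xn k) /Bezout_eq1_coprimepP[[a b] /= e].
have dv : 'X^k %| (V * b) * U - V.
  have -> : V * b * U - V = - (V * a * 'X^k).
    by rewrite -{2}[V]mulr1 -e; ring.
  by rewrite dvdpNr dvdp_mull.
exists (take_poly k (V * b)); split; first exact: size_take_poly.
apply: dvdp_sub_trans dv; rewrite -mulrBl dvdp_mulr //.
exact/dvdp_sub_sym/dvdXn_take.
Qed.

(** Modulo X^k one has f^j U^j = V^j = U^(j+1), and the unit U^j cancels; then f^(j+1) = f U = V. *)
Lemma quotient_is_root j k f U V : U`_0 != 0 -> 'X^k %| f * U - V ->
  'X^k %| U ^+ j.+1 - V ^+ j -> 'X^k %| f ^+ j - U /\ 'X^k %| f ^+ j.+1 - V.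
Proof.
move=> U0 dvf dv.
have dvj : 'X^k %| f ^+ j - U.
  rewrite -(@Gauss_dvdpl _ _ (U ^+ j)); last by rewrite coprimep_expr // coprime_Xn.
  rewrite mulrBl -exprMn -exprS; apply: dvdp_sub_trans (dvdp_sub_sym dv).
  exact: dvdp_subX.
split => //; apply: dvdp_sub_trans dvf.
by rewrite exprS -mulrBr dvdp_mull.
Qed.

End FormalRoot.

Lemma coef_dilate (F : comNzRingType) (p : {poly F}) (c : F) i :
  (p \Po (c *: 'X))`_i = c ^+ i * p`_i.
Proof.
elim/poly_ind: p i => [|p a IH] i; first by rewrite comp_poly0 !coef0 mulr0.
rewrite comp_polyD comp_polyM comp_polyX comp_polyC -scalerAr !coefD coefZ !coefMX !coefC.
by case: i => [|i] /=; rewrite ?(mulr0, add0r, expr0, mul1r, addr0) // IH exprS mulrA.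
Qed.

Section BoundedRoot.
Variable C : numClosedFieldType.
Implicit Types (G H U V : {poly C}).

Lemma norm_coef_shift U m N : (forall i, `|(U * 'X^m)`_i| <= 1) ->
  forall i, `|(take_poly N U)`_i| <= 1.
Proof.
move=> h i; rewrite coef_take_poly; case: ifP => _; last by rewrite normr0.
have := h (i + m)%N; rewrite coefMXn ltnNge leq_addl /= addnK //.
Qed.

Lemma bounded_root_unit j kap N G H : (0 < j)%N -> (0 < kap)%N -> N = (j * (j.+1 * kap))%N ->
  (size G <= N)%N -> (size H <= N)%N ->
  (forall i, `|G`_i| <= 1) -> (forall i, `|H`_i| <= 1) ->
  'X^N %| G ^+ j.+1 - H ^+ j ->
  exists f : {poly C}, [/\ (size f <= kap)%N, forall i, `|f`_i| <= joris_const%:R ^+ N,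
    'X^kap %| f ^+ j - G & 'X^kap %| f ^+ j.+1 - H].
Proof.
move=> j0 kap0 eN sG sH G1 H1 dv.
have K0 : (0 : C) <= joris_const%:R ^+ N by rewrite exprn_ge0.
(* When [G] vanishes to order j kap, the relation makes [H] vanish to order (j+1) kap, and the zero
   polynomial is a root to the required order. *)
have [dvG|ndvG] := boolP ('X^(j * kap) %| G).
  exists 0; split; first by rewrite size_poly0.
  - by move=> i; rewrite coef0 normr0.
  - rewrite expr0n (gtn_eqF j0) sub0r dvdpNr; apply: dvdXn_leq dvG.
    by rewrite leq_pmull.
  rewrite expr0n /= sub0r dvdpNr.
  have dvH : 'X^N %| H ^+ j.
    have := dvdp_exp2r j.+1 dvG; rewrite -exprM mulnAC -mulnA -eN => dvGj.
    by rewrite -(dvdp_subr _ dvGj).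
  apply: (@dvdXn_leq _ _ (j.+1 * kap)); first by rewrite leq_pmull.
  by rewrite eN mulnC exprM dvdp_pexp2r in dvH.
have Gn0 : G != 0 by apply: contraNneq ndvG => ->; rewrite dvdp0.
have Hn0 : H != 0.
  apply: contraNneq ndvG => H0; move: dv; rewrite H0 expr0n (gtn_eqF j0) subr0.
  by rewrite eN mulnCA mulnC exprM dvdp_pexp2r.
have [m [U [U0 eG]]] := Xn_factor Gn0; have [n [V [V0 eH]]] := Xn_factor Hn0.
have mk : (m < j * kap)%N.
  rewrite ltnNge; apply: contraNN ndvG => km; apply: (dvdXn_leq km).
  by rewrite eG dvdp_mulIr.
have mN : (m * j.+1 < N)%N by rewrite eN mulnCA mulnC ltn_pmul2l.
have [q [em en dvUV]] := order_joris j0 eG eH U0 V0 dv mN.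
have qk : (q < kap)%N by move: mk; rewrite em ltn_pmul2l.
(* Once X^q is split off the root, only kap - q coefficients remain to be bounded, and the
   corresponding order [N'] is exactly what remains of [N] in the relation between [U] and [V]. *)
pose k := (kap - q)%N; have k0 : (0 < k)%N by rewrite subn_gt0.
pose N' := (j * (j.+1 * k))%N.
have eN' : N' = (N - j * j.+1 * q)%N by rewrite /N' /k eN !mulnBr !mulnA.
have N'0 : (0 < N')%N by rewrite !muln_gt0 j0.
have kN' : (k <= N')%N by rewrite /N' mulnA leq_pmull // muln_gt0 j0.
have NN' : (N' <= N)%N by rewrite eN' leq_subr.
pose U' := take_poly N' U; pose V' := take_poly N' V.
have U'0 : U'`_0 != 0 by rewrite coef_take_poly N'0.
have dvU : 'X^N' %| U' - U by apply/dvdp_sub_sym/dvdXn_take.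
have dvV : 'X^N' %| V' - V by apply/dvdp_sub_sym/dvdXn_take.
have dv' : 'X^N' %| U' ^+ j.+1 - V' ^+ j.
  apply: dvdp_sub_trans (dvdp_subX _ dvU) _.
  apply: dvdp_sub_trans (dvdp_subX _ (dvdp_sub_sym dvV)).
  by rewrite eN'.
have [f [sf dvf]] := series_quotient V' k U'0.
have [dvj dvj1] := quotient_is_root U'0 dvf (dvdXn_leq kN' dv').
have fk : forall i, `|f`_i| <= joris_const%:R ^+ N.
  move=> i; have [ik|ki] := ltnP i k; last by rewrite nth_default ?normr0 // (leq_trans sf).
  have /le_trans -> // : `|f`_i| <= joris_const%:R ^+ N'.
    apply: (joris_quotient_bound j0 k0 (erefl N') _ _ _ _ U'0 dv' dvf ik).
    - exact: size_take_poly.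
    - exact: size_take_poly.
    - by apply: (@norm_coef_shift _ m); rewrite -eG.
    - by apply: (@norm_coef_shift _ n); rewrite -eH.
  by rewrite ler_weXn2l // ler1n joris_const_gt0.
exists (f * 'X^q); split.
- have [->|f0] := eqVneq f 0; first by rewrite mul0r size_poly0.
  by rewrite size_mulXn // -(subnKC (ltnW qk)) leq_add2l.
- move=> i; rewrite coefMXn; case: ifP => // _; by rewrite normr0.
- rewrite exprMn -exprM mulnC -em eG -mulrBl.
  apply: (@dvdXn_leq _ _ (k + m)); first by rewrite -{1}(subnK (ltnW qk)) -/k leq_add2l em leq_pmull.
  rewrite exprD dvdp_mul //; apply: dvdp_sub_trans dvj _.
  exact: dvdXn_leq dvU.
rewrite exprMn -exprM mulnC -en eH -mulrBl.
apply: (@dvdXn_leq _ _ (k + n)); first by rewrite -{1}(subnK (ltnW qk)) -/k leq_add2l en leq_pmull.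
rewrite exprD dvdp_mul //; apply: dvdp_sub_trans dvj1 _.
exact: dvdXn_leq dvV.
Qed.

(** Replacing f by f(X / rho) / lam divides [G] by lam^j and [H] by lam^(j+1), so these are the
    bounds compatible with the relation. The extra factor in the conclusion does not depend on [lam]
    and [rho]. *)
Lemma bounded_root j kap N G H (lam rho : C) :
  (0 < j)%N -> (0 < kap)%N -> N = (j * (j.+1 * kap))%N -> 0 < lam -> 0 < rho ->
  (size G <= N)%N -> (size H <= N)%N ->
  (forall i, `|G`_i| <= lam ^+ j * rho ^+ i) ->
  (forall i, `|H`_i| <= lam ^+ j.+1 * rho ^+ i) ->
  'X^N %| G ^+ j.+1 - H ^+ j ->
  exists f : {poly C}, [/\ (size f <= kap)%N, forall i, `|f`_i| <= lam * joris_const%:R ^+ N * rho ^+ i,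
    'X^kap %| f ^+ j - G & 'X^kap %| f ^+ j.+1 - H].
Proof.
move=> j0 kap0 eN lam0 rho0 sG sH G1 H1 dv.
have ln0 : lam != 0 by rewrite gt_eqF.
have rn0 : rho != 0 by rewrite gt_eqF.
pose sg c (P : {poly C}) := P \Po (c *: 'X).
have normalized m (P : {poly C}) : (forall i, `|P`_i| <= lam ^+ m * rho ^+ i) ->
    forall i, `|(lam ^- m *: sg rho^-1 P)`_i| <= 1.
  move=> h i; rewrite coefZ coef_dilate mulrA exprVn -invfM normrM normfV.
  have pos : 0 < lam ^+ m * rho ^+ i by rewrite mulr_gt0 // exprn_gt0.
  by rewrite (gtr0_norm pos) ler_pdivrMl // mulr1.
have sz c m (P : {poly C}) N' : (size P <= N')%N -> (size (m *: sg c P) <= N')%N.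
  move=> sP; apply/leq_sizeP => i Ni; rewrite coefZ coef_dilate nth_default ?mulr0 //.
  exact: leq_trans Ni.
have dvs k c m (P : {poly C}) : 'X^k %| P -> 'X^k %| m *: sg c P.
  move=> /dvdXnP h; apply/dvdXnP => i ik.
  by rewrite coefZ coef_dilate h // !mulr0.
have [|f [sf f1 dvj dvj1]] := bounded_root_unit j0 kap0 eN (sz _ _ _ _ sG) (sz _ _ _ _ sH)
    (normalized _ _ G1) (normalized _ _ H1).
  rewrite !exprZn -!exprVn -!exprM [(j.+1 * j)%N]mulnC -scalerBr /sg.
  rewrite -!rmorphXn -rmorphB; exact: dvs.
have back m (P Q : {poly C}) : 'X^kap %| P ^+ m - lam ^- m *: sg rho^-1 Q ->
    'X^kap %| (lam *: sg rho P) ^+ m - Q.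
  move=> /(dvs _ rho (lam ^+ m)); congr (_ %| _).
  rewrite exprZn {1}/sg rmorphB /= rmorphXn scalerBr; congr (_ - _).
  apply/polyP => i; rewrite coefZ coef_dilate coefZ coef_dilate.
  by rewrite exprVn; field; rewrite !expf_neq0.
exists (lam *: sg rho f); split.
- exact: sz.
- move=> i; rewrite coefZ coef_dilate !normrM normrX (ger0_norm (ltW lam0)) (ger0_norm (ltW rho0)).
  rewrite -[leRHS]mulrA ler_pM2l // mulrC ler_pM2r ?exprn_gt0 //.
- exact: back dvj.
exact: back dvj1.
Qed.

End BoundedRoot.

(** * Polynomials that are small near zero, and Hoelder stability of the common root *)

Section SmallPoly.
Variable K : numFieldType.
Implicit Types P U : {poly K}.

Lemma poly_small_dvd N P (e M : K) : 0 < e -> 0 <= M ->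
  (forall t, 0 < t -> t < e -> `|P.[t]| <= M * t ^+ N) -> 'X^N %| P.
Proof.
move=> e0 M0 small; have [->|P0] := eqVneq P 0; first exact: dvdp0.
have [m [U [U0 eP]]] := Xn_factor P0.
have [Nm|mN] := leqP N m; first by rewrite eP dvdp_mull // dvdp_exp2l.
exfalso; pose V := drop_poly 1 U.
have eU : U = (U`_0)%:P + V * 'X.
  rewrite -[LHS](poly_take_drop 1) expr1; congr (_ + _); apply/polyP => i.
  by rewrite coef_take_poly coefC; case: i.
pose B := nrmp 1 V; have B0 : 0 <= B by exact: nrmp_ge0.
have u0 : 0 < `|U`_0| by rewrite normr_gt0.
(* The point t = 1 / s must be below [e], at most 1, and so small that (M + B) t is less than the
   lowest coefficient; a sum meets the three demands at once. *)
pose s := e^-1 + 1 + (M + B + 1) / `|U`_0|.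
have MB : 0 < M + B + 1 by rewrite ltr_wpDl ?addr_ge0.
have q0 : 0 < (M + B + 1) / `|U`_0| by rewrite divr_gt0.
have ei0 : 0 < e^-1 by rewrite invr_gt0.
have s0 : 0 < s by rewrite !addr_gt0.
pose t := s^-1; have t0 : 0 < t by rewrite invr_gt0.
have te : t < e.
  by rewrite -[ltRHS]invrK ltf_pV2 ?posrE // /s -addrA ltrDl addr_gt0.
have t1 : t <= 1.
  by rewrite invf_le1 // /s addrAC lerDr addr_ge0 ?(ltW ei0) ?(ltW q0).
have key : `|U`_0| <= (M + B) * t.
  have hU : `|U.[t]| <= M * t.
    have := small t t0 te; rewrite eP hornerM hornerXn normrM normrX (gtr0_norm t0).
    rewrite -(subnK (ltnW mN)) exprD mulrA ler_pM2r ?exprn_gt0 // => /le_trans -> //.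
    apply: (ler_wpM2l M0); rewrite -[leRHS]expr1; apply: (ler_wiXn2l (ltW t0) t1).
    by rewrite subn_gt0.
  have -> : U`_0 = U.[t] - V.[t] * t.
    by rewrite {2}eU !hornerE addrK.
  rewrite mulrDl (le_trans (ler_normB _ _)) // lerD // normrM (gtr0_norm t0).
  rewrite (ler_wpM2r (ltW t0)) // (le_trans (nrmp_horner _ _)) // (gtr0_norm t0).
  by apply: ler_sum => i _; rewrite ler_wpM2l // expr1n exprn_ile1 // (ltW t0).
have : `|U`_0| < `|U`_0|.
  apply: (le_lt_trans key); rewrite ltr_pdivrMr //.
  apply: (@lt_le_trans _ _ (M + B + 1)); first by rewrite ltrDl.
  by rewrite /s mulrDr [X in _ <= _ + X]mulrC divfK ?gt_eqF // lerDr mulr_ge0 ?addr_ge0 ?(ltW ei0).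
by rewrite ltxx.
Qed.

Lemma nrmp1_geom P n (A rho : K) : (size P <= n)%N -> 0 <= rho -> 0 <= A ->
  (forall i, `|P`_i| <= A * rho ^+ i) -> nrmp 1 P <= n%:R * (A * (1 + rho) ^+ n).
Proof.
move=> sP rho0 A0 h; rewrite (nrmp_wide _ sP).
apply: (@le_trans _ _ (\sum_(i < n) A * (1 + rho) ^+ n)); last first.
  by rewrite sumr_const card_ord mulr_natl.
apply: ler_sum => i _; rewrite expr1n mulr1 (le_trans (h i)) // ler_wpM2l //.
apply: (@le_trans _ _ ((1 + rho) ^+ i)).
  by rewrite lerXn2r ?nnegrE ?addr_ge0 // lerDr.
by rewrite ler_weXn2l ?lerDl // ltnW.
Qed.

Lemma norm_subXX (x y B : K) n : 1 <= B -> `|x| <= B -> `|y| <= B ->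
  `|x ^+ n - y ^+ n| <= n%:R * B ^+ n * `|x - y|.
Proof.
move=> B1 xB yB; have B0 := le_trans ler01 B1.
rewrite subrXX normrM mulrC ler_wpM2r //.
apply: (le_trans (ler_norm_sum _ _ _)).
apply: (@le_trans _ _ (\sum_(i < n) B ^+ n)); last by rewrite sumr_const card_ord mulr_natl.
apply: ler_sum => i _; rewrite normrM !normrX.
apply: (@le_trans _ _ (B ^+ (n.-1 - i) * B ^+ i)).
  by rewrite ler_pM ?exprn_ge0 // lerXn2r ?nnegrE.
rewrite -exprD ler_weXn2l //; have := ltn_ord i; lia.
Qed.

(** If |a - b| <= 3 |b|, the identity b^j (a - b) = (a^(j+1) - b^(j+1)) - a (a^j - b^j) controls
    |b|^j |a - b|, hence |a - b|^(j+1). Otherwise, with d = |a - b| / 3, |b| <= d and |a| >= 2 d, so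
    a^(j+1) and b^(j+1) differ by at least d^(j+1). *)
Lemma root_perturbation j (a b B E eta : K) : (0 < j)%N -> 0 <= E -> 0 <= B ->
  `|b| <= B -> eta <= E -> `|a ^+ j - b ^+ j| <= eta -> `|a ^+ j.+1 - b ^+ j.+1| <= eta ->
  `|a - b| ^+ j.+1 <= 3 ^+ j.+1 * (2 + B ^+ j + E) * eta.
Proof.
move=> j0 E0 B0 bB eE h1 h2.
have eta0 : 0 <= eta by exact: le_trans h1.
set A := B ^+ j + E; have A0 : 0 <= A by rewrite addr_ge0 ?exprn_ge0.
have aA : `|a| <= 1 + A.
  case: (real_leP (normr_real a) (normr_real (1 : K))); rewrite normr1.
    by move=> /le_trans -> //; rewrite lerDl.
  move=> a1; have : `|a| <= `|a| ^+ j by rewrite ler_eXnr // ltW.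
  move=> /le_trans -> //; rewrite -normrX -[a ^+ j](subrK (b ^+ j)).
  apply: (le_trans (ler_normD _ _)); apply: (@le_trans _ _ (E + B ^+ j)).
    by rewrite lerD ?(le_trans h1) // normrX lerXn2r ?nnegrE.
  by rewrite addrC lerDr.
have hb : `|b| ^+ j * `|a - b| <= (2 + A) * eta.
  rewrite -normrX -normrM.
  have -> : b ^+ j * (a - b) = (a ^+ j.+1 - b ^+ j.+1) - a * (a ^+ j - b ^+ j).
    by rewrite !exprS; ring.
  apply: (le_trans (ler_normB _ _)); rewrite normrM.
  have -> : (2 + A) * eta = eta + (1 + A) * eta by ring.
  by rewrite lerD // ler_pM.
rewrite -addrA -/A.
have [le|lt] := real_leP (normr_real (a - b)) (realM (realn K 3) (normr_real b)).
  rewrite exprSr; apply: (@le_trans _ _ (3 ^+ j * (`|b| ^+ j * `|a - b|))).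
    by rewrite mulrA -exprMn ler_wpM2r // lerXn2r ?nnegrE ?mulr_ge0.
  rewrite -mulrA; apply: ler_pM; last exact: hb.
  - by rewrite exprn_ge0.
  - by rewrite mulr_ge0 // exprn_ge0.
  by rewrite ler_weXn2l // ler1n.
have d0 : `|a - b| = 3 * (`|a - b| / 3) by rewrite mulrC divfK // pnatr_eq0.
set d := `|a - b| / 3 in d0; have dge0 : 0 <= d by rewrite divr_ge0.
have bd : `|b| <= d by rewrite ler_pdivlMr ?ltr0n // mulrC ltW.
have ad : 2 * d <= `|a|.
  have : `|a - b| <= `|a| + `|b| by exact: ler_normB.
  rewrite d0 => h; have := le_trans h (lerD (lexx _) bd).
  by rewrite (_ : 3 * d = 2 * d + d) ?lerD2r //; ring.
have hd : d ^+ j.+1 <= eta.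
  apply: le_trans h2; apply: le_trans (lerB_dist _ _).
  rewrite lerBrDr !normrX; apply: (@le_trans _ _ ((2 * d) ^+ j.+1)); last first.
    by rewrite lerXn2r ?nnegrE // mulr_ge0.
  apply: (@le_trans _ _ (d ^+ j.+1 + d ^+ j.+1)).
    by rewrite lerD2l lerXn2r ?nnegrE.
  rewrite [(2 * d) ^+ _]exprMn -mulr2n -[leLHS]mulr_natl ler_wpM2r ?exprn_ge0 //.
  by rewrite -{1}(expr1 2) ler_weXn2l // ler1n.
rewrite d0 [(3 * d) ^+ _]exprMn -mulrA ler_wpM2l ?exprn_ge0 //.
apply: (le_trans hd); rewrite ler_peMl // -[leLHS]addr0 lerD // ler1n //.
Qed.

End SmallPoly.

Section JorisTaylor.
Variable C : numClosedFieldType.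
Implicit Types (G H F P : {poly C}).

(** Both G^(j+1) and H^j approximate phi^(j (j+1)) up to O(t^N), and a polynomial of that size near
    0 is divisible by X^N. *)
Lemma taylor_dvd j N G H (phi : C -> C) (e C0 : C) : (0 < j)%N -> 0 < e -> e <= 1 -> 0 <= C0 ->
  (forall t, t \is Num.real -> `|t| < e -> `|phi t ^+ j - G.[t]| <= C0 * `|t| ^+ N) ->
  (forall t, t \is Num.real -> `|t| < e -> `|phi t ^+ j.+1 - H.[t]| <= C0 * `|t| ^+ N) ->
  'X^N %| G ^+ j.+1 - H ^+ j.
Proof.
move=> j0 e0 e1 C00 hG hH.
pose B := 1 + nrmp 1 G + nrmp 1 H + C0.
have g0 : 0 <= nrmp 1 G by exact: nrmp_ge0.
have h0 : 0 <= nrmp 1 H by exact: nrmp_ge0.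
have B1 : 1 <= B by rewrite /B -!addrA lerDl !addr_ge0.
have B0 := le_trans ler01 B1.
pose M := j.+1%:R * B ^+ j.+1 * C0 + j%:R * B ^+ j * C0.
apply: (@poly_small_dvd _ _ _ e M) => //.
  by rewrite addr_ge0 // mulr_ge0 // mulr_ge0 ?exprn_ge0.
move=> t t0 te; have tr := gtr0_real t0.
have tn : `|t| = t by rewrite gtr0_norm.
have t1 : `|t| <= 1 by rewrite tn (le_trans (ltW te)).
have tN : `|t| ^+ N <= 1 by rewrite exprn_ile1.
have te' : `|t| < e by rewrite tn.
have dG := hG t tr te'; have dH := hH t tr te'.
have GB : `|G.[t]| <= B.
  by rewrite (le_trans (horner_le_nrmp1 _ t1)) // /B addrAC -!addrA addrCA lerDl !addr_ge0.
have HB : `|H.[t]| <= B.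
  by rewrite (le_trans (horner_le_nrmp1 _ t1)) // /B addrAC lerDr !addr_ge0.
have close (a : C) P : `|a - P.[t]| <= C0 * `|t| ^+ N -> nrmp 1 P + C0 <= B -> `|a| <= B.
  move=> h; apply: le_trans; rewrite -[a](subrK P.[t]) addrC.
  apply: (le_trans (ler_normD _ _)); rewrite lerD ?horner_le_nrmp1 //.
  by rewrite (le_trans h) // ler_piMr.
have pG : `|phi t ^+ j| <= B.
  by apply: (close _ _ dG); rewrite /B lerD2r addrAC lerDr addr_ge0.
have pH : `|phi t ^+ j.+1| <= B.
  by apply: (close _ _ dH); rewrite /B lerD2r lerDr addr_ge0.
rewrite hornerD hornerN !horner_exp.
have -> : G.[t] ^+ j.+1 - H.[t] ^+ j =
    ((phi t ^+ j.+1) ^+ j - H.[t] ^+ j) - ((phi t ^+ j) ^+ j.+1 - G.[t] ^+ j.+1).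
  by rewrite -!exprM mulnC; ring.
apply: (le_trans (ler_normB _ _)); rewrite [leLHS]addrC mulrDl -[in leRHS]tn lerD //.
  apply: (le_trans (norm_subXX _ B1 pG GB)).
  by rewrite -[leRHS]mulrA ler_wpM2l // mulr_ge0 // exprn_ge0.
apply: (le_trans (norm_subXX _ B1 pH HB)).
by rewrite -[leRHS]mulrA ler_wpM2l // mulr_ge0 // exprn_ge0.
Qed.

(** The powers of [F] match those of [phi] to order (j+1) k, and taking a (j+1)-th root in
    [root_perturbation] leaves order k. [C1] is fixed before [phi], [G], [H] and [e], which is the
    uniformity over points and directions. *)
Lemma joris_taylor j k N (C0 lam rho : C) : (0 < j)%N -> (0 < k)%N ->
  N = (j * (j.+1 * (j.+1 * k)))%N -> 0 <= C0 -> 0 < lam -> 0 < rho ->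
  exists2 C1 : C, 0 <= C1 &
  forall (phi : C -> C) G H (e : C), 0 < e -> e <= 1 ->
  (size G <= N)%N -> (size H <= N)%N ->
  (forall i, `|G`_i| <= lam ^+ j * rho ^+ i) ->
  (forall i, `|H`_i| <= lam ^+ j.+1 * rho ^+ i) ->
  (forall t, t \is Num.real -> `|t| < e -> `|phi t ^+ j - G.[t]| <= C0 * `|t| ^+ N) ->
  (forall t, t \is Num.real -> `|t| < e -> `|phi t ^+ j.+1 - H.[t]| <= C0 * `|t| ^+ N) ->
  exists F, [/\ (size F <= j.+1 * k)%N, forall i, `|F`_i| <= lam * joris_const%:R ^+ N * rho ^+ i &
    forall t, t \is Num.real -> `|t| < e -> `|phi t - F.[t]| <= C1 * `|t| ^+ k].
Proof.
move=> j0 k0 eN C00 lam0 rho0; set kap := (j.+1 * k)%N.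
have kap0 : (0 < kap)%N by rewrite muln_gt0.
have rho0' := ltW rho0; have lam0' := ltW lam0.
have := @bounded_root C j kap N; have : (0 : C) <= joris_const%:R ^+ N by exact: exprn_ge0 (ler0n _ _).
move: (joris_const%:R ^+ N : C) => K K0 root.
pose BF := kap%:R * (lam * K * (1 + rho) ^+ kap).
pose BG m := N%:R * (lam ^+ m * (1 + rho) ^+ N).
have BF0 : 0 <= BF by rewrite mulr_ge0 // mulr_ge0 ?mulr_ge0 // exprn_ge0 // addr_ge0.
have BG0 m : 0 <= BG m by rewrite mulr_ge0 // mulr_ge0 // exprn_ge0 // addr_ge0.
pose C2 := C0 + (BF ^+ j + BG j) + (BF ^+ j.+1 + BG j.+1).
have C20 : 0 <= C2 by rewrite !addr_ge0 ?exprn_ge0.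
pose C3 := 3 ^+ j.+1 * (2 + BF ^+ j + C2).
have C30 : 0 <= C3 by rewrite mulr_ge0 ?exprn_ge0 // !addr_ge0 ?exprn_ge0.
(* The summand 1 makes C1 <= C1^(j+1), so this constant survives the (j+1)-th root. *)
pose C1 := 1 + C3 * C2.
have C11 : 1 <= C1 by rewrite lerDl mulr_ge0.
have C10 := le_trans ler01 C11.
exists C1 => // phi G H e e0 e1 sG sH bG bH hG hH.
have dv := taylor_dvd j0 e0 e1 C00 hG hH.
have [F [sF bF dvj dvj1]] := root _ _ _ _ j0 kap0 eN lam0 rho0 sG sH bG bH dv.
exists F; split => // t tr te.
have t1 : `|t| <= 1 by rewrite (le_trans (ltW te)).
have nF : nrmp 1 F <= BF.
  by apply: nrmp1_geom => //; rewrite mulr_ge0.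
have nG : nrmp 1 G <= BG j by apply: nrmp1_geom => //; rewrite exprn_ge0.
have nH : nrmp 1 H <= BG j.+1 by apply: nrmp1_geom => //; rewrite exprn_ge0.
have kN : (kap <= N)%N by rewrite eN mulnA leq_pmull // muln_gt0 j0.
have close m P : 'X^kap %| F ^+ m - P -> nrmp 1 P <= BG m ->
    C0 + (BF ^+ m + BG m) <= C2 ->
    (forall t, t \is Num.real -> `|t| < e -> `|phi t ^+ m - P.[t]| <= C0 * `|t| ^+ N) ->
    `|phi t ^+ m - F.[t] ^+ m| <= C2 * `|t| ^+ kap.
  move=> dvP nP hC hP.
  have -> : phi t ^+ m - F.[t] ^+ m = (phi t ^+ m - P.[t]) - (F ^+ m - P).[t].
    by rewrite hornerD hornerN horner_exp; ring.
  apply: (le_trans (ler_normB _ _)).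
  apply: (@le_trans _ _ ((C0 + (BF ^+ m + BG m)) * `|t| ^+ kap)); last first.
    by rewrite ler_wpM2r ?exprn_ge0.
  rewrite mulrDl lerD //.
    apply: (le_trans (hP t tr te)); rewrite ler_wpM2l //.
    by apply: (ler_wiXn2l (normr_ge0 t) t1).
  apply: (le_trans (dvdXn_horner_le dvP t1)); rewrite mulrC ler_wpM2r ?exprn_ge0 //.
  apply: (le_trans (nrmpD _ _ ler01)); rewrite nrmpN lerD //.
  by rewrite (le_trans (nrmpX _ _ ler01)) // lerXn2r ?nnegrE ?nrmp_ge0.
have h1 : `|phi t ^+ j - F.[t] ^+ j| <= C2 * `|t| ^+ kap.
  by apply: (close _ G) => //; rewrite /C2 lerDl addr_ge0 // exprn_ge0.
have h2 : `|phi t ^+ j.+1 - F.[t] ^+ j.+1| <= C2 * `|t| ^+ kap.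
  apply: (close _ H) => //; rewrite /C2 addrAC lerDl addr_ge0 // exprn_ge0 //.
have FB : `|F.[t]| <= BF by rewrite (le_trans (horner_le_nrmp1 _ t1)).
have etaE : C2 * `|t| ^+ kap <= C2 by rewrite ler_piMr // exprn_ile1.
have := root_perturbation j0 C20 BF0 FB etaE h1 h2; rewrite -/C3 => h.
rewrite -(@ler_pXn2r _ j.+1) ?nnegrE ?mulr_ge0 ?exprn_ge0 //.
apply: (le_trans h); rewrite exprMn -exprM [(k * j.+1)%N]mulnC -/kap mulrA.
rewrite ler_wpM2r ?exprn_ge0 //; apply: (@le_trans _ _ C1); first by rewrite lerDr.
by rewrite -{1}[C1]expr1 ler_weXn2l.
Qed.

End JorisTaylor.

(** * Taylor expansions and finite differences of smooth functions *)

Section Derivatives.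
Variable R : realType.

Lemma is_derive_epsP (V : normedModType R) (f : V -> R) (a v : V) (L : R) :
  is_derive a v f L <-> forall e, 0 < e -> exists2 dl, 0 < dl &
    forall h : R, `|h| < dl -> `|f (a + h *: v) - f a - h * L| <= e * `|h|.
Proof.
split=> [[df dL] e e0|H].
  have : (fun h : R => h^-1 *: ((f \o shift a) (h *: v) - f a)) @ 0^' --> L.
    by rewrite -dL; exact: df.
  move=> /cvgrPdist_le /(_ e e0); rewrite /dnbhs /= => /nbhs_ballP[dl /= dl0 H].
  exists dl => // h hd; have [->|h0] := eqVneq h 0.
    by rewrite scale0r addr0 subrr sub0r mul0r oppr0 normr0 mulr0.
  have := H h; rewrite /ball /= sub0r normrN => /(_ hd h0).
  rewrite /= distrC => hle.
  have -> : f (a + h *: v) - f a - h * L =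
      h * (h^-1 *: (f (h *: v + a) - f a) - L).
    by rewrite mulrBr /GRing.scale /= mulrA mulfV // mul1r [a + _]addrC.
  by rewrite normrM mulrC ler_wpM2r.
have cv : (fun h : R => h^-1 *: ((f \o shift a) (h *: v) - f a)) @ 0^' --> L.
  apply/cvgrPdist_le => e e0; have [dl dl0 hdl] := H e e0.
  rewrite /dnbhs; apply/nbhs_ballP; exists dl => //= h; rewrite /ball /= sub0r normrN => hd h0.
  rewrite distrC.
  have -> : h^-1 *: (f (h *: v + a) - f a) - L = h^-1 * (f (a + h *: v) - f a - h * L).
    by rewrite mulrBr mulrA mulVf // mul1r [a + _]addrC.
  have hp : 0 < `|h| by rewrite normr_gt0.
  by rewrite normrM normfV mulrC ler_pdivrMr // hdl.
by split; [apply/cvg_ex; exists L | exact/cvg_lim].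
Qed.

Lemma continuous_epsP (V : normedModType R) (f : V -> R) (x : V) :
  {for x, continuous f} <-> forall e, 0 < e -> exists2 dl, 0 < dl &
    forall y, `|y - x| < dl -> `|f y - f x| <= e.
Proof.
split=> [/cvgrPdist_le H e e0|H].
  have /nbhs_ballP[dl /= dl0 h] := H e e0; exists dl => // y yx.
  by rewrite distrC; apply: h; rewrite -ball_normE /ball_ /= distrC.
apply/cvgrPdist_le => e e0; have [dl dl0 h] := H e e0.
apply/nbhs_ballP; exists dl => //= y; rewrite -ball_normE /ball_ /= => yx.
by rewrite distrC h // distrC.
Qed.

Lemma open_epsP (V : normedModType R) (U : set V) : open U <->
  forall x, U x -> exists2 dl, 0 < dl & forall y, `|y - x| < dl -> U y.
Proof.
split=> [oU x Ux|H].
  have /nbhs_ballP[dl /= dl0 h] := open_nbhs_nbhs (conj oU Ux).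
  by exists dl => // y yx; apply: h; rewrite -ball_normE /ball_ /= distrC.
rewrite openE => x Ux; have [dl dl0 h] := H x Ux.
apply/nbhs_ballP; exists dl => //= y; rewrite -ball_normE /ball_ /= => yx.
by apply: h; rewrite distrC.
Qed.

Lemma is_derive_line (V : normedModType R) (f : V -> R) (a v : V) (t L : R) :
  is_derive (a + t *: v) v f L -> is_derive t (1 : R) (fun s => f (a + s *: v)) L.
Proof.
move=> /is_derive_epsP H; apply/is_derive_epsP => e e0; have [dl dl0 h] := H e e0.
exists dl => // s sd; have := h s sd.
by rewrite -[a + _ + _]addrA -scalerDl [s *: (1 : R)]mulr1.
Qed.

Lemma mvt0 (f df : R -> R) (t : R) :
  (forall s : R, `|s| <= `|t| -> is_derive s (1 : R) f (df s)) ->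
  exists2 s, `|s| <= `|t| & f t - f 0 = t * df s.
Proof.
move=> H; have cont (a b : R) : (forall s : R, s \in `[a, b]%R -> is_derive s (1:R) f (df s)) ->
    {within `[a, b], continuous f}.
  by move=> h; apply: derivable_within_continuous => s /h[].
have [t0|t0] := leP 0 t.
  have Hs (s : R) : s \in `[0, t]%R -> is_derive s (1:R) f (df s).
    by rewrite in_itv /= => /andP[s0 st]; apply: H; rewrite !ger0_norm.
  have Ho (s : R) : s \in `]0, t[%R -> is_derive s (1:R) f (df s).
    by move=> /subset_itv_oo_cc; exact: Hs.
  have [c cin e] := MVT_segment t0 Ho (cont _ _ Hs).
  exists c; last by rewrite e subr0 mulrC.
  by move: cin; rewrite in_itv /= => /andP[s0 st]; rewrite !ger0_norm.
have Hs (s : R) : s \in `[t, 0]%R -> is_derive s (1:R) f (df s).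
  rewrite in_itv /= => /andP[ts s0]; apply: H.
  by rewrite ler0_norm // ltr0_norm // lerN2.
have Ho (s : R) : s \in `]t, 0[%R -> is_derive s (1:R) f (df s).
  by move=> /subset_itv_oo_cc; exact: Hs.
have [c cin e] := MVT_segment (ltW t0) Ho (cont _ _ Hs).
exists c; last by rewrite -[LHS]opprB e sub0r mulrN opprK mulrC.
move: cin; rewrite in_itv /= => /andP[ts s0].
by rewrite ler0_norm // ltr0_norm // lerN2.
Qed.

(** [F m] stands for the m-th derivative. Each use of the mean value theorem passes to the
    derivative of the difference and gains one power of t; the factor 1 / N! is given up. *)
Lemma taylor_chain (F : nat -> R -> R) (N : nat) (t B : R) :
  (forall m (s : R), (m < N)%N -> `|s| <= `|t| -> is_derive s (1 : R) (F m) (F m.+1 s)) ->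
  (forall s : R, `|s| <= `|t| -> `|F N s| <= B) ->
  `|F 0%N t - (\poly_(m < N) ((m`!%:R)^-1 * F m 0)).[t]| <= B * `|t| ^+ N.
Proof.
elim: N F t => [|N IH] F t dF bF.
  by rewrite poly_def big_ord0 horner0 subr0 expr0 mulr1 bF.
set P := \poly_(m < N.+1) _.
have eP' : P^`() = \poly_(m < N) ((m`!%:R)^-1 * F m.+1 0).
  apply/polyP => m; rewrite coef_deriv !coef_poly ltnS; case: ifP => // _.
    rewrite factS natrM invfM -[LHS]mulr_natl !mulrA.
    by rewrite mulfV ?mul1r // pnatr_eq0.
  by rewrite mul0rn.
have dG (s : R) : `|s| <= `|t| ->
    is_derive s (1 : R) (fun s => F 0%N s - P.[s]) (F 1%N s - P^`().[s]).
  move=> st; have h1 : is_derive s (1 : R) (F 0%N) (F 1%N s) by exact: dF.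
  have h2 := is_derive_poly P s.
  exact: is_deriveB.
have [s st e] := mvt0 dG.
have P0 : P.[0] = F 0%N 0.
  by rewrite horner_coef0 coef_poly /= fact0 invr1 mul1r.
rewrite P0 subrr subr0 in e; rewrite e normrM mulrC exprSr mulrA ler_wpM2r //.
rewrite eP'.
have B0 : 0 <= B by apply: le_trans (bF t (lexx _)).
apply: (@le_trans _ _ (B * `|s| ^+ N)); last first.
  by rewrite ler_wpM2l // lerXn2r ?nnegrE.
apply: (IH (fun m => F m.+1)) => [m x mN xs|x xs].
  by apply: dF => //; exact: le_trans st.
by apply: bF; exact: le_trans st.
Qed.

End Derivatives.

Section FiniteUniformity.
Variable R : realType.

Lemma uniform_radius (I : finType) (P : I -> R -> Prop) :
  (forall i a b, P i b -> a <= b -> P i a) ->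
  (forall i, exists2 dl, 0 < dl & P i dl) -> exists2 dl, 0 < dl & forall i, P i dl.
Proof.
move=> mono ex; have /choice[f hf] : forall i, exists dl, 0 < dl /\ P i dl.
  by move=> i; have [dl] := ex i; exists dl.
exists (\big[Num.min/1]_i f i).
  by apply: lt_bigmin => // i _; have [] := hf i.
by move=> i; apply: mono (hf i).2 _; exact: bigmin_le_cond.
Qed.

Lemma uniform_bound (I : finType) (P : I -> R -> Prop) :
  (forall i a b, P i a -> a <= b -> P i b) ->
  (forall i, exists b, P i b) -> exists2 b, 0 <= b & forall i, P i b.
Proof.
move=> mono /choice[f hf]; exists (\big[Num.max/0]_i f i).
  exact: bigmax_ge_id.
by move=> i; apply: mono (hf i) _; exact: le_bigmax.
Qed.

End FiniteUniformity.

(** * Directional derivatives expressed by partial derivatives *)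

Section ChainRule.
Variables (R : realType) (d : nat).
Implicit Types (u : 'rV[R]_d -> R) (x v : 'rV[R]_d) (U : set 'rV[R]_d).

Lemma norm_row_coord v i : `|v 0 i| <= `|v|.
Proof.
rewrite [leRHS]/(`|v|) /Num.norm /= mx_normrE.
exact: (le_bigmax _ (fun ij : 'I_1 * 'I_d => `|v ij.1 ij.2|) (0, i)).
Qed.

Lemma norm_row_le v (B : R) : 0 <= B -> (forall i, `|v 0 i| <= B) -> `|v| <= B.
Proof.
move=> B0 h; rewrite /Num.norm /= mx_normrE; apply: bigmax_le => // ij _.
by rewrite [ij.1]ord1.
Qed.

Lemma e_dirE (i k : 'I_d) : e_dir R i 0 k = (k == i)%:R.
Proof. by rewrite /e_dir mxE eqxx. Qed.

Lemma norm_e_dir_le (i : 'I_d) : `|e_dir R i| <= 1.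
Proof.
by apply: norm_row_le => // k; rewrite e_dirE; case: eqP; rewrite ?normr1 ?normr0.
Qed.

Lemma pds_rcons i s u : pds (rcons s i) u = pds s (pd i u).
Proof. by rewrite /pds foldr_rcons. Qed.

(** Corners of the path from 0 to [v] along the coordinate axes; in the sup norm none of them is
    longer than [v]. *)
Definition prefix_vec v k : 'rV[R]_d := \row_i (if (i < k)%N then v 0 i else 0).

Lemma norm_prefix_vec v k : `|prefix_vec v k| <= `|v|.
Proof.
apply: norm_row_le => // i; rewrite mxE; case: ifP => _; last by rewrite normr0.
exact: norm_row_coord.
Qed.

Lemma prefix_vecS v (i : 'I_d) : prefix_vec v i.+1 = prefix_vec v i + v 0 i *: e_dir R i.
Proof.
apply/rowP => k; rewrite !mxE eqxx ltnS leq_eqVlt.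
have [->|ki] := eqVneq k i; first by rewrite eqxx ltnn add0r mulr1.
rewrite mulr0 addr0; suff -> : (k == i :> nat) = false by [].
by apply/negbTE; apply: contraNneq ki => e; apply/eqP/val_inj.
Qed.

Lemma prefix_vec_full v : prefix_vec v d = v.
Proof. by apply/rowP => k; rewrite mxE ltn_ord. Qed.

Lemma prefix_vec0 v : prefix_vec v 0 = 0.
Proof. by apply/rowP => k; rewrite !mxE. Qed.

Lemma is_derive_coordinates U u x v : open U -> U x ->
  (forall y, U y -> forall i, derivable u y (e_dir R i)) ->
  (forall i, {for x, continuous (pd i u)}) ->
  is_derive x v u (\sum_i v 0 i * pd i u x).
Proof.
move=> /open_epsP oU Ux du cu; apply/is_derive_epsP => e e0.
have [rU rU0 hU] := oU x Ux.
pose e' := e / (1 + d%:R * `|v|).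
have den0 : 0 < 1 + d%:R * `|v| by rewrite ltr_pwDl // mulr_ge0.
have e'0 : 0 < e' by rewrite divr_gt0.
have [rc rc0 hc] : exists2 dl, 0 < dl &
    forall i y, `|y - x| < dl -> `|pd i u y - pd i u x| <= e'.
  apply: (@uniform_radius R 'I_d (fun i r => forall y, `|y - x| < r -> `|pd i u y - pd i u x| <= e')).
    by move=> i a b h ab y ya; apply: h; exact: lt_le_trans ab.
  by move=> i; have /continuous_epsP := cu i; apply.
pose r := Num.min rU rc; have r0 : 0 < r by rewrite lt_min rU0.
exists (r / (1 + 2 * `|v|)).
  by rewrite divr_gt0 // ltr_pwDl // mulr_ge0.
move=> h hr; have hsmall : `|h| * (2 * `|v|) < r.
  have [->|hn0] := eqVneq h 0; first by rewrite normr0 mul0r.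
  have := hr; rewrite ltr_pdivlMr ?ltr_pwDl ?mulr_ge0 //; apply: le_lt_trans.
  by rewrite ler_wpM2l // lerDr.
have step (i : 'I_d) : exists2 y, `|y - x| < r &
    u (x + h *: prefix_vec v i.+1) - u (x + h *: prefix_vec v i) = h * v 0 i * pd i u y.
  pose a := x + h *: prefix_vec v i.
  have near_x s : `|s| <= `|h * v 0 i| -> `|a + s *: e_dir R i - x| < r.
    move=> sh; apply: le_lt_trans hsmall.
    rewrite /a addrAC [x + _]addrC addrK (le_trans (ler_normD _ _)) // !normrZ.
    rewrite mulrDl mulrDr mul1r lerD //; first by rewrite ler_wpM2l ?norm_prefix_vec.
    apply: (@le_trans _ _ (`|s| * 1)); first by rewrite ler_wpM2l ?norm_e_dir_le.
    by rewrite mulr1 (le_trans sh) // normrM ler_wpM2l ?norm_row_coord.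
  have dphi (s : R) : `|s| <= `|h * v 0 i| ->
      is_derive s (1 : R) (fun s => u (a + s *: e_dir R i)) (pd i u (a + s *: e_dir R i)).
    move=> sh; apply: is_derive_line; apply: derivableP; apply: du; apply: hU.
    by apply: lt_le_trans (near_x s sh) _; rewrite ge_min lexx.
  have [s sh es] := mvt0 dphi.
  exists (a + s *: e_dir R i); first exact: near_x.
  by rewrite -es scale0r addr0 prefix_vecS scalerDr scalerA addrA.
have tele : u (x + h *: v) - u x =
    \sum_(i < d) (u (x + h *: prefix_vec v i.+1) - u (x + h *: prefix_vec v i)).
  rewrite -(big_mkord xpredT (fun k => u (x + h *: prefix_vec v k.+1) - u (x + h *: prefix_vec v k))).
  by rewrite telescope_sumr // prefix_vec_full prefix_vec0 scaler0 addr0.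
rewrite tele mulr_sumr -sumrB (le_trans (ler_norm_sum _ _ _)) //.
apply: (@le_trans _ _ (\sum_(i < d) `|h| * (`|v| * e'))).
  apply: ler_sum => i _; have [y yx ->] := step i.
  rewrite mulrA -mulrBr !normrM -mulrA ler_wpM2l // ler_pM ?norm_row_coord //.
  by apply: hc; apply: lt_le_trans yx _; rewrite ge_min lexx orbT.
rewrite sumr_const card_ord -[leLHS]mulr_natl.
have -> : d%:R * (`|h| * (`|v| * e')) = (d%:R * `|v| * e') * `|h| by ring.
rewrite ler_wpM2r // /e' mulrCA ler_piMr ?(ltW e0) //.
by rewrite ler_pdivrMr // mul1r lerDr.
Qed.

(** The m-th derivative along [v] of the partial derivative [pds s u], expanded over words. The new
    index becomes the outermost partial derivative, so that differentiating along [v] raises [m] by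
    one. *)
Fixpoint dird v m (s : seq 'I_d) u x : R :=
  if m is m'.+1 then \sum_i v 0 i * dird v m' (i :: s) u x else pds s u x.

Lemma dird_bound v m s u x (B : R) : `|v| <= 1 ->
  (forall s', size s' = (m + size s)%N -> `|pds s' u x| <= B) ->
  `|dird v m s u x| <= d%:R ^+ m * B.
Proof.
move=> v1; elim: m s => [|m IH] s h /=; first by rewrite mul1r h.
apply: (le_trans (ler_norm_sum _ _ _)).
apply: (@le_trans _ _ (\sum_(i < d) d%:R ^+ m * B)); last first.
  by rewrite sumr_const card_ord exprS -mulrA mulr_natl.
apply: ler_sum => i _; rewrite normrM -[leRHS]mul1r ler_pM //.
  by rewrite (le_trans (norm_row_coord _ _)).
by apply: IH => s' ss; apply: h; rewrite ss /= addnS addSn.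
Qed.

Lemma is_derive_dird U u v m s x (t : R) : open U -> smooth_real_on U u -> U (x + t *: v) ->
  is_derive t (1 : R) (fun tau => dird v m s u (x + tau *: v)) (dird v m.+1 s u (x + t *: v)).
Proof.
move=> oU su; elim: m s t => [|m IH] s t Ut.
  apply: (@is_derive_line _ _ (pds s u)).
  apply: (@is_derive_coordinates U (pds s u) _ v oU Ut) => [y Uy i|i].
    by have [_] := su s y Uy; apply.
  by have [] := su (i :: s) _ Ut.
rewrite [in X in is_derive _ _ X _]/=.
have -> : (fun tau => \sum_i v 0 i * dird v m (i :: s) u (x + tau *: v)) =
    \sum_i (fun tau => v 0 i * dird v m (i :: s) u (x + tau *: v)).
  by apply/funext => tau; rewrite fct_sumE.
apply: is_derive_sum => i; have := IH (i :: s) t Ut => /= h.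
exact: is_deriveZ.
Qed.

End ChainRule.

Section SmoothTaylor.
Variables (R : realType) (d : nat).
Implicit Types (u : 'rV[R]_d -> R) (x v : 'rV[R]_d) (U : set 'rV[R]_d).

Lemma local_bound U u x0 N : smooth_real_on U u -> U x0 ->
  exists2 r, 0 < r & exists2 B, 0 <= B &
    forall x s, `|x - x0| < r -> (size s <= N)%N -> `|pds s u x| <= B.
Proof.
move=> su Ux0.
have bnd1 (s : seq 'I_d) : exists2 r, 0 < r & exists B, forall x, `|x - x0| < r -> `|pds s u x| <= B.
  have [/continuous_epsP/(_ 1 ltr01)[r r0 h] _] := su s x0 Ux0.
  exists r => //; exists (1 + `|pds s u x0|) => x xr.
  by rewrite -[pds s u x](subrK (pds s u x0)) (le_trans (ler_normD _ _)) // lerD2r h.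
have bndm m : exists2 r, 0 < r & exists2 B, 0 <= B &
    forall x s, `|x - x0| < r -> size s = m -> `|pds s u x| <= B.
  have [r r0 hr] : exists2 r, 0 < r & forall s : m.-tuple 'I_d,
      exists B, forall x, `|x - x0| < r -> `|pds s u x| <= B.
    apply: (@uniform_radius R (m.-tuple 'I_d)
      (fun s r => exists B, forall x, `|x - x0| < r -> `|pds s u x| <= B)).
      by move=> s a b [B h] ab; exists B => x xa; apply: h; exact: lt_le_trans ab.
    by move=> s; exact: bnd1.
  exists r => //; have [B B0 hB] := @uniform_bound R (m.-tuple 'I_d)
    (fun s B => forall x, `|x - x0| < r -> `|pds s u x| <= B)
    (fun s a b h ab x xr => le_trans (h x xr) ab) hr.
  by exists B => // x s xr /eqP sm; exact: (hB (Tuple sm)).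
elim: N => [|N [r r0 [B B0 h]]].
  have [r r0 [B B0 h]] := bndm 0%N; exists r => //; exists B => // x s xr.
  by rewrite leqn0 => /eqP; exact: h.
have [r' r'0 [B' B'0 h']] := bndm N.+1.
exists (Num.min r r'); first by rewrite lt_min r0.
exists (B + B'); first exact: addr_ge0.
move=> x s; rewrite lt_min => /andP[xr xr']; rewrite leq_eqVlt => /orP[/eqP sN|sN].
  by rewrite (le_trans (h' x s xr' sN)) // lerDr.
by rewrite (le_trans (h x s xr sN)) // lerDl.
Qed.

Definition taylor_poly u N x v : {poly R} :=
  \poly_(m < N) ((m`!%:R)^-1 * dird v m [::] u x).

Lemma taylor_poly_coef_bound u N x v B : `|v| <= 1 -> 0 <= B ->
  (forall s, (size s < N)%N -> `|pds s u x| <= B) ->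
  forall m, `|(taylor_poly u N x v)`_m| <= B * (1 + d%:R) ^+ N.
Proof.
move=> v1 B0 h m; have rhs0 : 0 <= B * (1 + d%:R) ^+ N :> R by rewrite mulr_ge0 // exprn_ge0 // addr_ge0.
rewrite coef_poly; case: ifP => mN; last by rewrite normr0.
rewrite normrM normfV normr_nat ler_pdivrMl ?ltr0n ?fact_gt0 //.
apply: (@le_trans _ _ (d%:R ^+ m * B)).
  by apply: dird_bound => // s'; rewrite addn0 => e; apply: h; rewrite e.
rewrite mulrC -[leLHS]mul1r ler_pM ?mulr_ge0 ?exprn_ge0 //.
  by rewrite ler1n fact_gt0.
rewrite ler_wpM2l //; apply: (@le_trans _ _ ((1 + d%:R) ^+ m)).
  by rewrite lerXn2r ?nnegrE ?addr_ge0 // lerDr.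
by rewrite ler_weXn2l ?lerDl // ltnW.
Qed.

Lemma smooth_taylor U u x0 N : open U -> smooth_real_on U u -> U x0 ->
  exists2 r, 0 < r & exists2 C, 0 <= C & forall x v (t : R), `|x - x0| < r -> `|v| <= 1 ->
    `|t| < r -> `|u (x + t *: v) - (taylor_poly u N x v).[t]| <= C * `|t| ^+ N.
Proof.
move=> oU su Ux0.
have [r1 r10 [B B0 hB]] := local_bound N su Ux0.
have /open_epsP oU' := oU; have [r2 r20 hU] := oU' x0 Ux0.
pose r := Num.min r1 r2; have r0 : 0 < r by rewrite lt_min r10.
exists (r / 2); first by rewrite divr_gt0.
exists (d%:R ^+ N * B); first by rewrite mulr_ge0 // exprn_ge0.
move=> x v t xr v1 tr.
have near (s : R) : `|s| <= `|t| -> `|x + s *: v - x0| < r.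
  move=> st; rewrite addrAC; apply: (le_lt_trans (ler_normD _ _)).
  rewrite [r]splitr ltr_leD // normrZ -[leRHS]mulr1 ler_pM //.
  by rewrite (le_trans st) // ltW.
have -> : taylor_poly u N x v =
    \poly_(m < N) ((m`!%:R)^-1 * dird v m [::] u (x + 0 *: v)).
  by rewrite scale0r addr0.
apply: (taylor_chain (F := fun m tau => dird v m [::] u (x + tau *: v))).
  move=> m s mN st; apply: (is_derive_dird _ _ oU su); apply: hU.
  by apply: lt_le_trans (near s st) _; rewrite ge_min lexx orbT.
move=> s st; apply: dird_bound => // s' ss'; apply: hB.
  by apply: lt_le_trans (near s st) _; rewrite ge_min lexx.
by rewrite ss' addn0.
Qed.

End SmoothTaylor.

(** * Iterated finite differences and symmetry of partial derivatives *)

Section Differences.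
Variables (R : realType) (d : nat).
Implicit Types (u : 'rV[R]_d -> R) (x y v : 'rV[R]_d) (U : set 'rV[R]_d) (s : seq 'I_d).

Fixpoint diffs s (t : R) u x : R :=
  if s is i :: s' then diffs s' t u (x + t *: e_dir R i) - diffs s' t u x else u x.

Lemma smooth_pd U u i : smooth_real_on U u -> smooth_real_on U (pd i u).
Proof. by move=> su s x Ux; rewrite -!pds_rcons; exact: su. Qed.

Lemma smooth_pds U u s : smooth_real_on U u -> smooth_real_on U (pds s u).
Proof. by elim/last_ind: s u => // s i IH u su; rewrite pds_rcons; apply: IH; exact: smooth_pd. Qed.

Lemma norm_add_e_dir x y (t : R) i rho : `|y - (x + t *: e_dir R i)| <= rho -> `|y - x| <= rho + `|t|.
Proof.
move=> h; have -> : y - x = (y - (x + t *: e_dir R i)) + t *: e_dir R i.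
  by rewrite opprD addrA subrK.
rewrite (le_trans (ler_normD _ _)) // lerD // normrZ -[leRHS]mulr1.
by rewrite ler_wpM2l ?norm_e_dir_le.
Qed.

Lemma is_derive_diffs U u s x (t tau rho : R) i : smooth_real_on U u ->
  (forall y, `|y - x| <= rho -> U y) -> `|tau| + `|t| * (size s)%:R <= rho ->
  is_derive tau (1 : R) (fun tau => diffs s t u (x + tau *: e_dir R i))
    (diffs s t (pd i u) (x + tau *: e_dir R i)).
Proof.
move=> su; elim: s x rho => [|k s IH] x rho hU hr.
  apply: (@is_derive_line _ _ u); apply: derivableP.
  have Ux : U (x + tau *: e_dir R i).
    apply: hU; rewrite addrC addKr normrZ -[leRHS]mulr1.
    rewrite mulr0 addr0 in hr.
    by rewrite ler_pM ?norm_e_dir_le.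
  by have [_] := su [::] _ Ux; apply.
have szE : `|t| * (size (k :: s))%:R = `|t| * (size s)%:R + `|t| :> R.
  by rewrite /= -natr1 mulrDr mulr1.
rewrite szE addrA in hr.
apply: is_deriveB.
  have -> : (fun tau0 : R => diffs s t u (x + tau0 *: e_dir R i + t *: e_dir R k)) =
      (fun tau0 : R => diffs s t u ((x + t *: e_dir R k) + tau0 *: e_dir R i)).
    by apply/funext => z; rewrite addrAC.
  rewrite addrAC; apply: (IH _ (rho - `|t|)); last by rewrite lerBrDr.
  move=> y hy; apply: hU; apply: (le_trans (norm_add_e_dir hy)).
  by rewrite subrK.
apply: (IH _ rho hU); apply: le_trans hr; by rewrite lerDl.
Qed.

(** The mean value theorem is applied to the head of [s] and moves that derivative innermost, hence
    [rev s]. The order matters here: symmetry of derivatives is a consequence of this lemma. *)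
Lemma diffs_mvt U u s x (t rho : R) : smooth_real_on U u ->
  (forall y, `|y - x| <= rho -> U y) -> `|t| * (size s)%:R <= rho ->
  exists2 y, `|y - x| <= `|t| * (size s)%:R & diffs s t u x = t ^+ size s * pds (rev s) u y.
Proof.
elim: s u x rho => [|i s IH] u x rho su hU hr.
  by exists x; [rewrite subrr normr0 mulr0 | rewrite expr0 mul1r].
have szE : `|t| * (size (i :: s))%:R = `|t| + `|t| * (size s)%:R :> R.
  by rewrite /= -natr1 mulrDr mulr1 addrC.
rewrite szE in hr *.
have dphi (tau : R) : `|tau| <= `|t| ->
    is_derive tau (1 : R) (fun tau => diffs s t u (x + tau *: e_dir R i))
    (diffs s t (pd i u) (x + tau *: e_dir R i)).
  move=> ht; apply: (is_derive_diffs i su hU); apply: le_trans hr.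
  by rewrite lerD2r.
have [tau ht /=] := mvt0 dphi; rewrite scale0r addr0 => ->.
have [|y hy ->] := IH (pd i u) (x + tau *: e_dir R i) (`|t| * (size s)%:R) (smooth_pd i su) _ (lexx _).
  move=> y hy; apply: hU; apply: (le_trans (norm_add_e_dir hy)); apply: le_trans hr.
  by rewrite addrC lerD2r.
exists y; last by rewrite mulrA -exprS rev_cons pds_rcons.
by apply: (le_trans (norm_add_e_dir hy)); rewrite addrC lerD2r.
Qed.

Lemma diffsB s t u u' x :
  diffs s t (fun y => u y - u' y) x = diffs s t u x - diffs s t u' x.
Proof. by elim: s x => [|i s IH] x //=; rewrite !IH; ring. Qed.

Lemma diffs_shift s t u v x : diffs s t (fun y => u (y + v)) x = diffs s t u (x + v).
Proof. by elim: s x => [|i s IH] x //=; rewrite !IH addrAC. Qed.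

Lemma diffs_cat s1 s2 t u x : diffs (s1 ++ s2) t u x = diffs s1 t (diffs s2 t u) x.
Proof. by elim: s1 x => [|i s IH] x //=; rewrite !IH. Qed.

Lemma diffs_comm s1 s2 t u x : diffs s1 t (diffs s2 t u) x = diffs s2 t (diffs s1 t u) x.
Proof.
elim: s1 x => [|i s IH] x //=; rewrite !IH.
rewrite -(diffs_shift s2 t (diffs s t u)) -diffsB.
by [].
Qed.

Lemma diffs_perm s s' t u x : perm_eq s s' -> diffs s t u x = diffs s' t u x.
Proof.
move=> ss'; pose P s1 := diffs s t u x = diffs s1 t u x.
apply: (catCA_perm_ind (P := P) _ ss') => // s1 s2 s3; rewrite /P => ->.
have catE s2' s3' : diffs (s2' ++ s3') t u = diffs s2' t (diffs s3' t u).
  by apply/funext => y; rewrite diffs_cat.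
by rewrite !diffs_cat !catE diffs_comm.
Qed.

Lemma row_direction x y : exists2 v, `|v| <= 1 & y = x + `|y - x| *: v.
Proof.
have [->|yx] := eqVneq y x; first by exists 0; rewrite ?normr0 // scaler0 addr0.
have n0 : `|y - x| != 0 by rewrite normr_eq0 subr_eq0.
exists (`|y - x|^-1 *: (y - x)).
  by rewrite normrZ normfV normr_id mulVf.
by rewrite scalerA mulfV // scale1r addrC subrK.
Qed.

Lemma smooth_lipschitz U u x : open U -> smooth_real_on U u -> U x ->
  exists2 r, 0 < r & exists2 C, 0 <= C &
    forall y, `|y - x| < r -> `|u y - u x| <= C * `|y - x|.
Proof.
move=> oU su Ux; have [r r0 [C C0 h]] := smooth_taylor 1 oU su Ux.
exists r => //; exists C => // y yx.
have [v v1 ey] := row_direction x y.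
have := h x v `|y - x|; rewrite subrr normr0 => /(_ r0 v1).
rewrite normr_id -ey expr1 => /(_ yx).
by rewrite /taylor_poly horner_poly big_ord1 expr0 mulr1 fact0 invr1 mul1r.
Qed.

Lemma diffs_pds U u s x : open U -> smooth_real_on U u -> U x ->
  exists2 r, 0 < r & exists2 C, 0 <= C & forall t : R, `|t| < r ->
    `|diffs s t u x - t ^+ size s * pds (rev s) u x| <= C * `|t| ^+ (size s).+1.
Proof.
move=> oU su Ux; have [r r0 [C C0 h]] := smooth_lipschitz oU (smooth_pds (rev s) su) Ux.
have /open_epsP oU' := oU; have [rU rU0 hU] := oU' x Ux.
pose m : R := 1 + (size s)%:R; have m0 : 0 < m by rewrite ltr_pwDl.
pose r' := Num.min r rU; have r'0 : 0 < r' by rewrite lt_min r0.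
exists (r' / m); first by rewrite divr_gt0.
exists (C * (size s)%:R); first by rewrite mulr_ge0.
move=> t; rewrite ltr_pdivlMr // => tr.
have tsz : `|t| * (size s)%:R < r'.
  by apply: le_lt_trans tr; rewrite ler_wpM2l // lerDr.
have [|y hy ->] := diffs_mvt su _ (lexx (`|t| * (size s)%:R)) (x := x).
  move=> y hy; apply: hU; apply: (le_lt_trans hy); apply: lt_le_trans tsz _.
  by rewrite ge_min lexx orbT.
rewrite -mulrBr normrM normrX exprSr mulrCA ler_wpM2l ?exprn_ge0 //.
rewrite -mulrA [_%:R * _]mulrC; apply: (le_trans (h y _)); last by rewrite ler_wpM2l.
by apply: le_lt_trans hy (lt_le_trans tsz _); rewrite ge_min lexx.
Qed.

(** Schwarz's theorem: iterated differences do not depend on the order of the steps, and both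
    derivatives are the leading coefficient of the same difference as t tends to 0. *)
Lemma pds_perm U u s s' x : open U -> smooth_real_on U u -> U x -> perm_eq s s' ->
  pds s u x = pds s' u x.
Proof.
move=> oU su Ux ss'.
have [r r0 [C C0 h]] := diffs_pds (rev s) oU su Ux.
have [r' r'0 [C' C'0 h']] := diffs_pds (rev s') oU su Ux.
have pr : perm_eq (rev s) (rev s') by rewrite perm_rev perm_sym perm_rev perm_sym.
move: h h'; rewrite !revK !size_rev -(perm_size ss') => h h'.
set m := size s in h h'; set L := pds s u x in h *; set L' := pds s' u x in h' *.
have : dvdp 'X^(m.+1) ((L - L') *: 'X^m).
  apply: (@poly_small_dvd _ _ _ (Num.min r r') (C + C')).
  - by rewrite lt_min r0.
  - exact: addr_ge0.
  move=> t t0; rewrite lt_min => /andP[tr tr'].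
  have tn : `|t| = t by rewrite gtr0_norm.
  have := h t; rewrite tn => /(_ tr) h1; have := h' t; rewrite tn => /(_ tr') h1'.
  rewrite hornerZ hornerXn.
  have -> : (L - L') * t ^+ m = (diffs (rev s') t u x - t ^+ m * L') - (diffs (rev s) t u x - t ^+ m * L).
    by rewrite (diffs_perm _ _ _ pr); ring.
  by rewrite (le_trans (ler_normB _ _)) // addrC mulrDl lerD.
move=> /dvdXnP/(_ m (ltnSn m)); rewrite coefZ coefXn eqxx mulr1 => /eqP.
by rewrite subr_eq0 => /eqP.
Qed.

(** Signs and displacements of the 2^|s| nodes of an iterated difference. *)
Fixpoint dvecs s : seq (R * 'rV[R]_d) :=
  if s is i :: s' then [seq (p.1, p.2 + e_dir R i) | p <- dvecs s'] ++
    [seq (- p.1, p.2) | p <- dvecs s'] else [:: (1, 0)].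

Lemma size_dvecs s : size (dvecs s) = (2 ^ size s)%N.
Proof. by elim: s => // i s IH /=; rewrite size_cat !size_map IH expnS mul2n addnn. Qed.

Lemma dvecs_bound s p : p \in dvecs s -> `|p.1| = 1 /\ `|p.2| <= (size s)%:R.
Proof.
elim: s p => [|i s IH] p /=.
  by rewrite inE => /eqP -> /=; rewrite normr1 normr0.
rewrite mem_cat => /orP[] /mapP[q /IH[h1 h2] ->] /=.
  split => //; rewrite (le_trans (ler_normD _ _)) // -natr1 lerD ?norm_e_dir_le //.
by rewrite normrN; split => //; rewrite (le_trans h2) // ler_nat.
Qed.

Lemma diffs_dvecs s t u x : diffs s t u x = \sum_(p <- dvecs s) p.1 * u (x + t *: p.2).
Proof.
elim: s x => [|i s IH] x /=.
  by rewrite big_seq1 mul1r scaler0 addr0.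
rewrite big_cat /= !big_map !IH -sumrN; congr (_ + _); apply: eq_bigr => p _ /=.
  by rewrite scalerDr addrA [in RHS]addrAC.
by rewrite mulNr.
Qed.

(** The derivative is the coefficient of t^m in an iterated difference, a signed sum of 2^m values
    of [u] on lines through [x]. Each line contributes at most [A], and the polynomials of different
    lines need not be related. *)
Lemma pds_expansion_bound U u s x A : open U -> smooth_real_on U u -> U x -> 0 <= A ->
  (forall v, `|v| <= (size s)%:R -> exists p : {poly R}, `|p`_(size s)| <= A /\
     exists2 r, 0 < r & exists2 C, 0 <= C & forall t : R, `|t| < r ->
       `|u (x + t *: v) - p.[t]| <= C * `|t| ^+ (size s).+1) ->
  `|pds s u x| <= 2 ^+ size s * A.
Proof.
move=> oU su Ux A0 hv.
have [r r0 [C C0 h]] := diffs_pds (rev s) oU su Ux.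
rewrite size_rev revK in h; set m := size s in h hv *.
have [P [PA [r' r'0 [C' C'0 hP]]]] : exists P : {poly R}, `|P`_m| <= 2 ^+ m * A /\
    exists2 r, 0 < r & exists2 C, 0 <= C & forall t : R, `|t| < r ->
      `|diffs (rev s) t u x - P.[t]| <= C * `|t| ^+ m.+1.
  have -> : 2 ^+ m = (size (dvecs (rev s)))%:R :> R by rewrite size_dvecs size_rev natrX.
  have : forall p, p \in dvecs (rev s) -> `|p.1| = 1 /\ `|p.2| <= m%:R.
    by move=> p /dvecs_bound; rewrite size_rev.
  suff : forall l : seq (R * 'rV[R]_d), (forall p, p \in l -> `|p.1| = 1 /\ `|p.2| <= m%:R) ->
      exists P : {poly R}, `|P`_m| <= (size l)%:R * A /\
      exists2 r, 0 < r & exists2 C, 0 <= C & forall t : R, `|t| < r ->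
      `|\sum_(p <- l) p.1 * u (x + t *: p.2) - P.[t]| <= C * `|t| ^+ m.+1.
    move=> H /H[P [PA [r' r'0 [C' C'0 hP]]]]; exists P; split => //.
    by exists r' => //; exists C' => // t tr; rewrite diffs_dvecs hP.
  elim=> [|q l IH] hl.
    exists 0; rewrite coef0 normr0 mul0r; split => //; exists 1 => //; exists 0 => // t _.
    by rewrite big_nil horner0 subr0 normr0 mul0r.
  have [P [PA [r1 r10 [C1 C10 hP]]]] := IH (fun p pl => hl p (@mem_behead _ (q :: l) p pl)).
  have [q1 q2] := hl q (mem_head _ _).
  have [p [pA [r2 r20 [C2 C20 hp]]]] := hv _ q2.
  exists (q.1 *: p + P); split.
    rewrite coefD coefZ (le_trans (ler_normD _ _)) // normrM q1 mul1r /= -natr1 mulrDl mul1r.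
    by rewrite addrC lerD.
  exists (Num.min r1 r2); first by rewrite lt_min r10.
  exists (C1 + C2); first exact: addr_ge0.
  move=> t; rewrite lt_min => /andP[tr1 tr2].
  rewrite big_cons hornerD hornerZ.
  have -> : q.1 * u (x + t *: q.2) + \sum_(j <- l) j.1 * u (x + t *: j.2) - (q.1 * p.[t] + P.[t]) =
    (\sum_(j <- l) j.1 * u (x + t *: j.2) - P.[t]) + q.1 * (u (x + t *: q.2) - p.[t]) by ring.
  rewrite (le_trans (ler_normD _ _)) // mulrDl lerD ?hP // normrM q1 mul1r.
  exact: hp.
have dv : dvdp 'X^(m.+1) (P - (pds s u x) *: 'X^m).
  apply: (@poly_small_dvd _ _ _ (Num.min r r') (C + C')).
  - by rewrite lt_min r0.
  - exact: addr_ge0.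
  move=> t t0; rewrite lt_min => /andP[tr tr'].
  have tn : `|t| = t by rewrite gtr0_norm.
  have := h t; rewrite tn => /(_ tr) h1; have := hP t; rewrite tn => /(_ tr') h1'.
  rewrite hornerD hornerN hornerZ hornerXn.
  have -> : P.[t] - pds s u x * t ^+ m =
    (diffs (rev s) t u x - t ^+ m * pds s u x) - (diffs (rev s) t u x - P.[t]) by ring.
  by rewrite (le_trans (ler_normB _ _)) // mulrDl lerD.
move: dv => /dvdXnP/(_ m (ltnSn m)); rewrite coefB coefZ coefXn eqxx mulr1 => /eqP.
by rewrite subr_eq0 => /eqP <-.
Qed.

End Differences.

(** * Uniform directional Taylor expansions imply smoothness *)

Section UniformTaylor.
Variables (R : realType) (d : nat).
Implicit Types (u : 'rV[R]_d -> R) (x y v w : 'rV[R]_d) (U : set 'rV[R]_d).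

(** The polynomials of different lines are unrelated; what carries the information is that [r] and
    [C] do not depend on [x] and [v]. *)
Definition unif_taylor U u := forall x0, U x0 -> forall k,
  exists2 r, 0 < r & exists2 C, 0 <= C & forall x v, `|x - x0| < r -> `|v| <= 1 ->
  exists2 p : {poly R}, (size p <= k.+1)%N &
    forall t : R, `|t| < r -> `|u (x + t *: v) - p.[t]| <= C * `|t| ^+ k.+1.

Lemma expansion_coef0 u x v (p : {poly R}) k (r C : R) : 0 < r ->
  (forall t : R, `|t| < r -> `|u (x + t *: v) - p.[t]| <= C * `|t| ^+ k.+1) -> p`_0 = u x.
Proof.
move=> r0 /(_ 0); rewrite normr0 => /(_ r0); rewrite scale0r addr0 expr0n mulr0 normr_le0.
by rewrite subr_eq0 => /eqP ->; rewrite horner_coef0.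
Qed.

Lemma expansion_derive u x v (p : {poly R}) k (r C : R) : 0 < r -> 0 <= C ->
  (forall t : R, `|t| < r -> `|u (x + t *: v) - p.[t]| <= C * `|t| ^+ k.+2) ->
  is_derive x v u p`_1.
Proof.
move=> r0 C0 h; have p0 := expansion_coef0 r0 h.
pose q := drop_poly 2 p; pose B := nrmp 1 q.
have B0 : 0 <= B by exact: nrmp_ge0.
have ep (t : R) : p.[t] = u x + t * p`_1 + q.[t] * t ^+ 2.
  rewrite -[p in LHS](poly_take_drop 2) hornerD hornerM hornerXn; congr (_ + _).
  by rewrite (@horner_coef_wide _ 2) ?size_take_poly // !big_ord_recr big_ord0 /= !coef_take_poly /= add0r expr0 mulr1 expr1 p0 mulrC.
apply/is_derive_epsP => e e0.
pose dl := Num.min (Num.min r 1) (e / (C + B + 1)).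
have CB : 0 < C + B + 1 by rewrite ltr_wpDl ?addr_ge0.
exists dl; first by rewrite !lt_min r0 ltr01 divr_gt0.
move=> t; rewrite !lt_min => /andP[/andP[tr t1] te].
have -> : u (x + t *: v) - u x - t * p`_1 = (u (x + t *: v) - p.[t]) + q.[t] * t ^+ 2.
  by rewrite ep; ring.
apply: (le_trans (ler_normD _ _)).
apply: (@le_trans _ _ ((C + B) * `|t| * `|t|)).
  rewrite -mulrA mulrDl -expr2 lerD //.
    apply: (le_trans (h t tr)); rewrite ler_wpM2l //.
    by apply: (ler_wiXn2l (normr_ge0 t) (ltW t1)).
  by rewrite normrM normrX ler_wpM2r ?exprn_ge0 //; exact: horner_le_nrmp1 (ltW t1).
rewrite ler_wpM2r //; move: te; rewrite ltr_pdivlMr // => /ltW; apply: le_trans.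
by rewrite mulrC ler_wpM2l // lerDl.
Qed.

Lemma unif_taylor_lipschitz U u x0 : unif_taylor U u -> U x0 ->
  exists2 r, 0 < r & exists2 C, 0 <= C & forall x v (t : R), `|x - x0| < r -> `|v| <= 1 ->
    `|t| < r -> `|u (x + t *: v) - u x| <= C * `|t|.
Proof.
move=> tu Ux0; have [r r0 [C C0 h]] := tu x0 Ux0 0%N.
exists r => //; exists C => // x v t xr v1 tr; have [p sp hp] := h x v xr v1.
have := hp t tr; rewrite expr1 (size1_polyC sp) hornerC (expansion_coef0 r0 hp) //.
Qed.

Lemma unif_taylor_continuous U u x0 : unif_taylor U u -> U x0 -> {for x0, continuous u}.
Proof.
move=> tu Ux0; have [r r0 [C C0 h]] := unif_taylor_lipschitz tu Ux0.
apply/continuous_epsP => e e0.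
have C1 : 0 < C + 1 by rewrite ltr_wpDl.
exists (Num.min r (e / (C + 1))); first by rewrite lt_min r0 divr_gt0.
move=> y; rewrite lt_min => /andP[yr ye].
have [v v1 ey] := row_direction x0 y.
have := h x0 v `|y - x0|; rewrite subrr normr0 normr_id => /(_ r0 v1 yr); rewrite -ey.
move=> /le_trans -> //; move: ye; rewrite ltr_pdivlMr // => /ltW; apply: le_trans.
by rewrite mulrC ler_wpM2l // lerDl.
Qed.

Lemma unif_taylor_derive U u x0 : unif_taylor U u -> U x0 ->
  exists2 r, 0 < r & exists2 C, 0 <= C & forall x v, `|x - x0| < r -> `|v| <= 1 ->
    is_derive x v u ('D_v u x) /\ forall t : R, `|t| < r ->
    `|u (x + t *: v) - u x - t * 'D_v u x| <= C * `|t| ^+ 2.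
Proof.
move=> tu Ux0; have [r r0 [C C0 h]] := tu x0 Ux0 1%N.
exists r => //; exists C => // x v xr v1; have [p sp hp] := h x v xr v1.
have dp := expansion_derive r0 C0 hp.
have e1 : 'D_v u x = p`_1 by rewrite (@derive_val _ _ _ _ _ _ _ dp).
rewrite e1; split => // t tr; have := hp t tr; congr (_ <= _).
rewrite (horner_coef_wide _ sp) !big_ord_recr big_ord0 /= expr0 mulr1 add0r expr1.
by rewrite (expansion_coef0 r0 hp) opprD addrA [t * _]mulrC.
Qed.

(** Lagrange interpolation at 0, ..., n-1 gives a formula for the derivative at 0 that is exact
    below degree n, with weights depending on n only. *)
Lemma difference_coefs n : exists c : 'I_n -> R, forall p : {poly R},
  (size p <= n)%N -> p`_1 = \sum_l c l * p.[l%:R].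
Proof.
pose rs : seq R := [seq k%:R | k <- iota 0 n].
have urs : uniq rs.
  by rewrite map_inj_uniq ?iota_uniq // => a b /eqP; rewrite eqr_nat => /eqP.
have srs : size rs = n by rewrite size_map size_iota.
exists (fun l : 'I_n => (lagr rs l%:R)`_1 / (lagr rs l%:R).[l%:R]) => p sp.
rewrite -srs in sp; rewrite [in LHS](lagrange_interpolation urs sp) coef_sum big_map.
rewrite -[n in iota 0 n]subn0 -/(index_iota 0 n) big_mkord; apply: eq_bigr => l _.
by rewrite coefZ; ring.
Qed.

(* Displacement [t^2] against difference quotients of step [t]. *)
Lemma pd_line_limit U u x0 i : unif_taylor U u -> U x0 ->
  exists2 r, 0 < r & exists2 C, 0 <= C & forall x w (t : R), `|x - x0| < r -> `|w| <= 1 ->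
    0 < t -> t < r -> `|pd i u (x + t ^+ 2 *: w) - pd i u x| <= C * t.
Proof.
move=> tu Ux0; have [r1 r10 [C1 C10 h1]] := unif_taylor_lipschitz tu Ux0.
have [r2 r20 [C2 C20 h2]] := unif_taylor_derive tu Ux0.
pose r := Num.min (Num.min r1 r2) 1.
have r0 : 0 < r by rewrite !lt_min r10 r20 ltr01.
exists (r / 2); first by rewrite divr_gt0.
exists (2 * C1 + 2 * C2); first by rewrite addr_ge0 // mulr_ge0.
move=> x w t xr w1 t0 tr; have rr : r / 2 < r by rewrite ltr_pdivrMr // ltr_pMr // ltr1n.
have t1 : t < 1.
  by apply: lt_trans tr (lt_le_trans rr _); rewrite ge_min lexx orbT.
have tt : t ^+ 2 <= t by rewrite expr2 ler_piMr ?ltW.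
have tt0 : 0 <= t ^+ 2 by rewrite exprn_ge0 // ltW.
have rr1 z : z < r -> z < r1.
  by move=> h; apply: (lt_le_trans h); rewrite !ge_min lexx.
have rr2 z : z < r -> z < r2.
  by move=> h; apply: (lt_le_trans h); rewrite !ge_min lexx orbT.
have tn : `|t| = t by rewrite gtr0_norm.
have ttn : `|t ^+ 2| = t ^+ 2 by rewrite ger0_norm.
have near (a : R) z : `|z| <= 1 -> 0 <= a -> a <= t -> `|x + a *: z - x0| < r.
  move=> z1 a0 a_t; rewrite addrAC; apply: (le_lt_trans (ler_normD _ _)).
  rewrite [r]splitr ltrD // normrZ (ger0_norm a0).
  by apply: le_lt_trans tr; rewrite -[leRHS]mulr1 ler_pM.
have xr' : `|x - x0| < r by exact: lt_trans rr.
have tr' : `|t| < r by rewrite tn; exact: lt_trans rr.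
have ttr' : `|t ^+ 2| < r by rewrite ttn (le_lt_trans tt) // -tn.
pose e := e_dir R i; have e1 : `|e| <= 1 := norm_e_dir_le R i.
pose y := x + t ^+ 2 *: w.
have [_ /(_ t (rr2 _ tr')) a1] := h2 y e (rr2 _ (near _ _ w1 tt0 tt)) e1.
have [_ /(_ t (rr2 _ tr')) a2] := h2 x e (rr2 _ xr') e1.
have a3 := h1 (x + t *: e) w (t ^+ 2) (rr1 _ (near _ _ e1 (ltW t0) (lexx t))) w1 (rr1 _ ttr').
have a4 := h1 x w (t ^+ 2) (rr1 _ xr') w1 (rr1 _ ttr').
rewrite -(ler_pM2l t0) -{1}tn -normrM; rewrite tn ttn in a1 a2 a3 a4.
rewrite /pd -/e -/y in a1 a2 a3 a4 *; rewrite addrAC -/y in a3.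
(* Two difference quotients with error t^2 and two displacements of size t^2: every term is O(t^2),
   which leaves O(t) after division by t. *)
have -> : t * ('D_e u y - 'D_e u x) =
   - (u (y + t *: e) - u y - t * 'D_e u y) + (u (x + t *: e) - u x - t * 'D_e u x) +
   ((u (y + t *: e) - u (x + t *: e)) - (u y - u x)) by ring.
have -> : t * ((2 * C1 + 2 * C2) * t) = C2 * t ^+ 2 + C2 * t ^+ 2 + (C1 * t ^+ 2 + C1 * t ^+ 2) by ring.
apply: (le_trans (ler_normD _ _)); rewrite lerD //.
  by apply: (le_trans (ler_normD _ _)); rewrite normrN lerD.
by apply: (le_trans (ler_normB _ _)); rewrite lerD.
Qed.

End UniformTaylor.

Section UniformTaylorClosure.
Variables (R : realType) (d : nat).
Implicit Types (u : 'rV[R]_d -> R) (x y v w : 'rV[R]_d) (U : set 'rV[R]_d).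

Lemma size_dilate (p : {poly R}) (c : R) n : (size p <= n)%N -> (size (p \Po (c *: 'X)) <= n)%N.
Proof.
move=> sp; apply/leq_sizeP => i ni; rewrite coef_dilate nth_default ?mulr0 //.
exact: leq_trans ni.
Qed.

Lemma horner_dilate (p : {poly R}) (c t : R) : (p \Po (c *: 'X)).[t] = p.[c * t].
Proof. by rewrite horner_comp hornerZ hornerX. Qed.

(* The derivative at [x + t w] is computed by a difference quotient of step [t],
   the size of the displacement: the nodes [x + t (w + l e_i)] then lie on finitely
   many fixed lines through [x], where the expansions of [u] apply. *)
Lemma unif_taylor_pd_punctured U u x0 i k : unif_taylor U u -> U x0 ->
  exists2 r, 0 < r & exists2 C, 0 <= C & forall x w, `|x - x0| < r -> `|w| <= 1 ->
  exists2 q : {poly R}, (size q <= k.+1)%N &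
    forall t : R, `|t| < r -> t != 0 -> `|pd i u (x + t *: w) - q.[t]| <= C * `|t| ^+ k.+1.
Proof.
move=> tu Ux0; have [r r0 [C C0 h]] := tu x0 Ux0 k.+1.
pose n := k.+2; have [c hc] := difference_coefs R n.
pose M : R := n%:R.
have M1 : 1 <= M by rewrite /M ler1n.
have M0 : 0 < M := lt_le_trans ltr01 M1.
have e1 := norm_e_dir_le R i; set e := e_dir R i in e1.
pose S := \sum_l `|c l|.
have S0 : 0 <= S by apply: sumr_ge0.
pose r' := r / (2 * M).
have r'0 : 0 < r' by rewrite divr_gt0 // mulr_gt0.
have r'2 : r' + r' <= r.
  rewrite -mulr2n -[leLHS]mulr_natl /r' mulrCA ler_piMr ?(ltW r0) //.
  by rewrite ler_pdivrMr ?mulr_gt0 // mul1r ler_peMr.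
have Mr' : M * r' < r.
  rewrite /r' mulrA ltr_pdivrMr ?mulr_gt0 // mulrC ltr_pM2l //.
  by rewrite ltr_pMl // ltr1n.
exists r' => //; exists (2 * (S * (C * M ^+ n))).
  by rewrite mulr_ge0 // mulr_ge0 // mulr_ge0 // exprn_ge0 // ltW.
move=> x w xr' w1.
have xr : `|x - x0| < r by apply: lt_le_trans r'2; rewrite ltr_wpDr // ltW.
(* Since |w + l e| <= 1 + l <= n, division by M = n gives an admissible direction; the parameter on
   that line is then M t. *)
pose wl (l : 'I_n) := M^-1 *: (w + l%:R *: e).
have wl1 l : `|wl l| <= 1.
  rewrite normrZ normfV (gtr0_norm M0) ler_pdivrMl // mulr1.
  apply: (le_trans (ler_normD _ _)); rewrite normrZ normr_nat.
  apply: (@le_trans _ _ (1 + l%:R * 1)); first by rewrite lerD // ler_wpM2l.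
  by rewrite mulr1 nat1r /M ler_nat.
have /choice[p hp] : forall l : 'I_n, exists p : {poly R}, (size p <= n)%N /\
    forall t : R, `|t| < r -> `|u (x + t *: wl l) - p.[t]| <= C * `|t| ^+ n.
  by move=> l; have [p sp hp] := h x (wl l) xr (wl1 l); exists p.
pose Q := \sum_l c l *: (p l \Po (M *: 'X)).
have sQ : (size Q <= n)%N.
  rewrite /Q; elim/big_ind : _ => [|a b sa sb|l _]; first by rewrite size_poly0.
    by rewrite (leq_trans (size_polyD _ _)) // geq_max sa.
  by rewrite (leq_trans (size_scale_leq _ _)) // size_dilate //; have [] := hp l.
(* The weights annihilate constants, and all lines share the constant term u(x). So Q / X is a
   polynomial, and it is the desired expansion. *)
have Q0 : Q`_0 = 0.
  have := hc (u x)%:P; rewrite coefC /= size_polyC => /(_ (leq_trans (leq_b1 _) (ltn0Sn _))) e0.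
  rewrite [RHS]e0 coef_sum; apply: eq_bigr => l _.
  by rewrite coefZ coef_dilate expr0 mul1r hornerC (expansion_coef0 r0 (hp l).2).
exists (drop_poly 1 Q); first by rewrite size_drop_poly leq_subLR.
move=> t tr' t0.
have tp : 0 < `|t| by rewrite normr_gt0.
have yr : `|x + t *: w - x0| < r.
  rewrite addrAC; apply: (le_lt_trans (ler_normD _ _)); apply: lt_le_trans r'2.
  rewrite ltrD // normrZ; apply: le_lt_trans tr'.
  by rewrite -[leRHS]mulr1 ler_wpM2l.
have [py spy hpy] := h (x + t *: w) e yr e1.
have dpy : py`_1 = pd i u (x + t *: w).
  have dp := expansion_derive r0 C0 hpy.
  by rewrite /pd -/e (@derive_val _ _ _ _ _ _ _ dp).
have pt : t * pd i u (x + t *: w) = \sum_l c l * py.[l%:R * t].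
  have := hc (py \Po (t *: 'X)) (size_dilate t spy).
  rewrite coef_dilate expr1 dpy => ->; apply: eq_bigr => l _.
  by rewrite horner_dilate [t * _]mulrC.
have lM (l : 'I_n) : l%:R <= M by rewrite ler_nat ltnW.
have lt_ (l : 'I_n) : `|l%:R * t| <= M * `|t|.
  by rewrite normrM normr_nat ler_wpM2r.
have Mt : M * `|t| < r by apply: lt_trans Mr'; rewrite ltr_pM2l.
have main : `|t * pd i u (x + t *: w) - Q.[t]| <= 2 * (S * (C * M ^+ n)) * `|t| ^+ n.
  have -> : t * pd i u (x + t *: w) - Q.[t] =
      \sum_l c l * ((u (x + (M * t) *: wl l) - (p l).[M * t]) -
                    (u (x + t *: w + (l%:R * t) *: e) - py.[l%:R * t])).
    rewrite pt /Q horner_sum -sumrB; apply: eq_bigr => l _.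
    rewrite hornerZ horner_dilate -mulrBr; congr (_ * _).
    have -> : x + (M * t) *: wl l = x + t *: w + (l%:R * t) *: e.
      rewrite /wl scalerA mulrAC mulfV ?gt_eqF // mul1r scalerDr scalerA addrA.
      by rewrite [t * _]mulrC.
    by ring.
  apply: (le_trans (ler_norm_sum _ _ _)).
  have -> : 2 * (S * (C * M ^+ n)) * `|t| ^+ n = \sum_l `|c l| * (2 * (C * (M * `|t|) ^+ n)).
    by rewrite -mulr_suml -/S exprMn; ring.
  apply: ler_sum => l _; rewrite normrM ler_wpM2l //.
  apply: (le_trans (ler_normB _ _)); rewrite [leRHS]mulr_natl mulr2n lerD //.
    have := (hp l).2 (M * t); rewrite normrM (gtr0_norm M0) => /(_ Mt); exact.
  apply: (le_trans (hpy _ (le_lt_trans (lt_ l) Mt))); rewrite ler_wpM2l //.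
  by rewrite lerXn2r ?nnegrE // mulr_ge0 // ltW.
have eQ : Q.[t] = t * (drop_poly 1 Q).[t].
  rewrite -[Q in LHS](poly_take_drop 1) hornerD hornerM hornerXn expr1.
  rewrite (size1_polyC (size_take_poly _ _)) hornerC coef_take_poly /= Q0 add0r.
  by rewrite mulrC.
rewrite eQ -mulrBr normrM exprS mulrCA ler_pM2l // in main.
Qed.

(** Only t = 0 is missing from the punctured expansion, that is, the constant term of [q] must be
    the partial derivative at [x]; [pd_line_limit] identifies it. *)
Lemma unif_taylor_pd U u i : unif_taylor U u -> unif_taylor U (pd i u).
Proof.
move=> tu x0 Ux0 k.
have [r1 r10 [C1 C10 h1]] := unif_taylor_pd_punctured i k tu Ux0.
have [r2 r20 [C2 C20 h2]] := pd_line_limit i tu Ux0.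
pose r := Num.min r1 r2.
have r0 : 0 < r by rewrite lt_min r10.
exists r => //; exists C1 => // x w; rewrite lt_min => /andP[xr1 xr2] w1.
have [q sq hq] := h1 x w xr1 w1; exists q => // t; rewrite lt_min => /andP[tr1 _].
have [->|t0] := eqVneq t 0; last exact: hq.
rewrite scale0r addr0 normr0 expr0n mulr0 normr_le0 horner_coef0.
(* At displacement s^2 the available error is O(s), so the comparison is made between polynomials in
   s. *)
pose P := q \Po 'X^2 - (pd i u x)%:P.
have : dvdp 'X^1 P.
  apply: (@poly_small_dvd _ _ _ (Num.min r 1) (C1 + C2)).
  - by rewrite lt_min r0 ltr01.
  - exact: addr_ge0.
  move=> s s0; rewrite !lt_min => /andP[/andP[sr1 sr2] s1].
  rewrite /P hornerD hornerN hornerC horner_comp hornerXn expr1.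
  have ss0 : 0 < s ^+ 2 by rewrite exprn_gt0.
  have ssn : `|s ^+ 2| = s ^+ 2 by rewrite gtr0_norm.
  have ss : s ^+ 2 <= s by rewrite expr2 ler_piMr ?ltW.
  have := hq (s ^+ 2); rewrite ssn => /(_ (le_lt_trans ss sr1)); rewrite gt_eqF // => /(_ isT) a1.
  have a2 := h2 x w s xr2 w1 s0 sr2.
  have -> : q.[s ^+ 2] - pd i u x = (pd i u (x + s ^+ 2 *: w) - pd i u x) -
      (pd i u (x + s ^+ 2 *: w) - q.[s ^+ 2]) by ring.
  apply: (le_trans (ler_normB _ _)); rewrite addrC mulrDl lerD //.
  apply: (le_trans a1); rewrite ler_wpM2l //.
  apply: (le_trans _ ss); rewrite -[leRHS]expr1.
  by apply: ler_wiXn2l => //; [exact: ltW|exact: le_trans ss (ltW s1)].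
move=> /dvdXnP/(_ 0%N (ltnSn 0)); rewrite /P coefB coefC /= -horner_coef0 horner_comp hornerXn.
by rewrite expr0n /= horner_coef0 => /eqP; rewrite subr_eq0 => /eqP ->; rewrite subrr.
Qed.

Lemma unif_taylor_smooth U u : unif_taylor U u -> smooth_real_on U u.
Proof.
move=> tu; have tus s : unif_taylor U (pds s u).
  by elim: s => // i s IH; exact: unif_taylor_pd.
move=> s x Ux; split; first exact: unif_taylor_continuous (tus s) Ux.
move=> i; have [r r0 [C C0 h]] := unif_taylor_derive (tus s) Ux.
have := h x (e_dir R i); rewrite subrr normr0 => /(_ r0 (norm_e_dir_le R i)) [dx _].
exact: (@ex_derive _ _ _ _ _ _ _ dx).
Qed.

End UniformTaylorClosure.

(** * Weight functions *)

Section Weights.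
Variables (R : realType) (w : R -> R).
Hypothesis ww : weight_function w.

Lemma weight_ge0 t : 0 <= t -> 0 <= w t.
Proof. by have [h _] := ww; exact: h. Qed.

Lemma weight_le s t : 0 <= s -> s <= t -> w s <= w t.
Proof.
move=> s0; rewrite le_eqVlt => /orP[/eqP -> //|st].
by have [_ [_ [h _]]] := ww; apply/ltW/h.
Qed.

Lemma weight_phi_ge0 t : 0 <= phi_w w t.
Proof. by apply: weight_ge0; exact: expR_ge0. Qed.

(** Finiteness comes from log t = o(w(t)). It has to be established before any use of [phi_star], as
    [sup] takes a default value on unbounded sets. *)
Lemma phi_star_set_bounded s : exists b, forall t, 0 <= t -> s * t - phi_w w t <= b.
Proof.
have [_ [_ [_ [_ [_ [hlog _]]]]]] := ww.
have s1 : 0 < `|s| + 1 by rewrite ltr_wpDl.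
have [T hT] := hlog (`|s| + 1)^-1 ltac:(by rewrite invr_gt0).
exists (`|s| * `|T|) => t t0.
have [Tt|tT] := leP T (expR t).
  have := hT _ Tt (expR_gt0 t); rewrite expRK ler_pdivlMl // => h.
  apply: (@le_trans _ _ 0); last by rewrite mulr_ge0.
  rewrite subr_le0; apply: le_trans h; rewrite ler_wpM2r //.
  by rewrite (le_trans (ler_norm _)) // lerDl.
apply: (@le_trans _ _ (s * t)); first by rewrite gerBl weight_phi_ge0.
apply: (le_trans (ler_norm _)); rewrite normrM ler_wpM2l // (ger0_norm t0).
apply: le_trans (ler_norm _); apply: ltW; apply: le_lt_trans tT.
by apply: le_trans (expR_ge1Dx t); rewrite lerDr.
Qed.

Lemma phi_star_ub s t : 0 <= t -> s * t - phi_w w t <= phi_star w s.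
Proof.
move=> t0; apply: sup_upper_bound; last by exists t.
split; first by exists (s * t - phi_w w t); exists t.
by have [b hb] := phi_star_set_bounded s; exists b => _ [u u0 <-]; exact: hb.
Qed.

Lemma phi_star_lub s b : (forall t, 0 <= t -> s * t - phi_w w t <= b) -> phi_star w s <= b.
Proof.
move=> h; apply: ge_sup; last by move=> _ [t t0 <-]; exact: h.
by exists (s * 0 - phi_w w 0); exists 0 => //=.
Qed.

(** Concavity and w(0) >= 0 give w(l y) <= l w(y); testing the supremum for l s at the point t + ln
    l gives the claim. *)
Lemma phi_star_dilate s l : concave_on_nonneg w -> 1 <= l ->
  phi_star w s + s * ln l <= phi_star w (l * s) / l.
Proof.
move=> cw l1; have l0 : 0 < l := lt_le_trans ltr01 l1.
rewrite -lerBrDr; apply: phi_star_lub => t t0.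
rewrite lerBrDr ler_pdivlMr //.
have t'0 : 0 <= t + ln l by rewrite addr_ge0 // ln_ge0.
apply: le_trans (phi_star_ub (l * s) t'0).
have -> : (s * t - phi_w w t + s * ln l) * l = l * s * (t + ln l) - l * phi_w w t by ring.
rewrite lerB // /phi_w expRD lnK ?posrE //.
have li1 : l^-1 <= 1 by rewrite invf_le1.
have := cw (expR t * l) 0 l^-1 (mulr_ge0 (expR_ge0 _) (ltW l0)) (lexx _) _ li1.
rewrite invr_ge0 (ltW l0) => /(_ isT).
rewrite mulr0 addr0 mulrCA mulVf ?gt_eqF // mulr1 => h.
rewrite -ler_pdivrMl //; apply: le_trans h; rewrite lerDl mulr_ge0 ?weight_ge0 //.
by rewrite subr_ge0.
Qed.

(** Iterate the doubling condition; [B] covers the bounded range on which that condition says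
    nothing. *)
Lemma weight_dilate (A : R) : 0 <= A -> exists L B, [/\ 1 <= L, 0 <= B &
  forall t, 0 <= t -> w (A * t) <= L * w t + B].
Proof.
move=> A0; have [_ [_ [_ [[C [T hT]] _]]]] := ww.
have dbl t : 0 <= t -> w (2 * t) <= (`|C| + 1) * w t + w (2 * `|T|).
  move=> t0; have wt := weight_ge0 t0.
  have wT : 0 <= w (2 * `|T|) by apply: weight_ge0; rewrite mulr_ge0.
  have [Tt|tT] := leP T t.
    apply: (le_trans (hT t Tt)); rewrite -[leLHS]addr0 lerD // ler_wpM2r //.
    by rewrite (le_trans (ler_norm _)) // lerDl.
  rewrite -[leLHS]add0r lerD //; first by rewrite mulr_ge0 // addr_ge0.
  apply: weight_le; first by rewrite mulr_ge0.
  by rewrite ler_wpM2l // (le_trans (ltW tT)) // ler_norm.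
have iter p : exists L B, [/\ 1 <= L, 0 <= B &
    forall t, 0 <= t -> w (2 ^+ p * t) <= L * w t + B].
  elim: p => [|p [L [B [L1 B0 h]]]].
    by exists 1, 0; split => // t t0; rewrite expr0 !mul1r addr0.
  have L0 : 0 <= L := le_trans ler01 L1.
  exists (L * (`|C| + 1)), (L * w (2 * `|T|) + B); split.
  - by rewrite -[leLHS]mulr1 ler_pM // lerDr.
  - by rewrite addr_ge0 // mulr_ge0 // weight_ge0 // mulr_ge0.
  move=> t t0; rewrite exprSr -mulrA.
  apply: (le_trans (h _ (mulr_ge0 (ler0n _ 2) t0))).
  rewrite addrA lerD2r -mulrA -mulrDr ler_wpM2l //; exact: dbl.
have [p Ap] : exists p, A <= 2 ^+ p.
  exists (Num.truncn `|A|).+1; apply: (le_trans (ler_norm A)).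
  apply: (le_trans (ltW (truncnS_gt _))).
  by rewrite -natrX ler_nat ltnW // ltn_expl.
have [L [B [L1 B0 h]]] := iter p; exists L, B; split => // t t0.
apply: le_trans (h t t0); apply: weight_le; first exact: mulr_ge0.
by rewrite ler_wpM2r.
Qed.

(* The exponential of [wt rho m] is the usual weight sequence [W^rho_m]. *)
Definition wt (rho : R) (m : nat) : R := phi_star w (rho * m%:R) / rho.

(** Dividing inside the supremum, [wt rho m] is the supremum of m t - phi(t) / rho over t >= 0, a
    form in which the dependence on [rho] is transparent. *)
Lemma wt_ub rho m t : 0 < rho -> 0 <= t -> m%:R * t - phi_w w t / rho <= wt rho m.
Proof.
move=> r0 t0; rewrite /wt ler_pdivlMr //.
have -> : (m%:R * t - phi_w w t / rho) * rho = rho * m%:R * t - phi_w w t.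
  by field; rewrite gt_eqF.
exact: phi_star_ub.
Qed.

Lemma wt_lub rho m b : 0 < rho ->
  (forall t, 0 <= t -> m%:R * t - phi_w w t / rho <= b) -> wt rho m <= b.
Proof.
move=> r0 h; rewrite /wt ler_pdivrMr //; apply: phi_star_lub => t t0.
rewrite -ler_pdivrMr //; apply: le_trans (h t t0); apply: eq_leW.
by field; rewrite gt_eqF.
Qed.

Lemma wt0_le0 rho : 0 < rho -> wt rho 0 <= 0.
Proof.
move=> r0; apply: wt_lub => // t t0; rewrite mul0r sub0r oppr_le0.
by rewrite divr_ge0 ?weight_phi_ge0 // ltW.
Qed.

Lemma wt_mono rho rho' m : 0 < rho -> rho <= rho' -> wt rho m <= wt rho' m.
Proof.
move=> r0 rr'; have r'0 := lt_le_trans r0 rr'.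
apply: wt_lub => // t t0; apply: le_trans (wt_ub m r'0 t0).
by rewrite lerB // ler_wpM2l ?weight_phi_ge0 // lef_pV2 ?posrE.
Qed.

Lemma wt_dilate rho i N : concave_on_nonneg w -> 0 < rho -> (0 < i)%N -> (i <= N)%N ->
  wt rho i + i%:R * ln (N%:R / i%:R) <= i%:R / N%:R * wt rho N.
Proof.
move=> cw r0 i0 iN; have i0' : (0 : R) < i%:R by rewrite ltr0n.
have N0' : (0 : R) < N%:R by rewrite ltr0n (leq_trans i0).
have l1 : 1 <= N%:R / i%:R :> R by rewrite ler_pdivlMr // mul1r ler_nat.
have := phi_star_dilate (rho * i%:R) cw l1.
have -> : N%:R / i%:R * (rho * i%:R) = rho * N%:R by field; rewrite gt_eqF.
rewrite -(ler_pM2r (_ : 0 < rho^-1)) ?invr_gt0 // => h.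
rewrite /wt; apply: le_trans (le_trans h _); apply: eq_leW.
  by field; rewrite gt_eqF.
by field; rewrite !gt_eqF.
Qed.

(** The falling factorial (2i)(2i-1)...(i+1) dominates i^i factor by factor and equals the central
    binomial coefficient times i!. *)
Lemma expn_leq_fact i : (i ^ i <= 4 ^ i * i`!)%N.
Proof.
have h1 k : (k <= i)%N -> (i ^ k <= (i + i) ^_ k)%N.
  elim: k => [|k IH] ki; first by rewrite ffactn0.
  rewrite expnSr ffactnSr leq_mul ?IH ?(ltnW ki) // leq_subRL; lia.
apply: (leq_trans (h1 i (leqnn i))); rewrite -bin_ffact leq_mul //.
by apply: (leq_trans (bin_leq_exp2 _ _)); rewrite addnn -mul2n expnM.
Qed.

(** A single ratio serves all i <= N, as the dilation in [bounded_root] demands; the factor 4 comes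
    from i^i <= 4^i i!. *)
Lemma wt_coef rho i N : concave_on_nonneg w -> 0 < rho -> (i <= N)%N ->
  (i`!%:R)^-1 * expR (wt rho i) <= (4 * expR (wt rho N / N%:R) / N%:R) ^+ i.
Proof.
move=> cw r0; case: (posnP i) => [-> _|i0 iN].
  rewrite fact0 invr1 mul1r expr0 -expR0 ler_expR; exact: wt0_le0.
have i0' : (0 : R) < i%:R by rewrite ltr0n.
have N0' : (0 : R) < N%:R by rewrite ltr0n (leq_trans i0).
have f0 : (0 : R) < i`!%:R by rewrite ltr0n fact_gt0.
have := wt_dilate cw r0 i0 iN; rewrite -lerBrDr => h.
have l0 : 0 < N%:R / i%:R :> R by rewrite divr_gt0.
have e1 : expR (i%:R / N%:R * wt rho N - i%:R * ln (N%:R / i%:R)) =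
    expR (wt rho N / N%:R) ^+ i * (i%:R / N%:R) ^+ i.
  have e2 : i%:R / N%:R = expR (- ln (N%:R / i%:R)) :> R by rewrite expRN lnK ?posrE // invf_div.
  rewrite [X in _ = _ * X ^+ i]e2 -exprMn -expRD -expRM_natl.
  by congr expR; field; rewrite !gt_eqF.
have {}h : expR (wt rho i) <= expR (wt rho N / N%:R) ^+ i * (i%:R / N%:R) ^+ i.
  by rewrite -e1 ler_expR.
rewrite ler_pdivrMl //; apply: (le_trans h).
have -> : i`!%:R * (4 * expR (wt rho N / N%:R) / N%:R) ^+ i =
   expR (wt rho N / N%:R) ^+ i * N%:R^-1 ^+ i * (4 ^+ i * i`!%:R).
  by rewrite !exprMn; ring.
have -> : (i%:R / N%:R) ^+ i = N%:R^-1 ^+ i * i%:R ^+ i :> R by rewrite [LHS]exprMn mulrC.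
rewrite [leLHS]mulrA ler_wpM2l ?mulr_ge0 ?exprn_ge0 ?expR_ge0 ?invr_ge0 //.
by rewrite -!natrX -natrM ler_nat expn_leq_fact.
Qed.

(** Shift t by ln A in the supremum and use w(A t) <= L w(t) + B. [L] depends on [A] but not on
    [rho]. *)
Lemma wt_absorb (A : R) : 1 <= A -> exists L B, [/\ 1 <= L, 0 <= B &
  forall rho m, 0 < rho -> m%:R * ln A + wt rho m <= wt (L * rho) m + B / rho].
Proof.
move=> A1; have A0 : 0 < A := lt_le_trans ltr01 A1.
have [L [B [L1 B0 h]]] := weight_dilate (ltW A0).
have L0 : 0 < L := lt_le_trans ltr01 L1.
exists L, (B / L); split => // [|rho m r0]; first by rewrite divr_ge0 // ltW.
rewrite addrC -lerBrDr; apply: wt_lub => // t t0.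
have t'0 : 0 <= t + ln A by rewrite addr_ge0 // ln_ge0.
have := wt_ub m (mulr_gt0 L0 r0) t'0.
rewrite lerBrDr -lerBlDr; apply: le_trans.
rewrite /phi_w expRD lnK ?posrE // [expR t * A]mulrC.
have := h (expR t) (expR_ge0 t).
rewrite -(ler_pM2r (_ : 0 < (L * rho)^-1)) ?invr_gt0 ?mulr_gt0 // => h'.
rewrite lerBrDr; apply: le_trans (lerD (lexx _) h') _; apply: eq_leW.
by field; rewrite !gt_eqF.
Qed.

(** Scaling the supremum by m / N replaces 1 / rho by (m / N) / rho, and N / m = c (m+1) / m <= 2 c
    for m >= 1. The term with [w 1] takes care of m = 0. *)
Lemma wt_compare rho c m : 0 < rho -> (0 < c)%N ->
  m%:R / (c * m.+1)%:R * wt rho (c * m.+1) <=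
  wt (2 * c%:R * rho) m + w 1 / (2 * c%:R * rho).
Proof.
move=> r0 c0; set N := (c * m.+1)%N.
have c0' : (0 : R) < c%:R by rewrite ltr0n.
have N0 : (0 : R) < N%:R by rewrite ltr0n muln_gt0 c0.
have r'0 : 0 < 2 * c%:R * rho by rewrite !mulr_gt0.
case: (posnP m) => [m0|m0].
  rewrite m0 mul0r mul0r; have := wt_ub 0 r'0 (lexx 0).
  by rewrite mul0r sub0r /phi_w expR0 -subr_ge0 opprK.
have m0' : (0 : R) < m%:R by rewrite ltr0n.
rewrite -[leLHS]addr0 lerD ?divr_ge0 ?weight_ge0 ?(ltW r'0) //.
rewrite -ler_pdivlMl ?divr_gt0 //; apply: wt_lub => // t t0.
rewrite ler_pdivlMl ?divr_gt0 //.
apply: le_trans (wt_ub m r'0 t0).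
have -> : m%:R / N%:R * (N%:R * t - phi_w w t / rho) =
  m%:R * t - phi_w w t * (m%:R / N%:R / rho) by field; rewrite !gt_eqF.
rewrite lerB // ler_wpM2l ?weight_phi_ge0 // invfM ler_wpM2r ?invr_ge0 ?(ltW r0) //.
rewrite ler_pdivlMr // ler_pdivrMl ?mulr_gt0 // -!natrM ler_nat /N.
by rewrite mulnC; nia.
Qed.

(** The left side has the shape of the bound in [joris_pds_bound]: D^N from the quotient, m^m from
    the distance of the difference nodes. The latter is absorbed by the 1 / N in the ratio, as (m /
    N)^m <= 1, and what remains is A^m with A = 4 D^(c+1), up to the constant D^c. *)
Lemma wt_final (c D : nat) : (0 < c)%N -> (0 < D)%N -> exists2 L : R, 1 <= L &
  forall rho, 0 < rho -> exists2 K, 0 <= K & forall m,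
    D%:R ^+ (c * m.+1) * (m%:R * (D%:R * (4 * expR (wt rho (c * m.+1) / (c * m.+1)%:R)
      / (c * m.+1)%:R))) ^+ m <= K * expR (wt (L * rho) m).
Proof.
move=> c0 D0; have D1 : 1 <= D%:R :> R by rewrite ler1n.
have D0' : 0 <= D%:R :> R by [].
pose A : R := D%:R ^+ c * (4 * D%:R).
have A1 : 1 <= A.
  rewrite -[1]mulr1 ler_pM ?exprn_ege1 //.
  by rewrite (le_trans D1) // ler_peMl // ler1n.
have A0 : 0 < A := lt_le_trans ltr01 A1.
have [L [B [L1 B0 h]]] := wt_absorb A1.
have c1 : 1 <= 2 * c%:R :> R by rewrite -natrM ler1n muln_gt0 c0.
have c2 : 0 < 2 * c%:R :> R := lt_le_trans ltr01 c1.
exists (L * (2 * c%:R)); first by rewrite -[leLHS]mulr1 ler_pM.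
move=> rho r0; have r'0 : 0 < 2 * c%:R * rho by rewrite mulr_gt0.
exists (D%:R ^+ c * expR (B / (2 * c%:R * rho) + w 1 / (2 * c%:R * rho))).
  by rewrite mulr_ge0 ?exprn_ge0 ?expR_ge0.
move=> m; set N := (c * m.+1)%N.
have N0 : (0 : R) < N%:R by rewrite ltr0n muln_gt0 c0.
have mN : m%:R / N%:R <= 1 :> R.
  by rewrite ler_pdivrMr // mul1r ler_nat /N (leq_trans (leqnSn m)) // leq_pmull.
have -> : m%:R * (D%:R * (4 * expR (wt rho N / N%:R) / N%:R)) =
    (4 * D%:R) * expR (wt rho N / N%:R) * (m%:R / N%:R) by ring.
rewrite exprMn exprMn -expRM_natl.
have -> : D%:R ^+ N = D%:R ^+ c * (D%:R ^+ c) ^+ m :> R by rewrite -exprM -exprD /N mulnS.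
rewrite -[D%:R ^+ c * _ * _]mulrA -[D%:R ^+ c * expR _ * _]mulrA ler_wpM2l ?exprn_ge0 //.
have -> : (D%:R ^+ c) ^+ m * ((4 * D%:R) ^+ m * expR (m%:R * (wt rho N / N%:R)) * (m%:R / N%:R) ^+ m) =
   (A ^+ m * expR (m%:R / N%:R * wt rho N)) * (m%:R / N%:R) ^+ m.
  have -> : m%:R / N%:R * wt rho N = m%:R * (wt rho N / N%:R) by ring.
  by rewrite [A ^+ m]exprMn; ring.
apply: (@le_trans _ _ (A ^+ m * expR (m%:R / N%:R * wt rho N))).
  rewrite ler_piMr ?mulr_ge0 ?expR_ge0 ?exprn_ge0 ?(ltW A0) //.
  by rewrite exprn_ile1 // divr_ge0.
rewrite -{1}[A]lnK ?posrE // -expRM_natl -!expRD ler_expR.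
have h1 := h _ m r'0; have h2 := wt_compare m r0 c0.
rewrite mulrA in h1; apply: (le_trans (lerD (lexx _) h2)); rewrite addrA.
apply: (le_trans (lerD h1 (lexx _))); apply: eq_leW; ring.
Qed.

End Weights.

(** * Ultradifferentiable estimates *)

Section ComplexPolynomials.
Local Open Scope complex_scope.
Variable R : realType.
Local Notation C := R[i].

Lemma complex_norm_le (z : C) : `|z| <= (`|complex.Re z| + `|complex.Im z|)%:C.
Proof.
rewrite {1}(complexE z) (le_trans (ler_normD _ _)) // normrM.
rewrite rmorphD /= lerD //.
  by rewrite normc_def /= expr0n addr0 sqrtr_sqr.
by rewrite !normc_def /= !expr0n /= add0r expr1n sqrtr1 addr0 sqrtr_sqr mul1r.
Qed.

Lemma norm_Re_le (z : C) (a : R) : `|z| <= a%:C -> `|complex.Re z| <= a.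
Proof.
rewrite normc_def lecR; apply: le_trans.
by rewrite -sqrtr_sqr ler_wsqrtr // lerDl sqr_ge0.
Qed.

Lemma norm_Im_le (z : C) (a : R) : `|z| <= a%:C -> `|complex.Im z| <= a.
Proof.
rewrite normc_def lecR; apply: le_trans.
by rewrite -sqrtr_sqr ler_wsqrtr // lerDr sqr_ge0.
Qed.

Lemma ReD (x y : C) : complex.Re (x + y) = complex.Re x + complex.Re y.
Proof. by case: x => a b; case: y. Qed.

Lemma ImD (x y : C) : complex.Im (x + y) = complex.Im x + complex.Im y.
Proof. by case: x => a b; case: y. Qed.

Lemma Re_mulr_real (x : C) (a : R) : complex.Re (x * a%:C) = complex.Re x * a.
Proof. by case: x => b c /=; rewrite mulr0 subr0. Qed.

Lemma Im_mulr_real (x : C) (a : R) : complex.Im (x * a%:C) = complex.Im x * a.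
Proof. by case: x => b c /=; rewrite mulr0 add0r mulrC. Qed.

Definition re_poly (F : {poly C}) : {poly R} := \poly_(i < size F) complex.Re F`_i.
Definition im_poly (F : {poly C}) : {poly R} := \poly_(i < size F) complex.Im F`_i.

Lemma coef_re_poly F i : (re_poly F)`_i = complex.Re F`_i.
Proof. by rewrite coef_poly; case: ltnP => // h; rewrite nth_default. Qed.

Lemma coef_im_poly F i : (im_poly F)`_i = complex.Im F`_i.
Proof. by rewrite coef_poly; case: ltnP => // h; rewrite nth_default. Qed.

Lemma horner_re_poly F (t : R) : (re_poly F).[t] = complex.Re F.[t%:C].
Proof.
rewrite horner_poly horner_coef (big_morph _ ReD (erefl : complex.Re (0 : C) = 0)).
by apply: eq_bigr => i _; rewrite -rmorphXn Re_mulr_real.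
Qed.

Lemma horner_im_poly F (t : R) : (im_poly F).[t] = complex.Im F.[t%:C].
Proof.
rewrite horner_poly horner_coef (big_morph _ ImD (erefl : complex.Im (0 : C) = 0)).
by apply: eq_bigr => i _; rewrite -rmorphXn Im_mulr_real.
Qed.

Definition cpoly (p q : {poly R}) : {poly C} :=
  map_poly (real_complex R) p + 'i *: map_poly (real_complex R) q.

Lemma coef_cpoly p q i : (cpoly p q)`_i = (p`_i)%:C + 'i * (q`_i)%:C.
Proof. by rewrite coefD coefZ !coef_map. Qed.

Lemma norm_coef_cpoly p q i : `|(cpoly p q)`_i| <= (`|p`_i| + `|q`_i|)%:C.
Proof.
rewrite coef_cpoly (le_trans (complex_norm_le _)) // lecR.
by rewrite /= !(mul0r, mul1r, mulr0, add0r, addr0, subr0, oppr0).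
Qed.

Lemma size_cpoly (p q : {poly R}) n : (size p <= n)%N -> (size q <= n)%N -> (size (cpoly p q) <= n)%N.
Proof.
move=> sp sq; rewrite (leq_trans (size_polyD _ _)) // geq_max.
rewrite size_map_poly sp (leq_trans (size_scale_leq _ _)) // size_map_poly //.
Qed.

Lemma cpoly_approx (p q : {poly R}) (z : C) (t a b : R) : `|complex.Re z - p.[t]| <= a ->
  `|complex.Im z - q.[t]| <= b -> `|z - (cpoly p q).[t%:C]| <= (a + b)%:C.
Proof.
move=> ha hb; apply: (le_trans (complex_norm_le _)); rewrite lecR.
rewrite /cpoly hornerD hornerZ !horner_map; case: z ha hb => x y /= ha hb.
by rewrite !(mul0r, mul1r, mulr0, add0r, addr0, subr0, oppr0) lerD.
Qed.

End ComplexPolynomials.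

(** * The expansion of f along a single line *)

Section LocalJoris.
Local Open Scope complex_scope.
Variables (R : realType) (d : nat).
Local Notation C := R[i].
Implicit Types (f F : 'rV[R]_d -> C) (x v : 'rV[R]_d).

Definition line_taylor F N x v (e C0 A rho : R) : Prop :=
  [/\ forall i, `|(taylor_poly (ReF F) N x v)`_i| <= A * rho ^+ i,
      forall i, `|(taylor_poly (ImF F) N x v)`_i| <= A * rho ^+ i,
      forall t : R, `|t| < e ->
        `|ReF F (x + t *: v) - (taylor_poly (ReF F) N x v).[t]| <= C0 * `|t| ^+ N &
      forall t : R, `|t| < e ->
        `|ImF F (x + t *: v) - (taylor_poly (ImF F) N x v).[t]| <= C0 * `|t| ^+ N].

Lemma joris_line j k N (C0 A rho : R) : (0 < j)%N -> (0 < k)%N ->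
  N = (j * (j.+1 * (j.+1 * k)))%N -> 0 <= C0 -> 0 <= A -> 0 < rho ->
  exists2 C1, 0 <= C1 & forall f x v (e : R), 0 < e -> e <= 1 ->
  line_taylor (fun y => f y ^+ j) N x v e C0 A rho ->
  line_taylor (fun y => f y ^+ j.+1) N x v e C0 A rho ->
  exists p q : {poly R}, [/\ (size p <= j.+1 * k)%N /\ (size q <= j.+1 * k)%N,
    forall i, `|p`_i| <= (1 + 2 * A) * joris_const%:R ^+ N * rho ^+ i,
    forall i, `|q`_i| <= (1 + 2 * A) * joris_const%:R ^+ N * rho ^+ i,
    forall t : R, `|t| < e -> `|ReF f (x + t *: v) - p.[t]| <= C1 * `|t| ^+ k &
    forall t : R, `|t| < e -> `|ImF f (x + t *: v) - q.[t]| <= C1 * `|t| ^+ k].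
Proof.
move=> j0 k0 eN C00 A0 rho0; pose lam : R := 1 + 2 * A.
have lam1 : 1 <= lam by rewrite lerDl mulr_ge0.
have lam0 : 0 < lam := lt_le_trans ltr01 lam1.
(* The same [lam] must serve the exponents j and j+1; being at least 1 and at least 2 A is
   enough. *)
have lamA m : (0 < m)%N -> A + A <= lam ^+ m.
  move=> m0; apply: (@le_trans _ _ lam); first by rewrite /lam; lra.
  by rewrite ler_eXnr.
have h0 : (0 : C) <= (C0 + C0)%:C by rewrite ler0c addr_ge0.
have h1 : (0 : C) < lam%:C by rewrite ltcR.
have h2 : (0 : C) < rho%:C by rewrite ltcR.
have [C1 C10 H] := joris_taylor j0 k0 eN h0 h1 h2.
have C1r : C1 = (complex.Re C1)%:C by rewrite RRe_real // ger0_real.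
exists (complex.Re C1); first by rewrite -lecR -C1r.
move=> f x v e e0 e1 [gR gI gRa gIa] [hR hI hRa hIa].
pose T m := cpoly (taylor_poly (ReF (fun y => f y ^+ m)) N x v)
                  (taylor_poly (ImF (fun y => f y ^+ m)) N x v).
have sT m : (size (T m) <= N)%N by apply: size_cpoly; exact: size_poly.
have bT m : (0 < m)%N ->
    (forall i, `|(taylor_poly (ReF (fun y => f y ^+ m)) N x v)`_i| <= A * rho ^+ i) ->
    (forall i, `|(taylor_poly (ImF (fun y => f y ^+ m)) N x v)`_i| <= A * rho ^+ i) ->
    forall i, `|(T m)`_i| <= lam%:C ^+ m * rho%:C ^+ i.
  move=> m0 a b i; apply: (le_trans (norm_coef_cpoly _ _ _)).
  rewrite -!rmorphXn -rmorphM lecR; apply: (le_trans (lerD (a i) (b i))).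
  by rewrite -mulrDl ler_wpM2r ?exprn_ge0 ?lamA // ltW.
have aT m : (forall t : R, `|t| < e -> `|ReF (fun y => f y ^+ m) (x + t *: v) -
      (taylor_poly (ReF (fun y => f y ^+ m)) N x v).[t]| <= C0 * `|t| ^+ N) ->
    (forall t : R, `|t| < e -> `|ImF (fun y => f y ^+ m) (x + t *: v) -
      (taylor_poly (ImF (fun y => f y ^+ m)) N x v).[t]| <= C0 * `|t| ^+ N) ->
    forall z : C, z \is Num.real -> `|z| < e%:C ->
      `|(f (x + complex.Re z *: v)) ^+ m - (T m).[z]| <= (C0 + C0)%:C * `|z| ^+ N.
  move=> a b z /complex_realP[t ->] /=.
  rewrite normc_def /= expr0n addr0 sqrtr_sqr ltcR => te.
  apply: (le_trans (cpoly_approx (a t te) (b t te))).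
  by rewrite -mulrDl rmorphM rmorphXn.
have e0' : (0 : C) < e%:C by rewrite ltcR.
have e1' : e%:C <= (1 : C) by rewrite (lecR e 1).
have [F [sF bF aF]] := H (fun z => f (x + complex.Re z *: v)) (T j) (T j.+1) e%:C
  e0' e1' (sT j) (sT j.+1) (bT j j0 gR gI) (bT j.+1 isT hR hI) (aT j gRa gIa) (aT j.+1 hRa hIa).
have bF' i : `|F`_i| <= (lam * joris_const%:R ^+ N * rho ^+ i)%:C.
  apply: (le_trans (bF i)); apply: eq_leW.
  by rewrite !rmorphM !rmorphXn /= rmorph_nat.
have aF' (t : R) : `|t| < e -> `|f (x + t *: v) - F.[t%:C]| <= (complex.Re C1 * `|t| ^+ k)%:C.
  move=> te; have tn : `|t%:C| = `|t|%:C by rewrite normc_def /= expr0n addr0 sqrtr_sqr.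
  have := aF t%:C; rewrite tn ltcR => /(_ _ te) /= h.
  apply: (le_trans (h _)); first by apply/complex_realP; exists t.
  by apply: eq_leW; rewrite {1}C1r rmorphM rmorphXn.
exists (re_poly F), (im_poly F); split.
- by split; apply: leq_trans (size_poly _ _) _.
- by move=> i; rewrite coef_re_poly; exact: norm_Re_le.
- by move=> i; rewrite coef_im_poly; exact: norm_Im_le.
- move=> t te; rewrite horner_re_poly; have := norm_Re_le (aF' t te).
  by rewrite ReD; congr (_ <= _); congr (`|_ + _|); case: F.[_].
- move=> t te; rewrite horner_im_poly; have := norm_Im_le (aF' t te).
  by rewrite ImD; congr (_ <= _); congr (`|_ + _|); case: F.[_].
Qed.

End LocalJoris.

Section SmoothJoris.
Variables (R : realType) (d : nat).
Implicit Types (f F : 'rV[R]_d -> R[i]) (x v : 'rV[R]_d) (U V : set 'rV[R]_d).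

Lemma line_taylor_local U F x0 N : open U -> smooth_on U F -> U x0 ->
  exists2 r, 0 < r & exists2 C0, 0 <= C0 & forall x v (A rho e C1 : R),
    `|x - x0| < r -> `|v| <= 1 -> e <= r -> C0 <= C1 ->
    (forall i, `|(taylor_poly (ReF F) N x v)`_i| <= A * rho ^+ i) ->
    (forall i, `|(taylor_poly (ImF F) N x v)`_i| <= A * rho ^+ i) ->
    line_taylor F N x v e C1 A rho.
Proof.
move=> oU [sR sI] Ux0.
have [r1 r10 [C1 C10 h1]] := smooth_taylor N oU sR Ux0.
have [r2 r20 [C2 C20 h2]] := smooth_taylor N oU sI Ux0.
exists (Num.min r1 r2); first by rewrite lt_min r10.
exists (C1 + C2); first exact: addr_ge0.
move=> x v A rho e C3; rewrite lt_min le_min => /andP[xr1 xr2] v1 /andP[er1 er2] C3ge bR bI.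
split => // t te.
  apply: (le_trans (h1 x v t xr1 v1 (lt_le_trans te er1))).
  by rewrite ler_wpM2r ?exprn_ge0 // (le_trans _ C3ge) // lerDl.
apply: (le_trans (h2 x v t xr2 v1 (lt_le_trans te er2))).
by rewrite ler_wpM2r ?exprn_ge0 // (le_trans _ C3ge) // lerDr.
Qed.

(** The root polynomial has (j+1) k coefficients but approximates only to order k; cutting it at k
    restores the size required by [unif_taylor] and changes only the constant. *)
Lemma truncate_expansion (u : 'rV[R]_d -> R) x v (p : {poly R}) k n (C1 A e : R) :
  e <= 1 -> 0 <= A -> (size p <= n)%N -> (forall i, `|p`_i| <= A * 1 ^+ i) ->
  (forall t : R, `|t| < e -> `|u (x + t *: v) - p.[t]| <= C1 * `|t| ^+ k) ->
  forall t : R, `|t| < e ->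
   `|u (x + t *: v) - (take_poly k p).[t]| <= (C1 + n%:R * (A * (1 + 1) ^+ n)) * `|t| ^+ k.
Proof.
move=> e1 A0 sp bp h t te.
have t1 : `|t| <= 1 by rewrite (le_trans (ltW te)).
have -> : u (x + t *: v) - (take_poly k p).[t] =
    (u (x + t *: v) - p.[t]) + (drop_poly k p * 'X^k).[t].
  by rewrite -{2}(poly_take_drop k p) hornerD; ring.
rewrite (le_trans (ler_normD _ _)) // mulrDl lerD ?h //.
rewrite hornerM hornerXn normrM normrX ler_wpM2r ?exprn_ge0 //.
apply: (le_trans (horner_le_nrmp1 _ t1)); apply: (le_trans _ (nrmp1_geom sp ler01 A0 bp)).
have sd : (size (drop_poly k p) <= n)%N.
  by rewrite size_drop_poly (leq_trans (leq_subr _ _)).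
rewrite (nrmp_wide _ sd).
rewrite (@nrmp_wide _ (k + n)); last by rewrite (leq_trans sp) ?leq_addl.
rewrite big_split_ord /= -[leLHS]add0r lerD //.
  by apply: sumr_ge0 => i _; rewrite mulr_ge0 // exprn_ge0.
by apply: ler_sum => i _; rewrite !expr1n coef_drop_poly addnC.
Qed.

Lemma joris_unif_taylor U f j : (0 < j)%N -> open U ->
  smooth_on U (fun y => f y ^+ j) -> smooth_on U (fun y => f y ^+ j.+1) ->
  unif_taylor U (ReF f) /\ unif_taylor U (ImF f).
Proof.
move=> j0 oU sg sh.
suff H x0 : U x0 -> forall k, exists2 r, 0 < r & exists2 C, 0 <= C &
    forall x v, `|x - x0| < r -> `|v| <= 1 -> exists p q : {poly R},
    [/\ (size p <= k.+1)%N, (size q <= k.+1)%N,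
     forall t : R, `|t| < r -> `|ReF f (x + t *: v) - p.[t]| <= C * `|t| ^+ k.+1 &
     forall t : R, `|t| < r -> `|ImF f (x + t *: v) - q.[t]| <= C * `|t| ^+ k.+1].
  by split => x0 Ux0 k; have [r r0 [C C0 h]] := H x0 Ux0 k; exists r => //; exists C => // x v xr v1;
    have [p [q [sp sq hp hq]]] := h x v xr v1; [exists p | exists q].
move=> Ux0 k; pose N := (j * (j.+1 * (j.+1 * k.+1)))%N.
have [r1 r10 [C1 C10 h1]] := line_taylor_local N oU sg Ux0.
have [r2 r20 [C2 C20 h2]] := line_taylor_local N oU sh Ux0.
have [ra ra0 [Ba Ba0 ha]] := local_bound N sg.1 Ux0.
have [rb rb0 [Bb Bb0 hb]] := local_bound N sg.2 Ux0.
have [rc rc0 [Bc Bc0 hc]] := local_bound N sh.1 Ux0.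
have [rd rd0 [Bd Bd0 hd]] := local_bound N sh.2 Ux0.
pose B := Ba + Bb + Bc + Bd.
have B0 : 0 <= B by rewrite !addr_ge0.
pose A := B * (1 + d%:R) ^+ N.
have A0 : 0 <= A by rewrite mulr_ge0 // exprn_ge0 // addr_ge0.
have [C3 C30 h3] := joris_line d j0 (ltn0Sn k) (erefl N) (addr_ge0 C10 C20) A0 ltr01.
pose r := Num.min (Num.min (Num.min r1 r2) (Num.min ra rb)) (Num.min (Num.min rc rd) 1).
have r0 : 0 < r by rewrite !lt_min r10 r20 ra0 rb0 rc0 rd0 ltr01.
pose n := (j.+1 * k.+1)%N; pose M := (1 + 2 * A) * joris_const%:R ^+ N.
have M0 : 0 <= M.
  apply: mulr_ge0; first by rewrite addr_ge0 // mulr_ge0.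
  by apply: exprn_ge0; exact: ler0n.
exists r => //; exists (C3 + n%:R * (M * (1 + 1) ^+ n)).
  by rewrite addr_ge0 // mulr_ge0 // mulr_ge0 // exprn_ge0 // addr_ge0.
move=> x v; rewrite !lt_min.
move=> /andP[/andP[/andP[x1 x2] /andP[xa xb]] /andP[/andP[xc xd] _]] v1.
have bound (u : 'rV[R]_d -> R) b : 0 <= b -> b <= B ->
    (forall s, (size s <= N)%N -> `|pds s u x| <= b) ->
    forall i, `|(taylor_poly u N x v)`_i| <= A * 1 ^+ i.
  move=> b0 bB h i; rewrite expr1n mulr1; apply: (@le_trans _ _ (b * (1 + d%:R) ^+ N)).
    by apply: taylor_poly_coef_bound => // s sN; apply: h; exact: ltnW.
  by rewrite ler_wpM2r // exprn_ge0 // addr_ge0.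
have r_1 : r <= r1 by rewrite /r !ge_min lexx.
have r_2 : r <= r2 by rewrite /r !ge_min lexx !orbT.
have r_3 : r <= 1 by rewrite /r !ge_min lexx !orbT.
have lg := h1 x v A 1 r (C1 + C2) x1 v1 r_1 (ler_wpDr C20 (lexx _))
  (bound _ Ba Ba0 ltac:(rewrite /B; lra) (fun s => ha x s xa))
  (bound _ Bb Bb0 ltac:(rewrite /B; lra) (fun s => hb x s xb)).
have lh := h2 x v A 1 r (C1 + C2) x2 v1 r_2 (ler_wpDl C10 (lexx _))
  (bound _ Bc Bc0 ltac:(rewrite /B; lra) (fun s => hc x s xc))
  (bound _ Bd Bd0 ltac:(rewrite /B; lra) (fun s => hd x s xd)).
have [p [q [[sp sq] bp bq hp hq]]] := h3 f x v r r0 r_3 lg lh.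
exists (take_poly k.+1 p), (take_poly k.+1 q); split; try exact: size_take_poly.
  exact: (truncate_expansion r_3 M0 sp bp hp).
exact: (truncate_expansion r_3 M0 sq bq hq).
Qed.

Lemma joris_smooth U f j : (0 < j)%N -> open U ->
  smooth_on U (fun y => f y ^+ j) -> smooth_on U (fun y => f y ^+ j.+1) -> smooth_on U f.
Proof.
move=> j0 oU sg sh; have [tR tI] := joris_unif_taylor j0 oU sg sh.
by split; exact: unif_taylor_smooth.
Qed.

Lemma joris_pds_bound U f j m N x (A rho : R) : (0 < j)%N -> open U ->
  smooth_on U (fun y => f y ^+ j) -> smooth_on U (fun y => f y ^+ j.+1) ->
  N = (j * (j.+1 * (j.+1 * m.+1)))%N -> U x -> 0 <= A -> 0 < rho ->
  (forall v, `|v| <= 1 -> forall i,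
    [/\ `|(taylor_poly (ReF (fun y => f y ^+ j)) N x v)`_i| <= A * rho ^+ i,
        `|(taylor_poly (ImF (fun y => f y ^+ j)) N x v)`_i| <= A * rho ^+ i,
        `|(taylor_poly (ReF (fun y => f y ^+ j.+1)) N x v)`_i| <= A * rho ^+ i &
        `|(taylor_poly (ImF (fun y => f y ^+ j.+1)) N x v)`_i| <= A * rho ^+ i]) ->
  forall s, size s = m ->
   `|pds s (ReF f) x| <= 2 ^+ m * (m%:R ^+ m * ((1 + 2 * A) * joris_const%:R ^+ N * rho ^+ m)) /\
   `|pds s (ImF f) x| <= 2 ^+ m * (m%:R ^+ m * ((1 + 2 * A) * joris_const%:R ^+ N * rho ^+ m)).
Proof.
move=> j0 oU sg sh eN Ux A0 rho0 bT s sm.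
have [sfR sfI] := joris_smooth j0 oU sg sh.
have [r1 r10 [C1 C10 h1]] := line_taylor_local N oU sg Ux.
have [r2 r20 [C2 C20 h2]] := line_taylor_local N oU sh Ux.
have [C3 C30 h3] := joris_line d j0 (ltn0Sn m) eN (addr_ge0 C10 C20) A0 rho0.
pose K : R := (1 + 2 * A) * joris_const%:R ^+ N * rho ^+ m.
have K0 : 0 <= K.
  apply: mulr_ge0; last by rewrite exprn_ge0 // ltW.
  apply: mulr_ge0; first by rewrite addr_ge0 // mulr_ge0.
  by apply: exprn_ge0; exact: ler0n.
pose r := Num.min (Num.min r1 r2) 1.
have r0 : 0 < r by rewrite !lt_min r10 r20 ltr01.
have r_1 : r <= r1 by rewrite /r !ge_min lexx.
have r_2 : r <= r2 by rewrite /r !ge_min lexx !orbT.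
have r_3 : r <= 1 by rewrite /r !ge_min lexx !orbT.
have ex v : `|v| <= 1 -> exists p q : {poly R}, [/\ `|p`_m| <= K, `|q`_m| <= K,
    forall t : R, `|t| < r -> `|ReF f (x + t *: v) - p.[t]| <= C3 * `|t| ^+ m.+1 &
    forall t : R, `|t| < r -> `|ImF f (x + t *: v) - q.[t]| <= C3 * `|t| ^+ m.+1].
  move=> v1; have xx z : 0 < z -> `|x - x| < z by rewrite subrr normr0.
  have lg := h1 x v A rho r (C1 + C2) (xx _ r10) v1 r_1 (ler_wpDr C20 (lexx _))
    (fun i => let: And4 a _ _ _ := bT v v1 i in a) (fun i => let: And4 _ a _ _ := bT v v1 i in a).
  have lh := h2 x v A rho r (C1 + C2) (xx _ r20) v1 r_2 (ler_wpDl C10 (lexx _))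
    (fun i => let: And4 _ _ a _ := bT v v1 i in a) (fun i => let: And4 _ _ _ a := bT v v1 i in a).
  have [p [q [_ bp bq hp hq]]] := h3 f x v r r0 r_3 lg lh.
  by exists p, q; split.
(* The nodes of the difference have norm up to m, whereas the Taylor bounds concern the unit ball;
   rescaling costs m^m on the coefficient of t^m. *)
have scale v : `|v| <= m%:R -> exists2 v', `|v'| <= 1 & v = m%:R *: v'.
  move=> vm; case: (posnP m) => [m0|mpos].
    exists 0; first by rewrite normr0.
    by move: vm; rewrite m0 normr_le0 scaler0 => /eqP.
  have m0 : (0 : R) < m%:R by rewrite ltr0n.
  exists (m%:R^-1 *: v); first by rewrite normrZ normfV normr_nat ler_pdivrMl // mulr1.
  by rewrite scalerA mulfV ?gt_eqF // scale1r.
have m1 : (0 : R) < m.+1%:R by rewrite ltr0n.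
have expand (u : 'rV[R]_d -> R) (p : {poly R}) v' : `|p`_m| <= K ->
    (forall t : R, `|t| < r -> `|u (x + t *: v') - p.[t]| <= C3 * `|t| ^+ m.+1) ->
    exists p : {poly R}, `|p`_m| <= m%:R ^+ m * K /\
     exists2 r, 0 < r & exists2 C, 0 <= C & forall t : R, `|t| < r ->
       `|u (x + t *: (m%:R *: v')) - p.[t]| <= C * `|t| ^+ m.+1.
  move=> pK hp; exists (p \Po (m%:R *: 'X)); split.
    by rewrite coef_dilate normrM normrX normr_nat ler_wpM2l // exprn_ge0.
  exists (r / m.+1%:R); first by rewrite divr_gt0.
  exists (C3 * m%:R ^+ m.+1); first by rewrite mulr_ge0 // exprn_ge0.
  move=> t; rewrite ltr_pdivlMr // => tr.
  rewrite horner_dilate scalerA [t * _]mulrC -mulrA -exprMn -[m%:R in X in _ <= X]normr_nat -normrM.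
  apply: hp; rewrite normrM normr_nat mulrC; apply: le_lt_trans tr.
  by rewrite ler_wpM2l // ler_nat.
have mK0 : 0 <= m%:R ^+ m * K by rewrite mulr_ge0 // exprn_ge0.
rewrite -/K -sm; split; apply: (pds_expansion_bound oU _ Ux) => //; rewrite ?sm // => v vm.
  have [v' v'1 ->] := scale v vm; have [p [q [pK qK hp hq]]] := ex v' v'1.
  exact: expand pK hp.
have [v' v'1 ->] := scale v vm; have [p [q [pK qK hp hq]]] := ex v' v'1.
exact: expand qK hq.
Qed.

End SmoothJoris.

(** * Weighted derivative estimates *)

Section UltraJoris.
Variables (R : realType) (w : R -> R) (d : nat).
Hypothesis ww : weight_function w.
Implicit Types (f F : 'rV[R]_d -> R[i]) (x v : 'rV[R]_d) (U V : set 'rV[R]_d).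

Definition palpha_seq (alpha : 'I_d -> nat) : seq 'I_d :=
  flatten [seq nseq (alpha i) i | i <- enum 'I_d].

Lemma size_palpha_seq alpha : size (palpha_seq alpha) = length_mi alpha.
Proof.
rewrite /palpha_seq size_flatten /shape -map_comp sumnE big_map big_enum /=.
by apply: eq_bigr => i _; rewrite size_nseq.
Qed.

(** [B_w] only sees derivatives taken in a fixed order of the variables; this and [pds_perm]
    transfer its bound to every word. *)
Lemma perm_palpha_seq (s : seq 'I_d) : perm_eq (palpha_seq (fun i => count_mem i s)) s.
Proof.
apply/allP => k _ /=; apply/eqP.
rewrite /palpha_seq count_flatten -map_comp sumnE big_map big_enum /= (bigD1 k) //=.
rewrite count_nseq /= eqxx mul1n big1 ?addn0 // => i ik.
by rewrite count_nseq /= (negbTE ik).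
Qed.

Lemma B_w_mono rho rho' V F : 0 < rho -> rho <= rho' -> B_w w rho V F -> B_w w rho' V F.
Proof.
move=> r0 rr' [sF [C h]]; split => //; exists C => x alpha Vx.
apply: le_trans (h x alpha Vx); rewrite ler_wpM2l ?sqrtr_ge0 // ler_expR lerN2.
exact: wt_mono.
Qed.

Lemma B_w_pds rho V F : open V -> B_w w rho V F -> exists2 C, 0 <= C & forall x s, V x ->
  `|pds s (ReF F) x| <= C * expR (wt w rho (size s)) /\
  `|pds s (ImF F) x| <= C * expR (wt w rho (size s)).
Proof.
move=> oV [[sR sI] [C h]]; exists (Num.max C 0); first by rewrite le_max lexx orbT.
move=> x s Vx; pose alpha i := count_mem i s.
have ps := perm_palpha_seq s.
have lens : length_mi alpha = size s by rewrite -size_palpha_seq (perm_size ps).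
have := h x alpha Vx; rewrite lens -/(wt w rho (size s)) expRN ler_pdivrMr ?expR_gt0 // => hb.
have {}hb : abs_palpha alpha F x <= Num.max C 0 * expR (wt w rho (size s)).
  by apply: (le_trans hb); rewrite ler_wpM2r ?expR_ge0 // le_max lexx.
rewrite -(pds_perm oV sR Vx ps) -(pds_perm oV sI Vx ps).
split; apply: le_trans hb; rewrite /abs_palpha -sqrtr_sqr ler_wsqrtr //.
  by rewrite lerDl sqr_ge0.
by rewrite lerDr sqr_ge0.
Qed.

Lemma pds_B_w rho V F C : smooth_on V F -> (forall x s, V x ->
    `|pds s (ReF F) x| <= C * expR (wt w rho (size s)) /\
    `|pds s (ImF F) x| <= C * expR (wt w rho (size s))) -> B_w w rho V F.
Proof.
move=> sF h; split => //; exists (C + C) => x alpha Vx.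
have [hR hI] := h x (palpha_seq alpha) Vx; rewrite size_palpha_seq in hR hI.
rewrite -/(wt w rho (length_mi alpha)) expRN ler_pdivrMr ?expR_gt0 // mulrDl.
apply: le_trans (lerD hR hI); rewrite /abs_palpha -/(palpha_seq alpha).
set a := pds _ _ _; set b := pds _ _ _.
have s0 : 0 <= `|a| + `|b| by rewrite addr_ge0.
rewrite -[leRHS]ger0_norm // -sqrtr_sqr ler_wsqrtr // sqrrD !real_normK ?num_real //.
by rewrite lerD2r lerDl mulrn_wge0 // mulr_ge0.
Qed.

Lemma taylor_poly_weight_bound rho u N x v C i : concave_on_nonneg w -> 0 < rho ->
  `|v| <= 1 -> 0 <= C -> (forall s, `|pds s u x| <= C * expR (wt w rho (size s))) ->
  `|(taylor_poly u N x v)`_i| <=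
    C * (d%:R * (4 * expR (wt w rho N / N%:R) / N%:R)) ^+ i.
Proof.
move=> cw r0 v1 C0 h.
have W0 : 0 <= 4 * expR (wt w rho N / N%:R) / N%:R.
  by rewrite divr_ge0 // mulr_ge0 // expR_ge0.
rewrite coef_poly; case: ifP => iN; last by rewrite normr0 mulr_ge0 // exprn_ge0 // mulr_ge0.
rewrite normrM normfV normr_nat exprMn.
apply: (@le_trans _ _ ((i`!%:R)^-1 * (d%:R ^+ i * (C * expR (wt w rho i))))).
  rewrite ler_wpM2l ?invr_ge0 //; apply: dird_bound => // s' ss.
  by have := h s'; rewrite ss addn0.
have -> : (i`!%:R)^-1 * (d%:R ^+ i * (C * expR (wt w rho i))) =
  C * d%:R ^+ i * ((i`!%:R)^-1 * expR (wt w rho i)) by ring.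
rewrite [leRHS]mulrA ler_wpM2l ?mulr_ge0 ?exprn_ge0 //.
by apply: wt_coef => //; exact: ltnW.
Qed.

(** [L] is chosen before [rho], [V] and [f]: this is what lets the same estimate work for some large
    [rho] and for all small ones. *)
Lemma joris_B_w j : (0 < j)%N -> (0 < d)%N -> concave_on_nonneg w ->
  exists2 L, 1 <= L & forall rho V f, 0 < rho -> open V ->
    B_w w rho V (fun x => f x ^+ j) -> B_w w rho V (fun x => f x ^+ j.+1) ->
    B_w w (L * rho) V f.
Proof.
move=> j0 d0 cw; pose c := (j * (j.+1 * j.+1))%N.
have c0 : (0 < c)%N by rewrite muln_gt0 j0.
(* One base dominates both exponential losses: the quotient constant, and 2 d from the difference
   nodes and the directional derivatives. *)
have [D [D0 D1 D2]] : exists D, [/\ (0 < D)%N, (joris_const <= D)%N & (2 * d <= D)%N].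
  have d2 : (0 < 2 * d)%N by rewrite muln_gt0.
  exists (joris_const * (2 * d))%N; split; first by rewrite muln_gt0 d2 joris_const_gt0.
    by rewrite leq_pmulr.
  by rewrite leq_pmull ?joris_const_gt0.
have [L L1 hL] := wt_final ww c0 D0.
exists L => // rho V f r0 oV Bg Bh; have [K K0 hK] := hL rho r0.
have [Cg Cg0 hg] := B_w_pds oV Bg; have [Ch Ch0 hh] := B_w_pds oV Bh.
pose A := Cg + Ch; have A0 : 0 <= A by rewrite addr_ge0.
have [sg _] := Bg; have [sh _] := Bh.
apply: (@pds_B_w _ _ _ ((1 + 2 * A) * K)); first exact: joris_smooth j0 oV sg sh.
move=> x s Vx; set m := size s.
pose N := (c * m.+1)%N.
have eN : N = (j * (j.+1 * (j.+1 * m.+1)))%N by rewrite /N /c; ring.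
pose W : R := 4 * expR (wt w rho N / N%:R) / N%:R.
have N0 : (0 : R) < N%:R by rewrite ltr0n muln_gt0 c0.
have W0 : 0 < W by rewrite divr_gt0 // mulr_gt0 // expR_gt0.
have dW0 : 0 < d%:R * W by rewrite mulr_gt0 // ltr0n.
have bT v : `|v| <= 1 -> forall i,
    [/\ `|(taylor_poly (ReF (fun y => f y ^+ j)) N x v)`_i| <= A * (d%:R * W) ^+ i,
        `|(taylor_poly (ImF (fun y => f y ^+ j)) N x v)`_i| <= A * (d%:R * W) ^+ i,
        `|(taylor_poly (ReF (fun y => f y ^+ j.+1)) N x v)`_i| <= A * (d%:R * W) ^+ i &
        `|(taylor_poly (ImF (fun y => f y ^+ j.+1)) N x v)`_i| <= A * (d%:R * W) ^+ i].
  move=> v1 i; have inA u C : 0 <= C -> C <= A ->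
      (forall s, `|pds s u x| <= C * expR (wt w rho (size s))) ->
      `|(taylor_poly u N x v)`_i| <= A * (d%:R * W) ^+ i.
    move=> C0 CA h; apply: (le_trans (taylor_poly_weight_bound N i cw r0 v1 C0 h)).
    by rewrite ler_wpM2r // exprn_ge0 // ltW.
  have gA : Cg <= A by rewrite lerDl.
  have hA : Ch <= A by rewrite lerDr.
  split; [apply: (inA _ Cg)|apply: (inA _ Cg)|apply: (inA _ Ch)|apply: (inA _ Ch)] => // s'.
  - by have [] := hg x s' Vx.
  - by have [] := hg x s' Vx.
  - by have [] := hh x s' Vx.
  - by have [] := hh x s' Vx.
have [hR hI] := joris_pds_bound j0 oV sg sh eN Vx A0 dW0 bT (erefl m).
suff final : 2 ^+ m * (m%:R ^+ m * ((1 + 2 * A) * joris_const%:R ^+ N * (d%:R * W) ^+ m)) <=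
    (1 + 2 * A) * K * expR (wt w (L * rho) m).
  by split; [apply: le_trans hR final|apply: le_trans hI final].
have A1 : 0 <= 1 + 2 * A by rewrite addr_ge0 // mulr_ge0.
rewrite -[leRHS]mulrA; apply: (@le_trans _ _ ((1 + 2 * A) * (D%:R ^+ N * (m%:R * (D%:R * W)) ^+ m))); last first.
  by rewrite ler_wpM2l // hK.
have -> : 2 ^+ m * (m%:R ^+ m * ((1 + 2 * A) * joris_const%:R ^+ N * (d%:R * W) ^+ m)) =
    (1 + 2 * A) * (joris_const%:R ^+ N * (m%:R * ((2 * d)%:R * W)) ^+ m).
  by rewrite natrM !exprMn; ring.
apply: (ler_wpM2l A1); apply: ler_pM.
- by apply: exprn_ge0; exact: ler0n.
- by rewrite exprn_ge0 // mulr_ge0 // mulr_ge0 // ltW.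
- by rewrite lerXn2r ?nnegrE ?ler0n // ler_nat.
rewrite lerXn2r ?nnegrE ?mulr_ge0 ?ler0n ?(ltW W0) //.
by rewrite ler_wpM2l // ler_wpM2r ?(ltW W0) // ler_nat.
Qed.

End UltraJoris.

Section PropertyD.
Variables (R : realType) (d : nat).
Implicit Types (f F : 'rV[R]_d -> R[i]) (U V : set 'rV[R]_d).

Lemma smooth_on_subset U V F : V `<=` U -> smooth_on U F -> smooth_on V F.
Proof. by move=> VU [sR sI]; split => s x /VU Ux; [exact: sR|exact: sI]. Qed.

Lemma rel_compact_open_in_subset U U' V : U `<=` U' ->
  rel_compact_open_in V U -> rel_compact_open_in V U'.
Proof. by move=> UU' [oV [cV VU]]; split => //; split => // x /VU /UU'. Qed.

End PropertyD.

Unset Implicit Arguments.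

Theorem theorem3p2 (R : realType) (w : R -> R) :
  weight_function w -> non_quasianalytic w -> concave_on_nonneg w ->
  forall d : nat, (1 <= d)%N ->
    property_D (@E_roumieu R w d) /\ property_D (@E_beurling R w d).
Proof.
move=> ww _ cw d d1; split=> f j j1 [U1 [oU1 U10 [s1 h1]]] [U2 [oU2 U20 [s2 h2]]].
all: have [L L1 hL] := joris_B_w ww j1 d1 cw.
all: have L0 : 0 < L := lt_le_trans ltr01 L1.
all: have oU : open (U1 `&` U2) by exact: openI.
all: have I1 : U1 `&` U2 `<=` U1 by move=> x [].
all: have I2 : U1 `&` U2 `<=` U2 by move=> x [].
all: exists (U1 `&` U2); split => //; split.
all: try exact: (joris_smooth j1 oU (smooth_on_subset I1 s1) (smooth_on_subset I2 s2)).
  (* Roumieu case: both powers are brought to a common index, which is then multiplied by [L] and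
     rounded up. *)
  move=> V rV; have [oV _] := rV.
  have [n1 [n1_gt0 B1]] := h1 V (rel_compact_open_in_subset I1 rV).
  have [n2 [n2_gt0 B2]] := h2 V (rel_compact_open_in_subset I2 rV).
  pose n := maxn n1 n2.
  have n0 : (0 : R) < n%:R by rewrite ltr0n (leq_trans n1_gt0) // leq_maxl.
  have := hL n%:R V f n0 oV.
  move=> /(_ (B_w_mono ww _ _ B1)); rewrite ltr0n ler_nat leq_maxl => /(_ n1_gt0 isT).
  move=> /(_ (B_w_mono ww _ _ B2)); rewrite ltr0n ler_nat leq_maxr => /(_ n2_gt0 isT) Bf.
  exists (Num.truncn (L * n%:R)).+1; split => //.
  by apply: B_w_mono Bf => //; [exact: mulr_gt0|exact/ltW/truncnS_gt].
move=> V rV n n1; have [oV _] := rV.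
(* Beurling case: to reach 1 / n one starts from 1 / p with p >= L n, available because the
   hypotheses hold for every index. *)
pose p := (Num.truncn (L * n%:R)).+1.
have p0 : (0 : R) < p%:R^-1 by rewrite invr_gt0 ltr0n.
have Bf := hL p%:R^-1 V f p0 oV (h1 V (rel_compact_open_in_subset I1 rV) p isT)
  (h2 V (rel_compact_open_in_subset I2 rV) p isT).
apply: B_w_mono Bf => //; first exact: mulr_gt0.
have n0 : (0 : R) < n%:R by rewrite ltr0n.
rewrite ler_pdivrMr ?ltr0n // mulrC ler_pdivlMr //.
exact/ltW/truncnS_gt.
Qed.
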